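(* Let $M$ be a smooth, compact surface with $\chi(M)=0$, $h$ a flat smooth Riemannian metric on $M$, and $g_0=e^{2\bar p_0}h$ a smooth metric with $\mathrm{area}(M,g_0)=\mathrm{area}(M,h)$. Suppose that there is a smooth solution $\bar p_t$ to the normalized Ricci flow $$\partial_t\bar p_t=e^{-2\bar p_t}\Delta_h\bar p_t$$ with initial condition $\bar p_0$ for all $t\in[0,\infty)$. Then there exist constants $c,C>0$, which depend only on the metrics $g_0$ and $h$, such that $$\sup_{x\in M}|\bar p_t(x)|\le ce^{-Ct}\qquad\text{for all }t\ge0.$$
   Context: $M$ has no boundary. $\Delta_h$ is the Laplacian of $h$. The displayed equation is the normalized Ricci flow for $g_t=e^{2\bar p_t}h$; in the case $\chi(M)=0$ with $h$ flat, the general equation $\partial_t\bar p_t=e^{-2\bar p_t}(\Delta_h\bar p_t-K_h)+2\pi\chi(M)/\mathrm{area}(M,g_0)$ reduces to it.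
   Formalization: The surface M is assumed connected (and nonempty); for disconnected M the claim fails, e.g. on two disjoint flat tori of equal area with different constant values of the initial function chosen so that the total area is preserved. *)

(* Defs.v *)
From HB Require Import structures.
From mathcomp Require Import all_boot all_order all_algebra.
From mathcomp Require Import all_classical all_reals all_analysis.
Set Implicit Arguments.
Unset Strict Implicit.
Unset Printing Implicit Defensive.
Import Order.TTheory GRing.Theory Num.Theory.
Import numFieldNormedType.Exports.
Local Open Scope classical_set_scope.
Local Open Scope ring_scope.

(* C^k on an open set [U], through iterated directional derivatives; for
   finite-dimensional [V] this is the usual notion. *)
Fixpoint Ck (R : realType) (V W : normedModType R) (k : nat) (U : set V)
    (f : V -> W) : Prop :=
  (forall x, U x -> {for x, continuous f}) /\
  match k with
  | 0%N => True
  | k'.+1 => forall v : V,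
      (forall x, U x -> derivable f x v) /\ Ck k' U ('D_v f)
  end.

Definition smooth (R : realType) (V W : normedModType R) (U : set V)
    (f : V -> W) : Prop := forall k, Ck k U f.

(* Smoothness on an arbitrary subset, by local smooth extensions; used for
   smoothness up to the initial time on [0, +oo[ x chart range. *)
Definition smooth_on (R : realType) (V W : normedModType R) (A : set V)
    (f : V -> W) : Prop :=
  forall x, A x -> exists U : set V, exists g : V -> W,
    [/\ open U, U x, smooth U g & forall y, A y -> U y -> f y = g y].

(* [cmap] and [cinv] are total functions, only meaningful on [cdom] and on
   [cmap @` cdom] respectively. *)
Record chart (R : realType) (M : topologicalType) := Chart {
  cdom : set M;
  cmap : M -> 'rV[R]_2;
  cinv : 'rV[R]_2 -> M;
  cdom_open : open cdom;
  cran_open : open (cmap @` cdom);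
  cmapK : forall x, cdom x -> cinv (cmap x) = x;
  cmap_continuous : forall x, cdom x -> {for x, continuous cmap};
  cinv_continuous :
    forall y, (cmap @` cdom) y -> {for y, continuous cinv} }.

Definition cran (R : realType) (M : topologicalType) (phi : chart R M) :
    set 'rV[R]_2 := cmap phi @` cdom phi.

Definition transition (R : realType) (M : topologicalType)
    (phi psi : chart R M) : 'rV[R]_2 -> 'rV[R]_2 :=
  cmap psi \o cinv phi.

Definition overlap (R : realType) (M : topologicalType)
    (phi psi : chart R M) : set 'rV[R]_2 :=
  cmap phi @` (cdom phi `&` cdom psi).

(* Two-dimensional smooth manifolds without boundary; the atlas need not be
   maximal. The carrier is pointed, hence nonempty. *)
Record smooth_surface (R : realType) := SmoothSurface {
  carrier :> ptopologicalType;
  atlas : set (chart R carrier);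
  surface_hausdorff : hausdorff_space carrier;
  surface_second_countable : @second_countable carrier;
  atlas_cover : forall x : carrier, exists2 phi, atlas phi & cdom phi x;
  atlas_smooth : forall phi psi, atlas phi -> atlas psi ->
    smooth (overlap phi psi) (transition phi psi) }.

(* A metric is given by its coefficient matrix in each chart of the atlas,
   with row vectors as coordinates of tangent vectors. *)
Record riemannian_metric (R : realType) (M : smooth_surface R) :=
  RiemannianMetric {
  gmat : chart R M -> 'rV[R]_2 -> 'M[R]_2;
  gmat_smooth : forall phi, atlas phi -> forall i j : 'I_2,
    smooth (cran phi) (fun y => gmat phi y i j : R^o);
  gmat_sym : forall phi, atlas phi -> forall y, cran phi y ->
    (gmat phi y)^T = gmat phi y;
  gmat_pos : forall phi, atlas phi -> forall y, cran phi y ->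
    forall v : 'rV[R]_2, v != 0 -> 0 < (v *m gmat phi y *m v^T) 0 0;
  gmat_transition : forall phi psi, atlas phi -> atlas psi ->
    forall y, overlap phi psi y -> forall v w : 'rV[R]_2,
    v *m gmat phi y *m w^T =
      'D_v (transition phi psi) y *m gmat psi (transition phi psi y)
        *m ('D_w (transition phi psi) y)^T }.

(* The relation [g = e^{2u} h]. *)
Definition conformal (R : realType) (M : smooth_surface R)
    (u : M -> R) (h g : riemannian_metric M) : Prop :=
  forall phi, atlas phi -> forall y, cran phi y ->
    gmat g phi y = expR (2 * u (cinv phi y)) *: gmat h phi y.

Definition partial (R : realType) (i : 'I_2) (f : 'rV[R]_2 -> R) :
    'rV[R]_2 -> R :=
  fun y => 'D_(delta_mx 0 i) (f : 'rV[R]_2 -> R^o) y.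

Definition christoffel (R : realType) (g : 'rV[R]_2 -> 'M[R]_2)
    (i j k : 'I_2) (y : 'rV[R]_2) : R :=
  2^-1 * \sum_(l < 2) invmx (g y) k l *
    (partial i (fun z => g z j l) y + partial j (fun z => g z i l) y
     - partial l (fun z => g z i j) y).

(* R(d_i, d_j) d_k = \sum_l (riemann g i j k l) d_l, where
   R(X, Y) = [nabla_X, nabla_Y] - nabla_[X, Y]. *)
Definition riemann (R : realType) (g : 'rV[R]_2 -> 'M[R]_2)
    (i j k l : 'I_2) (y : 'rV[R]_2) : R :=
  partial i (christoffel g j k l) y - partial j (christoffel g i k l) y
  + \sum_(m < 2) (christoffel g j k m y * christoffel g i m l y
                  - christoffel g i k m y * christoffel g j m l y).

(* K = <R(d_0, d_1) d_1, d_0> / det g *)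
Definition gaussian_curvature (R : realType) (g : 'rV[R]_2 -> 'M[R]_2)
    (y : 'rV[R]_2) : R :=
  (\sum_(l < 2) riemann g 0 1 1 l y * g y l 0) / \det (g y).

Definition flat (R : realType) (M : smooth_surface R)
    (h : riemannian_metric M) : Prop :=
  forall phi, atlas phi -> forall y, cran phi y ->
    gaussian_curvature (gmat h phi) y = 0.

(* Laplace-Beltrami operator in coordinates (analyst's sign). *)
Definition laplacian_coord (R : realType) (g : 'rV[R]_2 -> 'M[R]_2)
    (f : 'rV[R]_2 -> R) (y : 'rV[R]_2) : R :=
  (Num.sqrt (\det (g y)))^-1 *
  \sum_(i < 2) partial i (fun z => Num.sqrt (\det (g z)) *
    \sum_(j < 2) invmx (g z) i j * partial j f z) y.

(* The value at [x] of the Laplacian of [f], computed in a chart [phi] of the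
   atlas around [x]; it does not depend on [phi] when [f] is smooth. *)
Definition laplacian (R : realType) (M : smooth_surface R)
    (h : riemannian_metric M) (phi : chart R M) (f : M -> R) (x : M) : R :=
  laplacian_coord (gmat h phi) (f \o cinv phi) (cmap phi x).

Definition row2 (R : realType) (z : R * R) : 'rV[R]_2 :=
  \row_(j < 2) (if j == 0 then z.1 else z.2).

(* [mu] is the Riemannian measure of [g]: in every chart its density is
   sqrt(det g). The surface need not be orientable. *)
Definition is_area_measure (R : realType) (M : smooth_surface R)
    (g : riemannian_metric M)
    (mu : {measure set (g_sigma_algebraType (@open M)) -> \bar R}) : Prop :=
  forall phi, atlas phi ->
  forall E : set (g_sigma_algebraType (@open M)),
    measurable E -> E `<=` cdom phi ->
    mu E = (\int[lebesgue_measure \x lebesgue_measure]_(z in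
              [set z : R * R | (cmap phi @` E) (row2 z)])
              (Num.sqrt (\det (gmat g phi (row2 z))))%:E)%E.

(* The total area of [g] is [a]. The Riemannian measure of a metric exists and
   is unique, so [a] is determined by [g]. *)
Definition has_area (R : realType) (M : smooth_surface R)
    (g : riemannian_metric M) (a : \bar R) : Prop :=
  exists2 mu : {measure set (g_sigma_algebraType (@open M)) -> \bar R},
    is_area_measure g mu & mu [set: M] = a.

(* Nonempty simplices on the vertex set 'I_n. *)
Definition simplicial_complex (n : nat) (K : {set {set 'I_n}}) : Prop :=
  finset.set0 \notin K /\
  forall s t : {set 'I_n}, s \in K -> t \subset s -> t != finset.set0 -> t \in K.

Definition geometric_realization (R : realType) (n : nat)
    (K : {set {set 'I_n}}) : set 'rV[R]_n :=
  [set w | [/\ forall i, 0 <= w 0 i, \sum_i w 0 i = 1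
             & [set i | w 0 i != 0]%SET \in K]].

Definition complex_euler_char (n : nat) (K : {set {set 'I_n}}) : int :=
  \sum_(s in K) (-1) ^+ (#|s|).-1.

Definition homeomorphic_to_subset (S T : topologicalType) (A : set S) : Prop :=
  exists f : S -> T, exists g : T -> S,
    [/\ {within A, continuous f}, continuous g,
        forall w, A w -> g (f w) = w
      & forall x, A (g x) /\ f (g x) = x].

(* The Euler characteristic of [M] is [chi], computed from a triangulation. *)
Definition has_euler_char (R : realType) (M : smooth_surface R) (chi : int) :
    Prop :=
  exists n : nat, exists K : {set {set 'I_n.+1}},
    [/\ simplicial_complex K,
        homeomorphic_to_subset M (@geometric_realization R n.+1 K)
      & complex_euler_char K = chi].

Definition smooth_in_space_time (R : realType) (M : smooth_surface R)
    (p : R -> M -> R) : Prop :=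
  forall phi, atlas phi ->
    smooth_on [set z : R^o * 'rV[R]_2 | 0 <= (z.1 : R) /\ cran phi z.2]
      (fun z => p z.1 (cinv phi z.2) : R^o).

(* The time derivative is one-sided at t = 0. *)
Definition normalized_ricci_flow_solution (R : realType) (M : smooth_surface R)
    (h : riemannian_metric M) (p : R -> M -> R) : Prop :=
  smooth_in_space_time p /\
  forall (t : R) (x : M) (phi : chart R M), 0 <= t -> atlas phi -> cdom phi x ->
    (fun s : R => (p s x - p t x) / (s - t)) @ within [set s : R | 0 <= s] t^'
      --> expR (- 2 * p t x) * laplacian h phi (p t) x.

(* Main.v *)
(* Along the flow, [p] satisfies a parabolic equation without zeroth-order term,
   so the maximum principle bounds [p]. Since the metric [h] is flat, Bochner's
   formula shows that e^(-2p) |grad p|^2 is a subsolution, and Bernstein's trick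
   applied to (t - s) e^(-2p) |grad p|^2 + (p - m)^2 / 2 turns a bound on the
   oscillation of [p] at time [s] into a bound on its gradient at time [t]. On a
   compact connected surface the gradient controls the oscillation, so the
   oscillation is halved over a fixed time lapse and decays exponentially.
   The area, i.e. the integral of e^(2p) for the area measure of [h], has
   derivative twice the integral of the Laplacian of [p], hence is constant; as it
   equals the area of [h], [p] takes a nonpositive and a nonnegative value at each
   time and is bounded by its oscillation. *)
Require Import Defs.
From HB Require Import structures.
From mathcomp Require Import all_boot all_order all_algebra.
From mathcomp Require Import all_classical all_reals all_analysis.
From mathcomp Require Import ring lra measurable_realfun.
Set Implicit Arguments.
Unset Strict Implicit.
Unset Printing Implicit Defensive.
Import Order.TTheory GRing.Theory Num.Theory.
Import numFieldNormedType.Exports.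
Local Open Scope classical_set_scope.
Local Open Scope ring_scope.

(** * Calculus on normed modules and on the plane *)

(** The constants must be fixed before the solution is known, so everything is reduced to two
    numbers: [D], the oscillation allowed by a unit gradient, which depends on [h] alone, and [B], a
    bound of the initial value. Since [B] persists, the weight e^(-2p) is at least e^(-2B), and the
    lapse 2 D^2 e^(2B) is what turns Bernstein's bound into half the oscillation. The weight makes
    the computation close: e^(-2p) |grad p|^2 is the squared gradient for the evolving metric e^(2p)
    h, and its defect in the heat equation of that metric is twice the squared norm of the Hessian
    of p for that same metric. Smoothness at time 0 is given only through local extensions. Hence
    all differentiation happens at positive times, and time 0 enters by continuity alone, both in
    the maximum principle for p and in the conservation of area. The integral of the Laplacian is
    computed with a partition of unity by cutoffs that are merely C^1: they are differentiated once,
    and their gradients add up to zero. *)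

Section SmoothFunctions.
Context {R : realType} {V : normedModType R}.
Implicit Types (U : set V) (f g : V -> R^o) (x v w : V) (k : nat).

Lemma Ck_W (W : normedModType R) k U (f : V -> W) : Ck k.+1 U f -> Ck k U f.
Proof.
elim: k f => [|k IH] f; first by case.
move=> [cf Df]; split=> // v; have [dv Dv] := Df v; split=> //; exact: IH.
Qed.

Lemma Ck_continuous (W : normedModType R) k U (f : V -> W) :
  Ck k U f -> forall x, U x -> {for x, continuous f}.
Proof. by case: k => [|k] []. Qed.

Lemma derive_line (W : normedModType R) (f : V -> W) x v :
  'D_1 (fun h : R => f (h *: v + x)) 0 = 'D_v f x.
Proof.
rewrite /derive; set g1 := fun h => h^-1 *: _; set g2 := fun h => h^-1 *: _.
suff -> : g1 = g2 by [].
by rewrite funeqE /g1 /g2 => h /=; rewrite addr0 scale0r add0r [_%:A]mulr1.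
Qed.

Lemma open_near U (P : set V) x : open U -> U x -> (forall y, U y -> P y) ->
  \forall y \near x, P y.
Proof. move=> oU Ux UP; apply: filterS UP _; exact: open_nbhs_nbhs. Qed.

Lemma derive_ext (W : normedModType R) U (f g : V -> W) x v :
  open U -> U x -> (forall y, U y -> f y = g y) -> 'D_v f x = 'D_v g x.
Proof.
by move=> oU Ux fg; apply: near_eq_derive; apply: open_near fg.
Qed.

Lemma derivable_ext (W : normedModType R) U (f g : V -> W) x v :
  open U -> U x -> (forall y, U y -> f y = g y) ->
  derivable f x v -> derivable g x v.
Proof.
by move=> oU Ux fg; apply: near_eq_derivable; apply: open_near fg.
Qed.

Lemma continuous_ext (T S : topologicalType) (U : set T) (f g : T -> S) (x : T) :
  open U -> U x -> (forall y, U y -> f y = g y) ->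
  {for x, continuous f} -> {for x, continuous g}.
Proof.
move=> oU Ux fg cf; rewrite /prop_for /continuous_at -(fg _ Ux).
apply: cvg_trans cf; apply: near_eq_cvg.
by apply: filterS fg _; exact: open_nbhs_nbhs.
Qed.

Lemma Ck_ext (W : normedModType R) k U (f g : V -> W) :
  open U -> (forall y, U y -> f y = g y) -> Ck k U f -> Ck k U g.
Proof.
move=> oU; elim: k f g => [|k IH] f g fg [cf Df].
  by split=> // x Ux; exact: (continuous_ext oU Ux fg (cf _ Ux)).
split=> [x Ux|v]; first exact: (continuous_ext oU Ux fg (cf _ Ux)).
have [dv Dv] := Df v; split=> [x Ux|]; first exact: (derivable_ext oU Ux fg (dv _ Ux)).
by apply: IH Dv => y Uy; exact: (derive_ext v oU Uy fg).
Qed.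

Lemma Ck_sub (W : normedModType R) k U U' (f : V -> W) :
  U' `<=` U -> Ck k U f -> Ck k U' f.
Proof.
move=> UU; elim: k f => [|k IH] f [cf Df].
  by split=> // x /UU; exact: cf.
split=> [x /UU|v]; first exact: cf.
by have [dv Dv] := Df v; split=> [x /UU|]; [exact: dv|exact: IH].
Qed.

Lemma Ck_cst k U (c : R) : Ck k U (fun=> c : R^o).
Proof.
elim: k c => [|k IH] c; split=> //; try by move=> *; exact: cvg_cst.
move=> v; split=> [x _|]; first exact: derivable_cst.
by have -> : 'D_v (fun=> c : R^o) = (fun=> (0 : R^o)) :> (V -> _) by
  apply/funext => x; exact: derive_cst.
Qed.

Lemma CkD k U f g : open U -> Ck k U f -> Ck k U g ->
  Ck k U (fun x => f x + g x : R^o).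
Proof.
move=> oU; elim: k f g => [|k IH] f g [cf Df] [cg Dg].
  by split=> // x Ux; apply: cvgD; [exact: cf|exact: cg].
split=> [x Ux|v]; first by apply: cvgD; [exact: cf|exact: cg].
have [dfv Dfv] := Df v; have [dgv Dgv] := Dg v; split=> [x Ux|].
  by apply: derivableD; [exact: dfv|exact: dgv].
apply: Ck_ext (IH _ _ Dfv Dgv) => // x Ux.
by rewrite (deriveD (dfv _ Ux) (dgv _ Ux)).
Qed.

Lemma CkM k U f g : open U -> Ck k U f -> Ck k U g ->
  Ck k U (fun x => f x * g x : R^o).
Proof.
move=> oU; elim: k f g => [|k IH] f g Cf Cg.
  split=> // x Ux; apply: (@cvgM R); first exact: (Ck_continuous Cf).
  exact: (Ck_continuous Cg).
have [cf Df] := Cf; have [cg Dg] := Cg.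
split=> [x Ux|v]; first by apply: (@cvgM R); [exact: cf|exact: cg].
have [dfv Dfv] := Df v; have [dgv Dgv] := Dg v; split=> [x Ux|].
  by apply: derivableM; [exact: dfv|exact: dgv].
have := CkD oU (IH _ _ (Ck_W Cf) Dgv) (IH _ _ (Ck_W Cg) Dfv).
by apply: Ck_ext => // x Ux; rewrite (deriveM (dfv _ Ux) (dgv _ Ux)).
Qed.

Lemma CkN k U f : open U -> Ck k U f -> Ck k U (fun x => - f x : R^o).
Proof.
move=> oU Cf; apply: Ck_ext (CkM oU (Ck_cst k U (-1)) Cf) => // x _.
by rewrite mulN1r.
Qed.

Lemma is_derive_chain f (phi : R -> R) (d : R) x v : derivable f x v ->
  is_derive (f x : R) 1 phi d ->
  is_derive x v (fun z => phi (f z) : R^o) ('D_v f x * d).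
Proof.
move=> /derivable1P dv dphi.
have d1 : is_derive (0 : R) 1 (fun h : R => f (h *: v + x)) ('D_v f x).
  by apply: DeriveDef => //; rewrite derive_line.
have d2 : is_derive ((fun h : R => f (h *: v + x)) 0) 1 phi d.
  by rewrite scale0r add0r.
have d3 := is_derive1_comp d2 d1.
apply: DeriveDef; first by apply/derivable1P; case: d3.
by rewrite mulrC; case: d3 => _ <-; exact/esym/derive_line.
Qed.

(* When [phi'] is a rational expression in [phi] and [id], the last hypothesis
   is immediate: smoothness of [phi \o f] follows by induction on the order. *)
Lemma Ck_comp k U f (phi phi' : R -> R) : open U -> Ck k U f ->
  (forall x, U x -> is_derive (f x : R) 1 phi (phi' (f x))) ->
  (forall j, (j < k)%N -> Ck j U (fun x => phi (f x) : R^o) ->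
     Ck j U (fun x => phi' (f x) : R^o)) ->
  Ck k U (fun x => phi (f x) : R^o).
Proof.
move=> oU Cf dphi Hphi.
elim: k Cf Hphi => [|k IH] Cf Hphi.
  split=> // x Ux; apply: continuous_comp; first exact: (Ck_continuous Cf).
  have := dphi _ Ux => -[+ _].
  by move=> /derivable1_diffP /differentiable_continuous.
have [cf Df] := Cf.
have Ck' : Ck k U (fun x => phi (f x) : R^o).
  by apply: IH => [|j jk]; [exact: Ck_W|apply: Hphi; exact: ltnW].
split=> [|v]; first exact: (Ck_continuous Ck').
have [dfv Dfv] := Df v; split=> [x Ux|].
  by have [] := is_derive_chain (dfv _ Ux) (dphi _ Ux).
have := CkM oU Dfv (Hphi _ (ltnSn _) Ck').
apply: Ck_ext => // x Ux.
by have := is_derive_chain (dfv _ Ux) (dphi _ Ux) => -[_ ->].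
Qed.

Lemma Ck_expR k U f : open U -> Ck k U f -> Ck k U (fun x => expR (f x) : R^o).
Proof. by move=> oU Cf; apply: (@Ck_comp _ _ _ _ expR). Qed.

Lemma CkV k U f : open U -> (forall x, U x -> f x != 0) -> Ck k U f ->
  Ck k U (fun x => (f x)^-1 : R^o).
Proof.
move=> oU f0 Cf.
apply: (@Ck_comp _ _ _ (fun y : R => y^-1) (fun y : R => - (y^-1 * y^-1))) => //.
  move=> x Ux; have := @is_deriveV R (@id R) (f x) 1 1 (f0 _ Ux) (is_derive_id _ _).
  by rewrite [_ *: _]mulr1 -exprVn expr2.
by move=> j jk Cj; apply: CkN => //; exact: CkM.
Qed.

Lemma Ck_sqrt k U f : open U -> (forall x, U x -> 0 < f x :> R) -> Ck k U f ->
  Ck k U (fun x => Num.sqrt (f x) : R^o).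
Proof.
move=> oU f0 Cf.
apply: (@Ck_comp _ _ _ Num.sqrt (fun y : R => (2 * Num.sqrt y)^-1)) => //.
  by move=> x Ux; apply: is_derive1_sqrt; exact: f0.
move=> j jk Cj; apply: CkV => // [x Ux|].
  by rewrite mulf_neq0 ?pnatr_eq0// gt_eqF// sqrtr_gt0; exact: f0.
by apply: (CkM oU _ Cj); exact: Ck_cst.
Qed.

End SmoothFunctions.

(** * Mean value theorem along lines and symmetry of second derivatives *)

Section MeanValue.
Context {R : realType} {V : normedModType R}.
Implicit Types (U : set V) (f g : V -> R^o) (x v w : V).

Lemma is_derive_line f x v (h : R) : derivable f (h *: v + x) v ->
  is_derive h 1 (fun s : R => f (s *: v + x) : R^o) ('D_v f (h *: v + x)).
Proof.
pose g (s : R) : R^o := f (s *: v + x) => dv; rewrite -/g.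
have E : (fun s : R => f (s *: v + (h *: v + x))) = (fun s : R => g (s *: (1 : R) + h)).
  by apply/funext => s; rewrite /g addrA -scalerDl [s *: 1]mulr1.
have := (@derivable1P R V R^o f _ v).1 dv; rewrite E => dg.
apply: DeriveDef; first exact: (@derivable1P R R R^o g h 1).2.
by rewrite -(@derive_line R R R^o g) -E derive_line.
Qed.

Lemma mvt_line f x v (d : R) :
  (forall s : R, `|s| <= `|d| -> derivable f (s *: v + x) v) ->
  exists2 s : R, `|s| <= `|d| & f (d *: v + x) - f x = d * 'D_v f (s *: v + x).
Proof.
move=> dv; pose g (s : R) : R := f (s *: v + x).
have g0 : g 0 = f x by rewrite /g scale0r add0r.
have gd (s : R) : `|s| <= `|d| -> is_derive s 1 g ('D_v f (s *: v + x)).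
  by move=> sd; apply: is_derive_line; exact: dv.
have gc (a b : R) : (forall s : R, s \in `[a, b]%R -> `|s| <= `|d|) ->
    {within `[a, b], continuous g}.
  move=> ab; apply: derivable_within_continuous => s /ab /gd[].
  by [].
have [d0|d0] := leP 0 d.
  have ab (s : R) : s \in `[0, d]%R -> `|s| <= `|d|.
    by rewrite in_itv /= => /andP[s0 sd]; rewrite !ger0_norm.
  have gdi (s : R) : s \in `]0, d[%R -> is_derive s 1 g ('D_v f (s *: v + x)).
    by move=> sd; apply/gd/ab; exact: subset_itv_oo_cc.
  have [s /ab sd] := MVT_segment d0 gdi (gc _ _ ab).
  by rewrite subr0 g0 mulrC => E; exists s.
have ab (s : R) : s \in `[d, 0]%R -> `|s| <= `|d|.
  by rewrite in_itv /= => /andP[sd s0]; rewrite !ler0_norm ?lerN2// ltW.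
have gdi (s : R) : s \in `]d, 0[%R -> is_derive s 1 g ('D_v f (s *: v + x)).
  by move=> sd; apply/gd/ab; exact: subset_itv_oo_cc.
have [s /ab sd] := MVT_segment (ltW d0) gdi (gc _ _ ab).
by rewrite sub0r g0 mulrN => E; exists s => //; apply: oppr_inj; rewrite opprB E mulrC.
Qed.

Lemma ball_line U x v w : open U -> U x -> \forall h \near (0 : R),
  forall s t : R, `|s| <= `|h| -> `|t| <= `|h| -> U (s *: v + (t *: w + x)).
Proof.
move=> oU Ux; have : nbhs x U by exact: open_nbhs_nbhs.
move=> /nbhs_ballP[e /= e0 eU].
have C0 : 0 < `|v| + `|w| + 1 by rewrite ltr_wpDl// addr_ge0.
near=> h => s t sh th; apply: eU; rewrite -ball_normE /ball_ /= distrC addrA addrK.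
apply: le_lt_trans (ler_normD _ _) _; rewrite !normrZ.
apply: (@le_lt_trans _ _ (`|h| * (`|v| + `|w| + 1))).
  rewrite -addrA mulrDr lerD// ?ler_wpM2r// mulrDr mulr1 -[leLHS]addr0 lerD//.
  exact: ler_wpM2r.
rewrite -ltr_pdivlMr//; near: h.
by apply: (@nbhs0_lt R R); rewrite divr_gt0.
Unshelve. all: by end_near. Qed.

(** Two mean value theorems: one in direction [v] for the increment of [f] along [h *: w], then one
    in direction [w] for ['D_v f]. Continuity of the iterated derivative at [x] absorbs the
    intermediate point. *)
Lemma second_difference f U x v w : open U -> U x -> Ck 2 U f ->
  forall e : R, 0 < e -> \forall h \near (0 : R),
    `|f (h *: v + (h *: w + x)) - f (h *: v + x) - f (h *: w + x) + f x
      - h * h * 'D_w ('D_v f) x| <= h * h * e.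
Proof.
move=> oU Ux Cf e e0.
have [_ Df] := Cf; have [dv Dv] := Df v.
have [_ /(_ w)[dvw [cvw _]]] := Dv.
have /cvgrPdist_le /(_ _ e0) cxe := cvw _ Ux.
pose U' := [set y | U y /\ `|'D_w ('D_v f) x - 'D_w ('D_v f) y| <= e].
have : nbhs x (interior U').
  by apply: nbhs_interior; apply: filterI cxe; exact: open_nbhs_nbhs.
move=> /nbhs_singleton U'x; have oU' := @open_interior _ U'.
near=> h.
have Hh : forall s t : R, `|s| <= `|h| -> `|t| <= `|h| ->
    U' (s *: v + (t *: w + x)).
  move=> s t sh th; apply: interior_subset; move: s t sh th; near: h.
  exact: ball_line.
have UU y : U' y -> U y by case.
pose g y := f (h *: w + y) - f y : R^o.
have dg (s : R) : `|s| <= `|h| -> is_derive (s *: v + x) v g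
    ('D_v f (s *: v + (h *: w + x)) - 'D_v f (s *: v + x)).
  move=> sh.
  have d1 : is_derive (s *: v + x) v (fun y => f (h *: w + y))
      ('D_v f (s *: v + (h *: w + x))).
    pose k y := f (h *: w + y) : R^o.
    have E : (fun r : R => k (r *: v + (s *: v + x))) =
        (fun r : R => f (r *: v + (s *: v + (h *: w + x)))).
      by apply/funext => r; congr f; rewrite addrCA; congr (_ + _); rewrite addrCA.
    have /dv dvy : U (s *: v + (h *: w + x)) by apply/UU/Hh.
    have := (@derivable1P R V R^o f _ v).1 dvy; rewrite -E => dk.
    rewrite -/k; apply: DeriveDef; first exact: (@derivable1P R V R^o k _ v).2.
    by rewrite -(@derive_line R V R^o k) E derive_line.
  have d2 : is_derive (s *: v + x) v f ('D_v f (s *: v + x)).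
    apply: derivableP; apply/dv/UU; rewrite -[x in _ + x]add0r -(scale0r w).
    by apply: Hh; rewrite ?normr0.
  exact: is_deriveB.
have [|s sh gs] := @mvt_line g x v h; first by move=> s /dg[].
have [|t th ft] := @mvt_line ('D_v f) (s *: v + x) w h.
  move=> t th; apply/dvw/UU; rewrite addrCA; exact: Hh.
have -> : f (h *: v + (h *: w + x)) - f (h *: v + x) - f (h *: w + x) + f x =
    h * h * 'D_w ('D_v f) (t *: w + (s *: v + x)).
  transitivity (g (h *: v + x) - g x); first by rewrite /g addrCA; ring.
  rewrite gs; have [_ ->] := dg _ sh.
  by rewrite addrCA ft mulrA.
rewrite -mulrBr normrM -expr2 ger0_norm ?sqr_ge0// ler_wpM2l ?sqr_ge0//.
by rewrite distrC addrCA; have [] := Hh s t sh th.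
Unshelve. all: by end_near. Qed.

(** The second difference is symmetric in [v] and [w], so both iterated derivatives are within
    [e / 2] of the same number, its quotient by [h * h]. *)
Lemma derive_comm f U x v w : open U -> U x -> Ck 2 U f ->
  'D_w ('D_v f) x = 'D_v ('D_w f) x.
Proof.
move=> oU Ux Cf; apply/eqP; rewrite -subr_eq0 -normr_le0; apply/ler_addgt0Pr => e e0.
rewrite add0r.
have e2 : 0 < e / 2 by rewrite divr_gt0.
have H1 := second_difference v w oU Ux Cf e2.
have H2 := second_difference w v oU Ux Cf e2.
have [r /= r0 rH] := (nbhs_ballP (0 : R) _).1 (filterI H1 H2).
have [] := rH (r / 2).
  by rewrite /ball /= sub0r normrN ger0_norm ?divr_ge0 ?(ltW r0)//; lra.
set h := r / 2; have h0 : 0 < h by rewrite divr_gt0.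
rewrite [h *: w + (h *: v + x)]addrCA.
set A := f _; set B := f _; set C := f _; set a := 'D_w _ x; set b := 'D_v _ x.
move=> Ha Hb.
have hh : 0 < h * h by rewrite mulr_gt0.
rewrite -(ler_pM2l hh) -{1}(gtr0_norm hh) -normrM.
have -> : h * h * (a - b) = (A - C - B + f x - h * h * b) - (A - B - C + f x - h * h * a).
  by ring.
apply: le_trans (ler_normB _ _) _; apply: le_trans (lerD Hb Ha) _.
by rewrite -mulrDr -splitr.
Qed.

End MeanValue.

(** * Total differentiability and the chain rule in the plane *)

Section Plane.
Context {R : realType}.
Local Notation P := 'rV[R]_2.
Implicit Types (U : set P) (f g : P -> R^o) (x v w : P).

Definition e_ (i : 'I_2) : P := delta_mx 0 i.

Lemma e_E i j : e_ i 0 j = (j == i)%:R.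
Proof. by rewrite mxE. Qed.

Lemma rowE2 v : v = v 0 0 *: e_ 0 + v 0 1 *: e_ 1.
Proof.
apply/rowP => -[[|[|//]] j]; rewrite !mxE /= ?mulr1 ?mulr0 ?addr0 ?add0r;
by congr (v _ _); apply/val_inj.
Qed.

Lemma norm_e i : `|e_ i| = 1.
Proof.
rewrite /Num.norm /= mx_normrE; apply/eqP; rewrite eq_le; apply/andP; split.
  apply: bigmax_le => // -[a b] _; rewrite !mxE /=.
  by case: (_ && _); rewrite ?normr1 ?normr0.
apply: (le_trans _ (le_bigmax _ _ (0, i))).
by rewrite !mxE /= !eqxx normr1.
Qed.

Lemma coord_le v i : `|v 0 i| <= `|v|.
Proof. by rewrite [leRHS]/Num.norm /= mx_normrE; exact: (le_bigmax _ _ (0, i)). Qed.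

(** [Ck] speaks only of directional derivatives. Walking first along [e_ 1], then along [e_ 0], with
    a mean value theorem on each leg, turns their continuity into a first order expansion. *)
Lemma C1_increment U f x : open U -> U x -> Ck 1 U f ->
  forall e : R, 0 < e -> \forall v \near (0 : P),
    `|f (v + x) - f x - (v 0 0 * partial 0 f x + v 0 1 * partial 1 f x)|
      <= e * `|v|.
Proof.
move=> oU Ux Cf e e0; have [_ Df] := Cf.
have near_e i : nbhs x [set y | U y /\ `|partial i f x - partial i f y| <= e / 2].
  apply: filterI; first exact: open_nbhs_nbhs.
  have [_ [cD _]] := Df (e_ i).
  by have /cvgrPdist_le := cD _ Ux; apply; rewrite divr_gt0.
have [r /= r0 rU] := (nbhs_ballP x _).1 (filterI (near_e 0) (near_e 1)).
near=> v.
have vr : `|v| < r / 2.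
  near: v; apply: (@nbhs0_lt R P); by rewrite divr_gt0.
have inU (s t : R) : `|s| <= `|v| -> `|t| <= `|v| ->
    ball x r (s *: e_ 0 + (t *: e_ 1 + x)).
  move=> sv tv; rewrite -ball_normE /ball_ /= distrC addrA addrK.
  apply: le_lt_trans (ler_normD _ _) _; rewrite !normrZ !norm_e !mulr1.
  by apply: le_lt_trans (lerD sv tv) _; rewrite [r]splitr ltrD.
have sum0 i (t : R) : t *: e_ i + x = (0 : R) *: e_ (i + 1) + (t *: e_ i + x).
  by rewrite scale0r add0r.
have [s sv fs] : exists2 s : R, `|s| <= `|v 0 0| &
    f (v 0 0 *: e_ 0 + (v 0 1 *: e_ 1 + x)) - f (v 0 1 *: e_ 1 + x) =
    v 0 0 * partial 0 f (s *: e_ 0 + (v 0 1 *: e_ 1 + x)).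
  apply: mvt_line => s sv; have [d _] := Df (e_ 0); apply: d.
  have [[]] := rU _ (inU s (v 0 1) (le_trans sv (coord_le _ _)) (coord_le _ _)).
  by [].
have [t tv ft] : exists2 t : R, `|t| <= `|v 0 1| &
    f (v 0 1 *: e_ 1 + x) - f x = v 0 1 * partial 1 f (t *: e_ 1 + x).
  apply: mvt_line => t tv; have [d _] := Df (e_ 1); apply: d.
  have := inU 0 t _ (le_trans tv (coord_le _ _)); rewrite normr0 => /(_ (normr_ge0 _)).
  by rewrite scale0r add0r => /rU[[]].
have -> : v + x = v 0 0 *: e_ 0 + (v 0 1 *: e_ 1 + x) by rewrite addrA -rowE2.
have tele (a b c m n : R) : a - c - (m + n) = (a - b - m) + (b - c - n) by ring.
rewrite (tele _ (f (v 0 1 *: e_ 1 + x))).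
apply: (le_trans (ler_normD _ _)).
rewrite {1}fs ft -!mulrBr !normrM [e]splitr mulrDl.
apply: lerD; rewrite mulrC ler_pM// ?coord_le// distrC.
  by have [[]] := rU _ (inU s (v 0 1) (le_trans sv (coord_le _ _)) (coord_le _ _)).
have := inU 0 t _ (le_trans tv (coord_le _ _)); rewrite normr0 => /(_ (normr_ge0 _)).
by rewrite scale0r add0r => /rU[_ []].
Unshelve. all: by end_near. Qed.

(** Changes of charts call for the chain rule, which directional derivatives alone do not give;
    hence the passage to a total derivative. *)
Lemma C1_differentiable U f x : open U -> U x -> Ck 1 U f ->
  differentiable f x.
Proof.
move=> oU Ux Cf.
pose df (v : P) : R^o := v 0 0 * partial 0 f x + v 0 1 * partial 1 f x.
have dfl : linear df.
  by move=> a u w; rewrite /df !mxE /GRing.scale /=; ring.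
pose dfL := GRing.isLinear.Build R P R^o *:%R df dfl.
pose dfl' : {linear P -> R^o} := HB.pack df dfL.
have cM i (b : R) : continuous (fun v : P => v 0 i * b : R).
  move=> y; apply: (@cvgM R P (nbhs y) _ (fun v : P => v 0 i) (fun=> b)).
    exact: (@coord_continuous R 1 2 0 i).
  exact: cvg_cst.
have dfc : continuous dfl'.
  by move=> y; exact: (cvgD (cM 0 (partial 0 f x) y) (cM 1 (partial 1 f x) y)).
have D := @diff_unique R P R^o f dfl' x dfc.
match type of D with ?A -> _ => have E : A end.
  apply/(@eqaddoP R P R^o P) => e e0; have := C1_increment oU Ux Cf e0.
  by apply: filterS => v; rewrite -addrA -opprD.
by apply/diff_locallyP; rewrite (D E); split.
Qed.

Lemma derive_chain (V : normedModType R) (T : V -> P) f (z v : V) :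
  derivable T z v -> differentiable f (T z) ->
  is_derive z v (f \o T)
    (('D_v T z) 0 0 * partial 0 f (T z) + ('D_v T z) 0 1 * partial 1 f (T z)).
Proof.
move=> dT df.
pose c (h : R) : P := T (h *: v + z).
have c0 : c 0 = T z by rewrite /c scale0r add0r.
have dc1 : derivable c 0 1 by apply/(@derivable1P R V P T z v).1.
have dc : differentiable c 0 by apply/(@derivable1_diffP R P c 0).
have dfc : differentiable (f \o c) 0.
  by apply: differentiable_comp => //; rewrite c0.
apply: DeriveDef.
  by apply/(@derivable1P R V R^o (f \o T) z v).2/derivable1_diffP.
have Ec : 'd c 0 1 = 'D_v T z by rewrite -deriveE//; exact: derive_line.
rewrite -(@derive_line R V R^o (f \o T) z v) -/(f \o c).
have := @deriveE R R R^o (f \o c) 0 1 dfc; rewrite /comp -/(c _) => ->.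
rewrite diff_comp//=; last by rewrite c0.
rewrite Ec c0 [X in 'd f _ X]rowE2 linearD !linearZ /=.
by rewrite /partial -!deriveE.
Qed.

Lemma derive_partial U f x v : open U -> U x -> Ck 1 U f ->
  'D_v f x = v 0 0 * partial 0 f x + v 0 1 * partial 1 f x.
Proof.
move=> oU Ux Cf; have df := C1_differentiable oU Ux Cf.
by rewrite deriveE// {1}[v]rowE2 linearD !linearZ /= /partial -!deriveE.
Qed.

End Plane.

(** * Bochner's formula and the evolution of the gradient as polynomial identities *)

Section BochnerAlgebra.
Context {R : realType}.

Lemma sum2 (V : nmodType) (F : 'I_2 -> V) : \sum_(i < 2) F i = F 0 + F 1.
Proof.
rewrite big_ord_recl big_ord_recl big_ord0 addr0.
by congr (_ + F _); apply/val_inj.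
Qed.

Lemma forall2 (Q : 'I_2 -> Prop) : Q 0 -> Q 1 -> forall i, Q i.
Proof.
move=> Q0 Q1 [[|[|//]] i]; [move: Q0|move: Q1]; congr Q; exact/val_inj.
Qed.

(* 2-jets of [A] = inverse metric, 1-jets of Christoffel symbols and 3-jets of a
   function at a point; [dC n i j k] is the [n]-th derivative of [C i j k]. *)
Lemma bochner_algebra (A : 'I_2 -> 'I_2 -> R) (C : 'I_2 -> 'I_2 -> 'I_2 -> R)
    (dC : 'I_2 -> 'I_2 -> 'I_2 -> 'I_2 -> R)
    (q1 : 'I_2 -> R) (q2 : 'I_2 -> 'I_2 -> R) (q3 : 'I_2 -> 'I_2 -> 'I_2 -> R) :
  A 1 0 = A 0 1 -> (forall k, C 1 0 k = C 0 1 k) ->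
  (forall n k, dC n 1 0 k = dC n 0 1 k) ->
  q2 1 0 = q2 0 1 -> (forall n, q3 n 1 0 = q3 n 0 1) ->
  (forall n, q3 1 0 n = q3 0 1 n) ->
  (forall k l, dC 0 1 k l - dC 1 0 k l
     + (C 1 k 0 * C 0 0 l - C 0 k 0 * C 1 0 l)
     + (C 1 k 1 * C 0 1 l - C 0 k 1 * C 1 1 l) = 0) ->
  let H i j := q2 i j - \sum_(k < 2) C i j k * q1 k in
  let dH n i j := q3 n i j - (\sum_(k < 2) dC n i j k * q1 k)
                  - \sum_(k < 2) C i j k * q2 n k in
  let dA n i j := - \sum_(l < 2) (C n l i * A l j + C n l j * A i l) in
  let dG m := 2 * \sum_(k < 2) \sum_(l < 2) A k l * H m k * q1 l in
  let ddG n m := 2 * \sum_(k < 2) \sum_(l < 2)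
    (dA n k l * H m k * q1 l + A k l * dH n m k * q1 l + A k l * H m k * q2 n l) in
  let dL n := \sum_(i < 2) \sum_(j < 2) (dA n i j * H i j + A i j * dH n i j) in
  \sum_(m < 2) \sum_(n < 2) A m n * (ddG n m - \sum_(k < 2) C m n k * dG k) =
  2 * \sum_(m < 2) \sum_(n < 2) \sum_(k < 2) \sum_(l < 2)
        A m n * A k l * H m k * H n l
  + 2 * \sum_(k < 2) \sum_(l < 2) A k l * q1 k * dL l.
Proof.
move=> As Cs dCs q2s q3s q3s' flat0 /=.
(* Vanishing curvature is solved for one derivative of the Christoffel symbols, so that after
   substitution the claim is an identity between independent variables, within reach of [ring]. *)
have e k l : dC 0 1 k l = dC 1 0 k l - ((C 1 k 0 * C 0 0 l - C 0 k 0 * C 1 0 l)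
     + (C 1 k 1 * C 0 1 l - C 0 k 1 * C 1 1 l)).
  by apply/eqP; rewrite -subr_eq0 -[X in _ == X](flat0 k l); apply/eqP; ring.
have e0 : dC 0 0 1 0 = dC 1 0 0 0 - ((C 0 1 0 * C 0 0 0 - C 0 0 0 * C 0 1 0)
     + (C 0 1 1 * C 0 1 0 - C 0 0 1 * C 1 1 0)).
  by rewrite -dCs e !Cs.
have e1 : dC 0 0 1 1 = dC 1 0 0 1 - ((C 0 1 0 * C 0 0 1 - C 0 0 0 * C 0 1 1)
     + (C 0 1 1 * C 0 1 1 - C 0 0 1 * C 1 1 1)).
  by rewrite -dCs e !Cs.
have e2 : dC 0 1 1 0 = dC 1 0 1 0 - ((C 1 1 0 * C 0 0 0 - C 0 1 0 * C 0 1 0)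
     + (C 1 1 1 * C 0 1 0 - C 0 1 1 * C 1 1 0)).
  by rewrite e !Cs.
have e3 : dC 0 1 1 1 = dC 1 0 1 1 - ((C 1 1 0 * C 0 0 1 - C 0 1 0 * C 0 1 1)
     + (C 1 1 1 * C 0 1 1 - C 0 1 1 * C 1 1 1)).
  by rewrite e !Cs.
rewrite !sum2 !dCs !Cs !q3s !q3s' ?q3s !q2s !As e0 e1 e2 e3.
move: (A 0 0) (A 0 1) (A 1 1) (C 0 0 0) (C 0 0 1) (C 0 1 0) (C 0 1 1) (C 1 1 0)
  (C 1 1 1) => a b c C000 C001 C010 C011 C110 C111.
move: (dC 0 0 0 0) (dC 0 0 0 1) (dC 1 0 0 0) (dC 1 0 0 1) (dC 1 0 1 0) (dC 1 0 1 1)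
  (dC 1 1 1 0) (dC 1 1 1 1) => ????????.
move: (q1 0) (q1 1) (q2 0 0) (q2 0 1) (q2 1 1) (q3 0 0 0) (q3 0 0 1) (q3 0 1 1) (q3 1 1 1) => ?????????.
ring.
Qed.

(** For the entries [p], [q], [r] of an inverse metric, the vectors [(a, b)] and [(0, c)] form an
    orthonormal frame of the metric. *)
Lemma cholesky2 (p q r : R) : 0 < p -> 0 < p * r - q ^+ 2 ->
  exists a b c : R, [/\ p = a ^+ 2, q = a * b & r = b ^+ 2 + c ^+ 2].
Proof.
move=> p0 d0; pose a := Num.sqrt p; pose b := q / a.
have a0 : 0 < a by rewrite sqrtr_gt0.
have aa : p = a ^+ 2 by rewrite sqr_sqrtr// ltW.
have ab : q = a * b by rewrite /b; field; rewrite gt_eqF.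
exists a, b, (Num.sqrt (r - b ^+ 2)); split=> //.
rewrite sqr_sqrtr; first by rewrite addrC subrK.
have -> : r - b ^+ 2 = (p * r - q ^+ 2) / a ^+ 2.
  by rewrite ab aa; field; rewrite gt_eqF.
by rewrite divr_ge0 ?sqr_ge0// ltW.
Qed.

(** With [w] = e^(-2p), the left side is the time derivative of [w * G] along the flow and the right
    side is [w] times its Laplacian. Their difference is twice the squared norm of the Hessian of p
    for e^(2p) h, namely Hess p - 2 dp dp + |dp|^2 h; in an orthonormal frame its entries are the
    three bases squared in [sos]. *)
Lemma evolution_algebra (A H : 'I_2 -> 'I_2 -> R) (C : 'I_2 -> 'I_2 -> 'I_2 -> R)
    (q1 dG dL : 'I_2 -> R) (q2 ddG : 'I_2 -> 'I_2 -> R) (w L G : R) :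
  A 1 0 = A 0 1 -> H 1 0 = H 0 1 -> 0 < A 0 0 -> 0 < A 0 0 * A 1 1 - A 0 1 ^+ 2 ->
  (forall n m, q2 n m = H n m + \sum_(k < 2) C n m k * q1 k) ->
  (forall k, C 1 0 k = C 0 1 k) ->
  (forall m, dG m = 2 * \sum_(k < 2) \sum_(l < 2) A k l * H m k * q1 l) ->
  \sum_(m < 2) \sum_(n < 2) A m n * (ddG n m - \sum_(k < 2) C m n k * dG k) =
  2 * \sum_(m < 2) \sum_(n < 2) \sum_(k < 2) \sum_(l < 2)
        A m n * A k l * H m k * H n l
  + 2 * \sum_(k < 2) \sum_(l < 2) A k l * q1 k * dL l ->
  L = \sum_(i < 2) \sum_(j < 2) A i j * H i j ->
  G = \sum_(i < 2) \sum_(j < 2) A i j * q1 i * q1 j ->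
  w * (2 * \sum_(k < 2) \sum_(l < 2) A k l * q1 k * (w * (dL l - 2 * q1 l * L))
       - 2 * (w * L) * G)
  <= w * \sum_(m < 2) \sum_(n < 2) A m n *
       (w * (ddG n m - 2 * q2 n m * G - 2 * q1 m * dG n
             - 2 * q1 n * (dG m - 2 * q1 m * G))
        - \sum_(k < 2) C m n k * (w * (dG k - 2 * q1 k * G))).
Proof.
move=> As Hs A0 Adet q2E Cs dGE bochner LE GE.
have [a [b [c [aa ab cc]]]] := cholesky2 A0 Adet.
(* In a frame orthonormal for the metric [H] becomes [x, y; y, z] and [q1]
   becomes [(u, v)]. *)
pose u := a * q1 0 + b * q1 1; pose v := c * q1 1.
pose x := a ^+ 2 * H 0 0 + 2 * a * b * H 0 1 + b ^+ 2 * H 1 1.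
pose y := a * c * H 0 1 + b * c * H 1 1.
pose z := c ^+ 2 * H 1 1.
have sos : 0 <= 2 * w ^+ 2 * ((x + v ^+ 2 - u ^+ 2) ^+ 2 + 2 * (y - 2 * u * v) ^+ 2
    + (z + u ^+ 2 - v ^+ 2) ^+ 2).
  by repeat first [exact: sqr_ge0 | apply: addr_ge0 | apply: mulr_ge0 | exact: ler0n].
rewrite -subr_ge0; apply: le_trans sos _; rewrite le_eqVlt; apply/orP; left; apply/eqP.
pose B := \sum_(m < 2) \sum_(n < 2) A m n * (ddG n m - \sum_(k < 2) C m n k * dG k).
pose D := \sum_(k < 2) \sum_(l < 2) A k l * q1 k * dL l.
transitivity (w ^+ 2 * (B - 2 * D) + w ^+ 2 * (4 * G * L + 4 * G ^+ 2
    - 4 * \sum_(k < 2) \sum_(l < 2) A k l * q1 k * dG l)).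
  rewrite /B bochner -/D addrK GE LE; rewrite !sum2 !dGE !sum2.
  rewrite /u /v /x /y /z !As !Hs ab aa cc; ring.
rewrite /B /D GE LE !sum2 !q2E !sum2 !Cs !As !Hs; ring.
Qed.

End BochnerAlgebra.

(** * Metrics in coordinates *)

Section SmoothRules.
Context {R : realType} {V : normedModType R}.
Implicit Types (U : set V) (f g : V -> R^o) (z v : V).

Lemma smD U f g : open U -> smooth U f -> smooth U g ->
  smooth U (fun z => f z + g z : R^o).
Proof. by move=> oU Sf Sg k; apply: CkD. Qed.

Lemma smM U f g : open U -> smooth U f -> smooth U g ->
  smooth U (fun z => f z * g z : R^o).
Proof. by move=> oU Sf Sg k; apply: CkM. Qed.

Lemma smN U f : open U -> smooth U f -> smooth U (fun z => - f z : R^o).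
Proof. by move=> oU Sf k; apply: CkN. Qed.

Lemma smC U (c : R) : smooth U (fun=> c : R^o).
Proof. by move=> k; exact: Ck_cst. Qed.

Lemma smV U f : open U -> (forall z, U z -> f z != 0) -> smooth U f ->
  smooth U (fun z => (f z)^-1 : R^o).
Proof. by move=> oU f0 Sf k; apply: CkV. Qed.

Lemma sm_expR U f : open U -> smooth U f -> smooth U (fun z => expR (f z) : R^o).
Proof. by move=> oU Sf k; apply: Ck_expR. Qed.

Lemma sm_sqrt U f : open U -> (forall z, U z -> 0 < f z :> R) -> smooth U f ->
  smooth U (fun z => Num.sqrt (f z) : R^o).
Proof. by move=> oU f0 Sf k; apply: Ck_sqrt. Qed.

Lemma sm_derive U f v : smooth U f -> smooth U ('D_v f : V -> R^o).
Proof. by move=> Sf k; have [_ /(_ v)[]] := Sf k.+1. Qed.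

Lemma sm_ext (W : normedModType R) U (f g : V -> W) :
  open U -> (forall z, U z -> f z = g z) -> smooth U f -> smooth U g.
Proof. by move=> oU fg Sf k; apply: Ck_ext (Sf k). Qed.

Lemma sm_der U f z v : smooth U f -> U z -> is_derive z v f ('D_v f z).
Proof.
by move=> Sf Uz; have [_ /(_ v)[dv _]] := Sf 1%N; apply: derivableP; exact: dv.
Qed.

Lemma sm_cont (W : normedModType R) U (f : V -> W) z :
  smooth U f -> U z -> {for z, continuous f}.
Proof. by move=> Sf Uz; have [cf _] := Sf 0%N; exact: cf. Qed.

Lemma sm_comm U f z v w : open U -> smooth U f -> U z ->
  'D_w ('D_v f) z = 'D_v ('D_w f) z.
Proof. by move=> oU Sf Uz; exact: (derive_comm v w oU Uz (Sf 2%N)). Qed.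

Lemma dval f z v (d : R) : is_derive z v f d -> 'D_v f z = d.
Proof. by case. Qed.

Lemma dvD f g z v (a b : R) : is_derive z v f a -> is_derive z v g b ->
  is_derive z v (fun y => f y + g y : R^o) (a + b).
Proof. by move=> fa gb; exact: is_deriveD. Qed.

Lemma dvM f g z v (a b : R) : is_derive z v f a -> is_derive z v g b ->
  is_derive z v (fun y => f y * g y : R^o) (f z * b + g z * a).
Proof. by move=> fa gb; have := is_deriveM fa gb. Qed.

Lemma dvN f z v (a : R) : is_derive z v f a ->
  is_derive z v (fun y => - f y : R^o) (- a).
Proof. by move=> fa; exact: is_deriveN. Qed.

Lemma dvC (c : R) z v : is_derive z v (fun=> c : R^o) 0.
Proof. exact: is_derive_cst. Qed.

Lemma dvE f z v (a : R) : is_derive z v f a ->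
  is_derive z v (fun y => expR (f y) : R^o) (a * expR (f z)).
Proof. by case=> df <-; exact: (is_derive_chain df). Qed.

Lemma dvS f z v (a : R) : 0 < f z :> R -> is_derive z v f a ->
  is_derive z v (fun y => Num.sqrt (f y) : R^o) (a * (2 * Num.sqrt (f z))^-1).
Proof. by move=> f0 [df <-]; apply: (is_derive_chain df); exact: is_derive1_sqrt. Qed.

End SmoothRules.

Ltac smo := repeat first
  [ assumption | apply: smD | apply: smM | apply: smN | apply: smC
  | apply: sm_derive ].

Section CoordinateMetric.
Context {R : realType}.
Local Notation P := 'rV[R]_2.

Lemma det2 (A : 'M[R]_2) : \det A = A 0 0 * A 1 1 - A 0 1 * A 1 0.
Proof.
rewrite (expand_det_row _ 0) sum2 /cofactor !det_mx11 !mxE /= expr0 expr1 mul1r mulN1r.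
rewrite mulrN; congr (A _ _ * A _ _ - A _ _ * A _ _); exact/val_inj.
Qed.

Lemma invmx2 (A : 'M[R]_2) i j : \det A != 0 ->
  invmx A i j = (\det A)^-1 * (if i == j then A (1 - i) (1 - i) else - A i j).
Proof.
move=> dA; rewrite /invmx unitmxE unitfE dA !mxE /cofactor !det_mx11 !mxE.
congr (_ * _); move: i j; apply: forall2; apply: forall2; rewrite /= ?expr0 ?expr1 ?mul1r ?mulN1r;
 rewrite ?addn0 ?expr0 ?sqrrN ?expr1n ?mul1r; try congr (- _); congr (A _ _); exact/val_inj.
Qed.

Variables (U : set P) (oU : open U) (g : P -> 'M[R]_2).
Hypothesis g_smooth : forall i j, smooth U (fun y => g y i j : R^o).
Hypothesis g_sym : forall y, U y -> (g y)^T = g y.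
Hypothesis g_pos : forall y, U y -> forall v : P, v != 0 ->
  0 < (v *m g y *m v^T) 0 0.

Lemma quadE (v w : P) (A : 'M[R]_2) : (v *m A *m w^T) 0 0 =
  v 0 0 * A 0 0 * w 0 0 + v 0 0 * A 0 1 * w 0 1 + v 0 1 * A 1 0 * w 0 0
  + v 0 1 * A 1 1 * w 0 1.
Proof. by rewrite !mxE !sum2 !mxE !sum2; ring. Qed.

Lemma g10 y : U y -> g y 1 0 = g y 0 1.
Proof. by move=> Uy; rewrite -[in LHS](g_sym Uy) mxE. Qed.

Lemma g00_gt0 y : U y -> 0 < g y 0 0.
Proof.
move=> Uy; have := g_pos Uy (v := e_ 0).
rewrite quadE !mxE /= !(mul1r, mulr1, mul0r, mulr0, addr0); apply.
by apply/negP => /eqP/rowP/(_ 0)/eqP; rewrite !mxE /= oner_eq0.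
Qed.

Lemma detg_gt0 y : U y -> 0 < \det (g y).
Proof.
(* The squared length of this vector is [g y 0 0] times the determinant. *)
move=> Uy; pose v : P := row2 (- g y 0 1, g y 0 0).
have g0 := g00_gt0 Uy.
have vn0 : v != 0.
  by apply/negP => /eqP/rowP/(_ 1)/eqP; rewrite !mxE /= gt_eqF.
have := g_pos Uy vn0; rewrite quadE /v !mxE /= (g10 Uy) => H.
rewrite det2 (g10 Uy) -(pmulr_rgt0 _ g0); apply: (lt_le_trans H).
by rewrite le_eqVlt; apply/orP; left; apply/eqP; ring.
Qed.

Lemma detg_neq0 y : U y -> \det (g y) != 0.
Proof. by move=> Uy; rewrite gt_eqF ?detg_gt0. Qed.

Definition ginv i j y : R^o := invmx (g y) i j.

Lemma ginvE i j y : ginv i j y = invmx (g y) i j.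
Proof. by []. Qed.

Lemma ginv00 y : U y -> ginv 0 0 y = (\det (g y))^-1 * g y 1 1.
Proof. by move=> Uy; rewrite /ginv invmx2 ?detg_neq0//=; congr (_ * g y _ _); exact/val_inj. Qed.

Lemma ginv11 y : U y -> ginv 1 1 y = (\det (g y))^-1 * g y 0 0.
Proof. by move=> Uy; rewrite /ginv invmx2 ?detg_neq0//=; congr (_ * g y _ _); exact/val_inj. Qed.

Lemma ginv01 y : U y -> ginv 0 1 y = (\det (g y))^-1 * - g y 0 1.
Proof. by move=> Uy; rewrite /ginv invmx2 ?detg_neq0. Qed.

Lemma ginv10 y : U y -> ginv 1 0 y = ginv 0 1 y.
Proof. by move=> Uy; rewrite ginv01// /ginv invmx2 ?detg_neq0//= g10. Qed.

Lemma detE y : U y -> \det (g y) = g y 0 0 * g y 1 1 - g y 0 1 * g y 0 1.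
Proof. by move=> Uy; rewrite det2 g10. Qed.

Lemma smooth_detg : smooth U (fun y => \det (g y) : R^o).
Proof.
apply: (@sm_ext _ _ _ _ (fun y => g y 0 0 * g y 1 1 + - (g y 0 1 * g y 0 1) : R^o)) => //.
  by move=> y Uy; rewrite detE.
by smo.
Qed.

Lemma smooth_ginv i j : smooth U (ginv i j).
Proof.
have Sd : smooth U (fun y => (\det (g y))^-1 : R^o).
  by apply: smV smooth_detg => // y Uy; rewrite gt_eqF ?detg_gt0.
move: i j; apply: forall2; apply: forall2.
- apply: (sm_ext oU (fun y Uy => esym (ginv00 Uy))).
  by apply: (smM oU Sd).
- apply: (sm_ext oU (fun y Uy => esym (ginv01 Uy))).
  by apply: (smM oU Sd); apply: smN.
- apply: (sm_ext oU (fun y Uy => esym (etrans (ginv10 Uy) (ginv01 Uy)))).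
  by apply: (smM oU Sd); apply: smN.
- apply: (sm_ext oU (fun y Uy => esym (ginv11 Uy))).
  by apply: (smM oU Sd).
Qed.

Lemma ginv00_gt0 y : U y -> 0 < ginv 0 0 y.
Proof.
move=> Uy; have d0 := detg_gt0 Uy; rewrite ginv00// mulr_gt0 ?invr_gt0//.
have := detE Uy; have g0 := g00_gt0 Uy; move: d0 => /[swap] -> d0.
by rewrite -(pmulr_rgt0 _ g0); nra.
Qed.

Lemma ginv_det_gt0 y : U y -> 0 < ginv 0 0 y * ginv 1 1 y - ginv 0 1 y ^+ 2.
Proof.
move=> Uy; have d0 := detg_gt0 Uy.
suff -> : ginv 0 0 y * ginv 1 1 y - ginv 0 1 y ^+ 2 = (\det (g y))^-1 by rewrite invr_gt0.
rewrite ginv00// ginv11// ginv01//.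
transitivity ((\det (g y))^-1 * (\det (g y))^-1 * (g y 0 0 * g y 1 1 - g y 0 1 * g y 0 1)).
  by ring.
by rewrite -detE// mulfVK// detg_neq0.
Qed.

Local Notation C := (christoffel g).
Local Notation d_ := (@partial R).

Definition dg k i j : P -> R := d_ k (fun z => g z i j).

Lemma christoffelE i j k y : C i j k y = 2^-1 *
  (ginv k 0 y * (dg i j 0 y + dg j i 0 y - dg 0 i j y)
   + ginv k 1 y * (dg i j 1 y + dg j i 1 y - dg 1 i j y)).
Proof. by rewrite /christoffel sum2. Qed.

Lemma smooth_dg k i j : smooth U (dg k i j : P -> R^o).
Proof. exact: sm_derive. Qed.

Lemma smooth_christoffel i j k : smooth U (C i j k : P -> R^o).
Proof.
have Sdg := smooth_dg; have Sg := smooth_ginv.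
apply: (@sm_ext _ _ _ _ (fun y => 2^-1 *
  (ginv k 0 y * (dg i j 0 y + dg j i 0 y + - dg 0 i j y)
   + ginv k 1 y * (dg i j 1 y + dg j i 1 y + - dg 1 i j y)) : R^o)) => //.
  by move=> y _; rewrite christoffelE.
by smo.
Qed.

Lemma dg10 k y : U y -> dg k 1 0 y = dg k 0 1 y.
Proof. by move=> Uy; apply: (derive_ext _ oU Uy) => z Uz; rewrite g10. Qed.

Lemma christoffel10 k y : U y -> C 1 0 k y = C 0 1 k y.
Proof. by move=> Uy; rewrite !christoffelE !dg10//; ring. Qed.

Lemma ginvMg k l y : U y -> ginv 0 k y * g y 0 l + ginv 1 k y * g y 1 l = (k == l)%:R.
Proof.
move=> Uy; have dE := mulVf (detg_neq0 Uy); rewrite {2}detE// in dE.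
by move: k l; apply: forall2; apply: forall2;
rewrite ?ginv10// !(ginv00, ginv11, ginv01)// ?g10//= -?dE; ring.
Qed.

Lemma christoffel_low i j k y : U y ->
  C i j 0 y * g y 0 k + C i j 1 y * g y 1 k = 2^-1 * (dg i j k y + dg j i k y - dg k i j y).
Proof.
move=> Uy; rewrite !christoffelE.
pose T l := dg i j l y + dg j i l y - dg l i j y.
transitivity (2^-1 * (T 0 * (ginv 0 0 y * g y 0 k + ginv 1 0 y * g y 1 k)
  + T 1 * (ginv 0 1 y * g y 0 k + ginv 1 1 y * g y 1 k))).
  by rewrite /T; ring.
rewrite !ginvMg//; congr (_ * _).
by move: k; apply: forall2; rewrite /T /=; ring.
Qed.

Lemma dg_sym k i j y : U y -> dg k i j y = dg k j i y.
Proof. by move: i j; apply: forall2; apply: forall2 => // Uy; rewrite dg10. Qed.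

Lemma g_symE i j y : U y -> g y i j = g y j i.
Proof. by move: i j; apply: forall2; apply: forall2 => // Uy; rewrite g10. Qed.

(** Compatibility of the connection with the metric: in the sum of the two lowered Christoffel
    symbols all derivatives except [dg k i j] cancel in pairs. *)
Lemma dg_christoffel k i j y : U y -> dg k i j y =
  (C k i 0 y * g y 0 j + C k i 1 y * g y 1 j)
  + (C k j 0 y * g y 0 i + C k j 1 y * g y 1 i).
Proof.
by move=> Uy; rewrite !christoffel_low// (dg_sym i k j)// (dg_sym j k i)// (dg_sym k j i)//; field.
Qed.

End CoordinateMetric.

Opaque christoffel ginv derive.

(** * Derivatives of the inverse metric, the Laplacian as trace of the Hessian, and the curvature *)

Section DerivedIdentities.
Context {R : realType}.

(** Differentiating the product of the inverse metric and the metric gives dA = - A dg A; the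
    derivatives of the metric are then traded for Christoffel symbols. *)
Lemma dginv_algebra (A g dA dg C : 'I_2 -> 'I_2 -> R) :
  (forall k l, A 0 k * g 0 l + A 1 k * g 1 l = (k == l)%:R) ->
  (forall i j, A i j = A j i) -> (forall i j, g i j = g j i) ->
  (forall k l, dA 0 k * g 0 l + dA 1 k * g 1 l
     + (A 0 k * dg 0 l + A 1 k * dg 1 l) = 0) ->
  (forall i j, dg i j = (C i 0 * g 0 j + C i 1 * g 1 j)
                        + (C j 0 * g 0 i + C j 1 * g 1 i)) ->
  forall i j, dA i j = - \sum_(l < 2) (C l i * A l j + C l j * A i l).
Proof.
move=> Ag As gs dAg dgE i j.
have key : dA i j = A 0 i * (dA 0 j * g 0 0 + dA 1 j * g 1 0)
    + A 1 i * (dA 0 j * g 0 1 + dA 1 j * g 1 1).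
  transitivity (dA 0 j * (A 0 i * g 0 0 + A 1 i * g 1 0)
      + dA 1 j * (A 0 i * g 0 1 + A 1 i * g 1 1)); last by rewrite (gs 1 0); ring.
  by rewrite !Ag; move: i; apply: forall2; rewrite /= ?mulr1n ?mulr0n; ring.
have dAgE l : dA 0 j * g 0 l + dA 1 j * g 1 l = - (A 0 j * dg 0 l + A 1 j * dg 1 l).
  by apply/eqP; rewrite -addr_eq0 dAg.
rewrite key !dAgE !dgE sum2.
transitivity (- ((A 0 j * C 0 0 + A 1 j * C 1 0) * (A 0 i * g 0 0 + A 1 i * g 1 0)
  + (A 0 j * C 0 1 + A 1 j * C 1 1) * (A 0 i * g 0 1 + A 1 i * g 1 1)
  + (A 0 i * C 0 0 + A 1 i * C 1 0) * (A 0 j * g 0 0 + A 1 j * g 1 0)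
  + (A 0 i * C 0 1 + A 1 i * C 1 1) * (A 0 j * g 0 1 + A 1 j * g 1 1))).
  by rewrite (gs 1 0); ring.
rewrite !Ag (As i 0) (As i 1); move: i j {key dAgE}; apply: forall2; apply: forall2;
by rewrite /= ?mulr1n ?mulr0n; ring.
Qed.

(** Here [s] is the square root of the determinant, whose logarithmic derivative is a trace of
    Christoffel symbols. This trace cancels against one half of the derivative of the inverse
    metric; the other half is the Hessian correction. *)
Lemma laplacian_algebra (A F2 : 'I_2 -> 'I_2 -> R) (C : 'I_2 -> 'I_2 -> 'I_2 -> R)
    (F1 : 'I_2 -> R) (dA : 'I_2 -> 'I_2 -> R) (s : R) : s != 0 ->
  A 1 0 = A 0 1 -> (forall k, C 1 0 k = C 0 1 k) ->
  (forall i j, dA i j = - \sum_(l < 2) (C i l i * A l j + C i l j * A i l)) ->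
  s^-1 * \sum_(i < 2) (s * (A i 0 * F2 i 0 + F1 0 * dA i 0 + (A i 1 * F2 i 1 + F1 1 * dA i 1))
    + (A i 0 * F1 0 + A i 1 * F1 1) * ((C i 0 0 + C i 1 1) * s)) =
  \sum_(i < 2) \sum_(j < 2) A i j * (F2 i j - \sum_(k < 2) C i j k * F1 k).
Proof.
move=> s0 As Cs dAE; apply: (mulfI s0); rewrite mulrA mulfV// mul1r.
by rewrite !sum2 !dAE !sum2 !Cs !As; ring.
Qed.

(** Antisymmetry of the curvature in its last two indices reflects the equality of mixed second
    derivatives of the metric: [D n k] is the [n]-th derivative of the right side of
    [dg_christoffel]. *)
Lemma riemann_algebra (g : 'I_2 -> 'I_2 -> R) (C dg : 'I_2 -> 'I_2 -> 'I_2 -> R)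
    (dC : 'I_2 -> 'I_2 -> 'I_2 -> 'I_2 -> R) i j :
  let D n k := C k i 0 * dg n 0 j + g 0 j * dC n k i 0
    + (C k i 1 * dg n 1 j + g 1 j * dC n k i 1)
    + (C k j 0 * dg n 0 i + g 0 i * dC n k j 0
       + (C k j 1 * dg n 1 i + g 1 i * dC n k j 1)) in
  let Rm k l := dC 0 1 k l - dC 1 0 k l + (C 1 k 0 * C 0 0 l - C 0 k 0 * C 1 0 l)
    + (C 1 k 1 * C 0 1 l - C 0 k 1 * C 1 1 l) in
  (forall k, C 1 0 k = C 0 1 k) -> (forall a b, g a b = g b a) ->
  (forall k a b, dg k a b = (C k a 0 * g 0 b + C k a 1 * g 1 b)
                          + (C k b 0 * g 0 a + C k b 1 * g 1 a)) ->
  D 0 1 = D 1 0 ->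
  (Rm i 0 * g 0 j + Rm i 1 * g 1 j) + (Rm j 0 * g 0 i + Rm j 1 * g 1 i) = 0.
Proof.
move=> D Rm Cs gs dgE /eqP; rewrite -subr_eq0 => /eqP comm.
rewrite -[RHS]comm /D /Rm !dgE !Cs (gs 1 0); ring.
Qed.

Local Notation P := 'rV[R]_2.
Variables (U : set P) (oU : open U) (g : P -> 'M[R]_2).
Hypothesis g_smooth : forall i j, smooth U (fun y => g y i j : R^o).
Hypothesis g_sym : forall y, U y -> (g y)^T = g y.
Hypothesis g_pos : forall y, U y -> forall v : P, v != 0 ->
  0 < (v *m g y *m v^T) 0 0.
Local Notation C := (christoffel g).
Local Notation A := (ginv g).

Let SC := smooth_christoffel oU g_smooth g_sym g_pos.
Let SA := smooth_ginv oU g_smooth g_sym g_pos.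

Lemma partialE i (f : P -> R) : partial i f = 'D_(e_ i) (f : P -> R^o) :> (P -> R).
Proof. by []. Qed.

Lemma dg_partialE n i j y : dg g n i j y = 'D_(e_ n) (fun y => g y i j : R^o) y.
Proof. by []. Qed.

Lemma ginv_sym i j y : U y -> A i j y = A j i y.
Proof.
by move: i j; apply: forall2; apply: forall2 => // Uy; rewrite (ginv10 g_sym g_pos Uy).
Qed.

Lemma derive_ginv n i j y : U y -> partial n (A i j) y =
  - \sum_(l < 2) (C n l i y * A l j y + C n l j y * A i l y).
Proof.
move=> Uy; apply: (@dginv_algebra (fun i j => A i j y) (fun i j => g y i j)
  (fun i j => partial n (A i j) y) (fun i j => dg g n i j y)
  (fun l i => C n l i y)) => [k l|a b|a b|k l|a b].
- exact: (ginvMg g_sym g_pos).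
- exact: ginv_sym.
- exact: (g_symE g_sym).
- pose f z : R^o := A 0 k z * g z 0 l + A 1 k z * g z 1 l.
  have f0 : 'D_(e_ n) f y = 0.
    rewrite (@derive_ext _ _ _ U f (fun=> ((k == l)%:R : R^o)) _ (e_ n))//.
      exact: derive_cst.
    by move=> z Uz; exact: (ginvMg g_sym g_pos).
  rewrite -[RHS]f0 /f.
  have H := dvD (dvM (sm_der (e_ n) (SA 0 k) Uy) (sm_der (e_ n) (g_smooth 0 l) Uy))
    (dvM (sm_der (e_ n) (SA 1 k) Uy) (sm_der (e_ n) (g_smooth 1 l) Uy)).
  by rewrite (dval H) !partialE !dg_partialE /=; ring.
- exact: (dg_christoffel oU g_sym g_pos).
Qed.

Lemma derive_detg n y : U y -> partial n (fun z => \det (g z)) y =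
  2 * (C n 0 0 y + C n 1 1 y) * \det (g y).
Proof.
move=> Uy.
have -> : partial n (fun z => \det (g z)) y =
    'D_(e_ n) (fun z => g z 0 0 * g z 1 1 + - (g z 0 1 * g z 0 1) : R^o) y.
  by apply: (derive_ext _ oU Uy) => z Uz; rewrite (detE g_sym).
have d i j : is_derive y (e_ n) (fun z => g z i j : R^o)
    ((C n i 0 y * g y 0 j + C n i 1 y * g y 1 j)
     + (C n j 0 y * g y 0 i + C n j 1 y * g y 1 i)).
  by rewrite -(dg_christoffel oU g_sym g_pos)//; exact: (sm_der _ (g_smooth i j) Uy).
rewrite (dval (dvD (dvM (d 0 0) (d 1 1)) (dvN (dvM (d 0 1) (d 0 1))))).
rewrite (detE g_sym)// (g10 g_sym)//; ring.
Qed.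

Lemma laplacian_coordE (f : P -> R^o) y : U y -> smooth U f ->
  laplacian_coord g f y = \sum_(i < 2) \sum_(j < 2) A i j y *
    (partial i (partial j f) y - \sum_(k < 2) C i j k y * partial k f y).
Proof.
move=> Uy Sf; have dgt0 := detg_gt0 g_sym g_pos.
have dd i : is_derive y (e_ i) (fun z => \det (g z) : R^o)
    (2 * (C i 0 0 y + C i 1 1 y) * \det (g y)).
  by rewrite -derive_detg//; apply: (sm_der _ (smooth_detg oU g_smooth g_sym) Uy).
have s0 : Num.sqrt (\det (g y)) != 0 by rewrite gt_eqF// sqrtr_gt0 dgt0.
have sE : \det (g y) = Num.sqrt (\det (g y)) * Num.sqrt (\det (g y)).
  by rewrite -expr2 sqr_sqrtr// ltW// dgt0.
have ds i : is_derive y (e_ i) (fun z => Num.sqrt (\det (g z)) : R^o)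
    ((C i 0 0 y + C i 1 1 y) * Num.sqrt (\det (g y))).
  apply: is_derive_eq (@dvS _ _ (fun z => \det (g z) : R^o) y (e_ i) _ (dgt0 _ Uy) (dd i)) _.
  by rewrite {1}sE; move: s0; move: (Num.sqrt _) (_ + _) => s c s0; field.
have df i j : is_derive y (e_ i) (partial j f : P -> R^o) (partial i (partial j f) y).
  exact: (sm_der (e_ i) (sm_derive (e_ j) Sf) Uy).
have dA i j k : is_derive y (e_ k) (A i j) (partial k (A i j) y).
  exact: (sm_der (e_ k) (SA i j) Uy).
have E i : partial i (fun z => Num.sqrt (\det (g z)) *
    \sum_(j < 2) invmx (g z) i j * partial j f z) y =
  'D_(e_ i) (fun z => Num.sqrt (\det (g z)) *
    (A i 0 z * partial 0 f z + A i 1 z * partial 1 f z) : R^o) y.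
  by apply: (derive_ext _ oU Uy) => z Uz; rewrite sum2 -!ginvE.
rewrite -(@laplacian_algebra (fun i j => A i j y) (fun i j => partial i (partial j f) y)
  (fun i j k => C i j k y) (fun j => partial j f y) (fun i j => partial i (A i j) y) _ s0).
- rewrite /laplacian_coord; congr (_ * _); apply: eq_bigr => i _; rewrite E.
  exact: (dval (dvM (ds i) (dvD (dvM (dA _ _ _) (df _ _)) (dvM (dA _ _ _) (df _ _))))).
- exact: (ginv10 g_sym g_pos Uy).
- by move=> k; exact: (christoffel10 oU g_sym k Uy).
- by move=> i j; exact: derive_ginv.
Qed.

Lemma riemannE k l y : riemann g 0 1 k l y =
  partial 0 (C 1 k l) y - partial 1 (C 0 k l) y
  + (C 1 k 0 y * C 0 0 l y - C 0 k 0 y * C 1 0 l y)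
  + (C 1 k 1 y * C 0 1 l y - C 0 k 1 y * C 1 1 l y).
Proof. by rewrite /riemann sum2 addrA. Qed.

Lemma riemann_antisym i j y : U y ->
  (riemann g 0 1 i 0 y * g y 0 j + riemann g 0 1 i 1 y * g y 1 j)
  + (riemann g 0 1 j 0 y * g y 0 i + riemann g 0 1 j 1 y * g y 1 i) = 0.
Proof.
move=> Uy; rewrite !riemannE.
have dgE k z : U z -> dg g k i j z =
  (C k i 0 z * g z 0 j + C k i 1 z * g z 1 j)
  + (C k j 0 z * g z 0 i + C k j 1 z * g z 1 i).
  exact: (dg_christoffel oU g_sym g_pos).
have comm : 'D_(e_ 0) (dg g 1 i j : P -> R^o) y = 'D_(e_ 1) (dg g 0 i j : P -> R^o) y.
  exact: (sm_comm _ _ oU (g_smooth i j) Uy).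
have dC n a b c : is_derive y (e_ n) (C a b c : P -> R^o) (partial n (C a b c) y).
  exact: (sm_der (e_ n) (SC a b c) Uy).
have dG n a b : is_derive y (e_ n) (fun z => g z a b : R^o) (dg g n a b y).
  exact: (sm_der (e_ n) (g_smooth a b) Uy).
have E n k : 'D_(e_ n) (dg g k i j : P -> R^o) y =
    C k i 0 y * dg g n 0 j y + g y 0 j * partial n (C k i 0) y
    + (C k i 1 y * dg g n 1 j y + g y 1 j * partial n (C k i 1) y)
    + (C k j 0 y * dg g n 0 i y + g y 0 i * partial n (C k j 0) y
       + (C k j 1 y * dg g n 1 i y + g y 1 i * partial n (C k j 1) y)).
  rewrite (derive_ext _ oU Uy (dgE k)).
  exact: (dval (dvD (dvD (dvM (dC n k i 0) (dG n 0 j)) (dvM (dC n k i 1) (dG n 1 j)))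
    (dvD (dvM (dC n k j 0) (dG n 0 i)) (dvM (dC n k j 1) (dG n 1 i))))).
move: comm; rewrite !E {E}; move: dC dG => _ _ comm.
apply: (@riemann_algebra (fun a b => g y a b) (fun a b c => C a b c y)
  (fun n a b => dg g n a b y) (fun n a b c => partial n (C a b c) y) i j _ _ _ comm) => [k|a b|k a b].
- exact: (christoffel10 oU g_sym k Uy).
- exact: (g_symE g_sym).
- exact: (dg_christoffel oU g_sym g_pos).
Qed.

(** By antisymmetry the lowered curvature has a single independent entry in dimension two, which is
    the numerator of the Gaussian curvature; raising the index then recovers the whole tensor. *)
Lemma riemann_eq0 k l y : U y -> gaussian_curvature g y = 0 -> riemann g 0 1 k l y = 0.
Proof.
move=> Uy; have dg0 := detg_gt0 g_sym g_pos Uy.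
rewrite /gaussian_curvature sum2 => /eqP.
rewrite mulf_eq0 invr_eq0 (gt_eqF dg0) orbF => /eqP K0.
have low i j : riemann g 0 1 i 0 y * g y 0 j + riemann g 0 1 i 1 y * g y 1 j = 0.
  have lowA (L : 'I_2 -> 'I_2 -> R) : (forall i j, L i j + L j i = 0) -> L 1 0 = 0 ->
      forall i j, L i j = 0.
    move=> LA L10; have := LA 0 0; have := LA 0 1; have := LA 1 1; rewrite L10 => H1 H2 H3.
    by apply: forall2; apply: forall2 => //; lra.
  apply: (lowA (fun i j => riemann g 0 1 i 0 y * g y 0 j + riemann g 0 1 i 1 y * g y 1 j)) => //.
  by move=> a b; exact: riemann_antisym.
have Ag := ginvMg g_sym g_pos.
transitivity (riemann g 0 1 k 0 y * (0 == l)%:R + riemann g 0 1 k 1 y * (1 == l)%:R).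
  by move: l; apply: forall2; rewrite /= ?mulr1n ?mulr0n; ring.
have Ag' i : (i == l)%:R = A 0 l y * g y i 0 + A 1 l y * g y i 1.
  by rewrite (g_symE g_sym i 0 Uy) (g_symE g_sym i 1 Uy) Ag// eq_sym.
rewrite !Ag'; transitivity (A 0 l y * (riemann g 0 1 k 0 y * g y 0 0 + riemann g 0 1 k 1 y * g y 1 0)
   + A 1 l y * (riemann g 0 1 k 0 y * g y 0 1 + riemann g 0 1 k 1 y * g y 1 1)); first by ring.
by rewrite !low !mulr0 addr0.
Qed.

End DerivedIdentities.

(** * The Bernstein function in coordinates *)

Opaque e_.

Section SpaceTime.
Context {R : realType}.

Lemma grad2_ge0 (A : 'I_2 -> 'I_2 -> R) (q1 : 'I_2 -> R) :
  A 1 0 = A 0 1 -> 0 < A 0 0 -> 0 < A 0 0 * A 1 1 - A 0 1 ^+ 2 ->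
  0 <= \sum_(i < 2) \sum_(j < 2) A i j * q1 i * q1 j.
Proof.
move=> As A0 Adet; have [a [b [c [aa ab cc]]]] := cholesky2 A0 Adet.
rewrite (_ : \sum_(i < 2) _ = (a * q1 0 + b * q1 1) ^+ 2 + (c * q1 1) ^+ 2).
  by rewrite addr_ge0 ?sqr_ge0.
by rewrite !sum2 As aa ab cc; ring.
Qed.

(** The factor [tau] grows at unit speed and contributes [a] times the weighted squared gradient.
    The Laplacian of [u ^+ 2 / 2] contributes one such squared gradient on the other side, which
    suffices because [a] is at most 1. *)
Lemma bernstein_algebra (A q2 ddG : 'I_2 -> 'I_2 -> R) (C : 'I_2 -> 'I_2 -> 'I_2 -> R)
    (q1 dG : 'I_2 -> R) (w tau u TG a : R) :
  0 <= a <= 1 -> 0 <= w -> 0 <= \sum_(i < 2) \sum_(j < 2) A i j * q1 i * q1 j ->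
  0 <= tau -> (forall i j, q2 i j = q2 j i) ->
  TG <= w * \sum_(m < 2) \sum_(n < 2) A m n * (ddG n m - \sum_(k < 2) C m n k * dG k) ->
  a * (w * (\sum_(i < 2) \sum_(j < 2) A i j * q1 i * q1 j) + tau * TG)
    + u * (w * \sum_(i < 2) \sum_(j < 2) A i j * (q2 i j - \sum_(k < 2) C i j k * q1 k))
  <= w * \sum_(m < 2) \sum_(n < 2) A m n *
    (a * (tau * ddG n m) + (q1 m * q1 n + u * q2 n m)
     - \sum_(k < 2) C m n k * (a * (tau * dG k) + u * q1 k)).
Proof.
move=> /andP[a0 a1] w0 Q0 tau0 q2s TGle; set B := (X in w * X) in TGle.
set Q := \sum_(_ < _) _ in Q0 *.
apply: (@le_trans _ _ (w * Q + a * (tau * (w * B))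
    + u * (w * \sum_(i < 2) \sum_(j < 2) A i j * (q2 i j - \sum_(k < 2) C i j k * q1 k)))).
  rewrite lerD2r mulrDr lerD//; last by rewrite ler_wpM2l// ler_wpM2l.
  by rewrite -[leRHS]mul1r ler_wpM2r// mulr_ge0.
rewrite le_eqVlt; apply/orP; left; apply/eqP.
by rewrite /Q /B !sum2 (q2s 1 0); ring.
Qed.

Lemma sum_alg4 (A : 'I_2 -> 'I_2 -> R) (q1 t : 'I_2 -> R) : A 1 0 = A 0 1 ->
  \sum_(i < 2) \sum_(j < 2) (A i j * q1 i * t j + q1 j * (A i j * t i + q1 i * 0)) =
  2 * \sum_(k < 2) \sum_(l < 2) A k l * q1 k * t l.
Proof. by move=> As; rewrite !sum2 As; ring. Qed.

Lemma sum_alg1 (a : R) (c e f d : 'I_2 -> R) :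
  a + - \sum_(k < 2) (c k * e k + f k * d k) =
  a - (\sum_(k < 2) d k * f k) - \sum_(k < 2) c k * e k.
Proof. by rewrite !sum2; ring. Qed.

Lemma sum_alg2 (A dH dA H : 'I_2 -> 'I_2 -> R) :
  \sum_(i < 2) \sum_(j < 2) (A i j * dH i j + H i j * dA i j) =
  \sum_(i < 2) \sum_(j < 2) (dA i j * H i j + A i j * dH i j).
Proof. by rewrite !sum2; ring. Qed.

Lemma sum_alg3 (A dA : 'I_2 -> 'I_2 -> R) (dH H q1 q2 : 'I_2 -> R) (c d : R) :
  c * (\sum_(k < 2) \sum_(l < 2)
    (A k l * H k * q2 l + q1 l * (A k l * dH k + H k * dA k l))) + d * 0 =
  c * \sum_(k < 2) \sum_(l < 2)
    (dA k l * H k * q1 l + A k l * dH k * q1 l + A k l * H k * q2 l).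
Proof. by rewrite !sum2; ring. Qed.

Lemma grad2_algebra (A dA q2 : 'I_2 -> 'I_2 -> R) (C : 'I_2 -> 'I_2 -> 'I_2 -> R)
    (q1 : 'I_2 -> R) (n : 'I_2) :
  A 1 0 = A 0 1 -> q2 1 0 = q2 0 1 -> (forall k, C 1 0 k = C 0 1 k) ->
  (forall i j, dA i j = - \sum_(l < 2) (C n l i * A l j + C n l j * A i l)) ->
  \sum_(i < 2) \sum_(j < 2) (A i j * q1 i * q2 n j + q1 j * (A i j * q2 n i + q1 i * dA i j))
  = 2 * \sum_(k < 2) \sum_(l < 2) A k l * (q2 n k - \sum_(r < 2) C n k r * q1 r) * q1 l.
Proof.
move=> As q2s Cs dAE; rewrite !sum2 !dAE !sum2.
by move: n {dAE}; apply: forall2; rewrite ?q2s ?Cs As; ring.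
Qed.

Local Notation P := 'rV[R]_2.
Local Notation V := (R^o * P)%type.
Implicit Types (U : set P) (z : V).

Definition X_ i : V := (0, e_ i).
Definition T_ : V := (1, 0).

Transparent derive.

Lemma derive_snd (f : P -> R^o) (v z : V) :
  'D_v (fun z : V => f z.2 : R^o) z = 'D_(v.2) f z.2.
Proof. by []. Qed.

Lemma derivable_snd (f : P -> R^o) (v z : V) :
  derivable (fun z : V => f z.2 : R^o) z v = derivable f z.2 v.2.
Proof. by []. Qed.

Lemma slice_pt (h t : R) (v y : P) : h *: ((0, v) : V) + (t, y) = (t, h *: v + y).
Proof.
have -> : h *: ((0, v) : V) + (t, y) = (h *: (0 : R^o) + t, h *: v + y) by [].
by rewrite scaler0 add0r.
Qed.

Lemma time_pt (h t : R) (y : P) : h *: T_ + (t, y) = (h *: (1 : R^o) + t, y).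
Proof.
have -> : h *: T_ + (t, y) = (h *: (1 : R^o) + t, h *: 0 + y) by [].
by rewrite scaler0 add0r.
Qed.

Lemma derive_slice (q : V -> R^o) (t : R) (y v : P) :
  'D_v (fun y => q (t, y) : R^o) y = 'D_((0, v) : V) q (t, y).
Proof.
rewrite /derive; set g1 := fun h => h^-1 *: _; set g2 := fun h => h^-1 *: _.
suff -> : g1 = g2 by [].
apply/funext => h; rewrite /g1 /g2 /=.
by rewrite slice_pt.
Qed.

Lemma derivable_slice (q : V -> R^o) (t : R) (y v : P) :
  derivable (fun y => q (t, y) : R^o) y v = derivable q (t, y) ((0, v) : V).
Proof.
rewrite /derivable; set g1 := fun h => h^-1 *: _; set g2 := fun h => h^-1 *: _.
suff -> : g1 = g2 by [].
apply/funext => h; rewrite /g1 /g2 /=.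
by rewrite slice_pt.
Qed.

Lemma derive_time (q : V -> R^o) (t : R) (y : P) :
  'D_1 (fun s : R => q (s, y) : R^o) t = 'D_T_ q (t, y).
Proof.
rewrite /derive; set g1 := fun h => h^-1 *: _; set g2 := fun h => h^-1 *: _.
suff -> : g1 = g2 by [].
apply/funext => h; rewrite /g1 /g2 /=.
by rewrite time_pt.
Qed.

Lemma derivable_time (q : V -> R^o) (t : R) (y : P) :
  derivable (fun s : R => q (s, y) : R^o) t 1 = derivable q (t, y) T_.
Proof.
rewrite /derivable; set g1 := fun h => h^-1 *: _; set g2 := fun h => h^-1 *: _.
suff -> : g1 = g2 by [].
apply/funext => h; rewrite /g1 /g2 /=.
by rewrite time_pt.
Qed.

Lemma is_derive_fst (z v : V) : is_derive z v (fun z : V => z.1 : R^o) v.1.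
Proof. by case: (@is_derive_id R R^o z.1 v.1) => d1 d2; apply: DeriveDef; [exact: d1|exact: d2]. Qed.

Lemma derive_fst (z v : V) : 'D_v (fun z : V => z.1 : R^o) z = v.1.
Proof. by have [_ <-] := is_derive_fst z v. Qed.

Opaque derive.

Lemma smooth_fst (W : set V) : smooth W (fun z => z.1 : R^o).
Proof.
have cf : continuous (@fst R^o P) by move=> z; exact: cvg_fst.
case=> [|k]; first by split=> [z _|]; [exact: cf|].
split=> [z _|v]; first exact: cf.
split=> [z _|]; first by have [] := is_derive_fst z v.
have -> : 'D_v (fun z : V => z.1 : R^o) = (fun=> v.1 : R^o).
  by apply/funext => z; rewrite derive_fst.
exact: Ck_cst.
Qed.

Lemma smooth_snd U (W : set V) (f : P -> R^o) : (forall z, W z -> U z.2) ->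
  smooth U f -> smooth W (fun z => f z.2 : R^o).
Proof.
move=> WU + k; elim: k f => [|k IH] f Sf.
  split=> // z /WU Uz; apply: continuous_comp; first exact: cvg_snd.
  exact: (sm_cont Sf).
split=> [z /WU Uz|v].
  apply: continuous_comp; first exact: cvg_snd.
  exact: (sm_cont Sf).
split=> [z /WU Uz|]; first by rewrite derivable_snd; case: (sm_der v.2 Sf Uz).
have -> : 'D_v (fun z : V => f z.2 : R^o) = (fun z : V => 'D_(v.2) f z.2).
  by apply/funext => z; rewrite derive_snd.
exact: (IH ('D_(v.2) f : P -> R^o) (sm_derive _ Sf)).
Qed.

Lemma smooth_slice U (W : set V) (q : V -> R^o) (t : R) : (forall y, U y -> W (t, y)) ->
  smooth W q -> smooth U (fun y => q (t, y) : R^o).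
Proof.
have ct y : {for y, continuous (fun y : P => (t, y) : V)}.
  exact: (@cvg_pair _ _ _ (nbhs y) (nbhs (t : R^o)) (nbhs y) _ _ _
    (fun=> t : R^o) id (cvg_cst _) cvg_id).
move=> UW + k; elim: k q => [|k IH] q Sq.
  split=> // y /UW Wz; apply: continuous_comp; first exact: ct.
  exact: (sm_cont Sq).
split=> [y /UW Wz|v].
  apply: continuous_comp; first exact: ct.
  exact: (sm_cont Sq).
split=> [y /UW Wz|]; first by rewrite derivable_slice; case: (sm_der (0, v) Sq Wz).
have -> : 'D_v (fun y : P => q (t, y) : R^o) = (fun y : P => 'D_((0, v) : V) q (t, y)).
  by apply/funext => y; rewrite derive_slice.
exact: (IH ('D_((0, v) : V) q : V -> R^o) (sm_derive _ Sq)).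
Qed.

Lemma dv_sum (E : normedModType R) (f : 'I_2 -> E -> R^o) (d : 'I_2 -> R) (y v : E) :
  (forall i, is_derive y v (f i) (d i)) ->
  is_derive y v (fun x => \sum_(i < 2) f i x : R^o) (\sum_(i < 2) d i).
Proof.
move=> fd; rewrite sum2.
have -> : (fun x => \sum_(i < 2) f i x : R^o) = (fun x => f 0 x + f 1 x : R^o).
  by apply/funext => x; rewrite sum2.
exact: dvD.
Qed.

Lemma sm_sum (E : normedModType R) (U : set E) (f : 'I_2 -> E -> R^o) : open U ->
  (forall i, smooth U (f i)) -> smooth U (fun x => \sum_(i < 2) f i x : R^o).
Proof.
move=> oU Sf; apply: (sm_ext oU _ (smD oU (Sf 0) (Sf 1))) => x _.
by rewrite sum2.
Qed.

Variables (U : set P) (oU : open U) (g : P -> 'M[R]_2).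
Hypothesis g_smooth : forall i j, smooth U (fun y => g y i j : R^o).
Hypothesis g_sym : forall y, U y -> (g y)^T = g y.
Hypothesis g_pos : forall y, U y -> forall v : P, v != 0 ->
  0 < (v *m g y *m v^T) 0 0.
Hypothesis g_flat : forall y, U y -> gaussian_curvature g y = 0.
Local Notation C := (christoffel g).
Local Notation A := (ginv g).

Variables (W : set V) (oW : open W) (WU : forall z, W z -> U z.2) (q : V -> R^o).
Hypothesis q_smooth : smooth W q.
Let q1 i : V -> R^o := 'D_(X_ i) q.
Let q2 i j : V -> R^o := 'D_(X_ i) (q1 j).
Let q3 n i j : V -> R^o := 'D_(X_ n) (q2 i j).
Let hess i j z : R^o := q2 i j z - \sum_(k < 2) C i j k z.2 * q1 k z.
Let lap z : R^o := \sum_(i < 2) \sum_(j < 2) A i j z.2 * hess i j z.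
Let grad2 z : R^o := \sum_(i < 2) \sum_(j < 2) A i j z.2 * q1 i z * q1 j z.
Let wt z : R^o := expR (- 2 * q z).
Hypothesis flow : forall z, W z -> 'D_T_ q z = wt z * lap z.

(** These formulas repeat those of [bochner_algebra]. The [dv] facts below identify them with the
    spatial derivatives of [A], [C], [hess], [grad2], [dG] and [lap]. *)
Let dA n i j z : R := - \sum_(l < 2) (C n l i z.2 * A l j z.2 + C n l j z.2 * A i l z.2).
Let dC n i j k z : R := partial n (C i j k) z.2.
Let dH n i j z : R := q3 n i j z - (\sum_(k < 2) dC n i j k z * q1 k z)
  - \sum_(k < 2) C i j k z.2 * q2 n k z.
Let dG m z : R^o := 2 * \sum_(k < 2) \sum_(l < 2) A k l z.2 * hess m k z * q1 l z.
Let ddG n m z : R := 2 * \sum_(k < 2) \sum_(l < 2)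
    (dA n k l z * hess m k z * q1 l z + A k l z.2 * dH n m k z * q1 l z
     + A k l z.2 * hess m k z * q2 n l z).
Let dL n z : R := \sum_(i < 2) \sum_(j < 2) (dA n i j z * hess i j z + A i j z.2 * dH n i j z).

Let Sq1 i : smooth W (q1 i). Proof. exact: sm_derive. Qed.
Let Sq2 i j : smooth W (q2 i j). Proof. exact: sm_derive. Qed.
Let SA i j : smooth W (fun z : V => A i j z.2 : R^o).
Proof. exact: (smooth_snd WU (smooth_ginv oU g_smooth g_sym g_pos i j)). Qed.
Let SC i j k : smooth W (fun z : V => C i j k z.2 : R^o).
Proof. exact: (smooth_snd WU (smooth_christoffel oU g_smooth g_sym g_pos i j k)). Qed.
Let Swt : smooth W wt.
Proof. by apply: sm_expR => //; apply: smM => //; exact: smC. Qed.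

Lemma smooth_grad2 : smooth W grad2.
Proof. by apply: sm_sum => // i; apply: sm_sum => // j; apply: smM => //; exact: smM. Qed.


Let dvA z (Wz : W z) n i j : is_derive z (X_ n) (fun z : V => A i j z.2 : R^o) (dA n i j z).
Proof.
rewrite /dA -(derive_ginv oU g_smooth g_sym g_pos n i j (WU Wz)).
exact: (sm_der (X_ n) (SA i j) Wz).
Qed.

Let dvCh z (Wz : W z) n i j k : is_derive z (X_ n) (fun z : V => C i j k z.2 : R^o) (dC n i j k z).
Proof. exact: (sm_der (X_ n) (SC i j k) Wz). Qed.

Let dvq z (Wz : W z) n : is_derive z (X_ n) q (q1 n z). Proof. exact: (sm_der _ q_smooth). Qed.
Let dvq1 z (Wz : W z) n i : is_derive z (X_ n) (q1 i) (q2 n i z). Proof. exact: (sm_der _ (Sq1 i)). Qed.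

Let dvhess z (Wz : W z) n i j : is_derive z (X_ n) (hess i j) (dH n i j z).
Proof.
apply: (is_derive_eq (dvD (sm_der (X_ n) (Sq2 i j) Wz)
  (dvN (dv_sum (fun k => dvM (dvCh Wz n i j k) (dvq1 Wz n k)))))).
exact: sum_alg1.
Qed.

Let dvlap z (Wz : W z) n : is_derive z (X_ n) lap (dL n z).
Proof.
apply: (is_derive_eq (dv_sum (fun i => dv_sum (fun j => dvM (dvA Wz n i j) (dvhess Wz n i j))))).
exact: sum_alg2.
Qed.

Let q2_sym z (Wz : W z) i j : q2 i j z = q2 j i z.
Proof. exact: (sm_comm _ _ oW q_smooth Wz). Qed.

Let C_sym z (Wz : W z) k : C 1 0 k z.2 = C 0 1 k z.2.
Proof. exact: (christoffel10 oU g_sym k (WU Wz)). Qed.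

Let A_sym z (Wz : W z) : A 1 0 z.2 = A 0 1 z.2.
Proof. exact: (ginv10 g_sym g_pos (WU Wz)). Qed.

Let dvgrad2 z (Wz : W z) n : is_derive z (X_ n) grad2 (dG n z).
Proof.
apply: (is_derive_eq (dv_sum (fun i => dv_sum (fun j =>
  dvM (dvM (dvA Wz n i j) (dvq1 Wz n i)) (dvq1 Wz n j))))).
have E := @grad2_algebra (fun i j => A i j z.2) (fun i j => dA n i j z) (fun i j => q2 i j z)
  (fun i j k => C i j k z.2) (fun i => q1 i z) n (A_sym Wz) (q2_sym Wz 1 0) (C_sym Wz).
have {}E := E (fun i j => erefl).
etransitivity.
2: exact E.
cbv beta.
reflexivity.
Qed.

Let dvdG z (Wz : W z) n m : is_derive z (X_ n) (dG m) (ddG n m z).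
Proof.
apply: (is_derive_eq (dvM (dvC 2 z (X_ n)) (dv_sum (fun k => dv_sum (fun l =>
  dvM (dvM (dvA Wz n k l) (dvhess Wz n m k)) (dvq1 Wz n l)))))).
exact: sum_alg3.
Qed.


Let bochner z (Wz : W z) :
  \sum_(m < 2) \sum_(n < 2) A m n z.2 * (ddG n m z - \sum_(k < 2) C m n k z.2 * dG k z) =
  2 * \sum_(m < 2) \sum_(n < 2) \sum_(k < 2) \sum_(l < 2)
        A m n z.2 * A k l z.2 * hess m k z * hess n l z
  + 2 * \sum_(k < 2) \sum_(l < 2) A k l z.2 * q1 k z * dL l z.
Proof.
apply: (@bochner_algebra R (fun i j => A i j z.2) (fun i j k => C i j k z.2)
  (fun n i j k => dC n i j k z) (fun i => q1 i z) (fun i j => q2 i j z)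
  (fun n i j => q3 n i j z) (A_sym Wz) (C_sym Wz)).
- move=> n k; apply: (derive_ext _ oU (WU Wz)) => y Uy.
  exact: (christoffel10 oU g_sym k Uy).
- exact: (q2_sym Wz).
- move=> n; apply: (derive_ext _ oW Wz) => y Wy.
  exact: (sm_comm _ _ oW q_smooth Wy).
- by move=> n; exact: (sm_comm _ _ oW (Sq1 n) Wz).
- move=> k l; have := riemann_eq0 oU g_smooth g_sym g_pos k l (WU Wz) (g_flat (WU Wz)).
  by rewrite riemannE.
Qed.

Let dvwt z v (d : R) : is_derive z v q d -> is_derive z v wt (wt z * (- 2 * d)).
Proof.
move=> dq; apply: (is_derive_eq (dvE (dvM (dvC (-2) z v) dq))).
by rewrite -/(wt z) mulrC mulr0 addr0.
Qed.

(** The squared length of the gradient of [q] for the evolving metric e^(2q) g. *)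
Let G y : R^o := wt y * grad2 y.
Let dGw n y : R^o := wt y * (dG n y + - (2 * (q1 n y * grad2 y))).

Let dvG z (Wz : W z) n : is_derive z (X_ n) G (dGw n z).
Proof.
apply: (is_derive_eq (dvM (dvwt (dvq Wz n)) (dvgrad2 Wz n))).
rewrite /dGw; move: (wt z) (dG n z) (q1 n z) (grad2 z) => a b c d; ring.
Qed.

Let ddGw z n m : R := wt z * (ddG n m z - 2 * q2 n m z * grad2 z - 2 * q1 m z * dG n z
  - 2 * q1 n z * (dG m z - 2 * q1 m z * grad2 z)).

Let dvdGw z (Wz : W z) n m : is_derive z (X_ n) (dGw m) (ddGw z n m).
Proof.
apply: (is_derive_eq (dvM (dvwt (dvq Wz n)) (dvD (dvdG Wz n m)
  (dvN (dvM (dvC 2 z (X_ n)) (dvM (dvq1 Wz n m) (dvgrad2 Wz n))))))).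
rewrite /ddGw; move: (wt z) (dG n z) (dG m z) (q1 n z) (q1 m z) (grad2 z) (ddG n m z) (q2 n m z).
by move=> a b c d e f h i; ring.
Qed.

Let dvTq z (Wz : W z) : is_derive z T_ q (wt z * lap z).
Proof. by rewrite -flow//; exact: sm_der. Qed.

Let dvTq1 z (Wz : W z) l : is_derive z T_ (q1 l) (wt z * (dL l z - 2 * q1 l z * lap z)).
Proof.
apply: (is_derive_eq (sm_der T_ (Sq1 l) Wz)).
(* Exchanging the time and space derivatives allows the flow equation to be differentiated in
   space. *)
rewrite (sm_comm (X_ l) T_ oW q_smooth Wz) (derive_ext _ oW Wz flow).
rewrite (dval (dvM (dvwt (dvq Wz l)) (dvlap Wz l))).
move: (wt z) (dL l z) (q1 l z) (lap z) => a b c d; ring.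
Qed.

Let dvTsnd z (f : P -> R^o) : is_derive z T_ (fun z : V => f z.2 : R^o) 0.
Proof.
apply: DeriveDef; first by rewrite derivable_snd; exact: derivable0.
by rewrite derive_snd derive0.
Qed.

Let TG z : R := wt z * (2 * (\sum_(k < 2) \sum_(l < 2) A k l z.2 * q1 k z *
    (wt z * (dL l z - 2 * q1 l z * lap z))) - 2 * (wt z * lap z) * grad2 z).

Let dvTG z (Wz : W z) : is_derive z T_ G (TG z).
Proof.
have H := dv_sum (fun i => dv_sum (fun j =>
  dvM (dvM (dvTsnd z (A i j)) (dvTq1 Wz i)) (dvTq1 Wz j))).
apply: (is_derive_eq (dvM (dvwt (dvTq Wz)) H)).
rewrite (@sum_alg4 (fun i j => A i j z.2) (fun i => q1 i z)
  (fun l => wt z * (dL l z - 2 * q1 l z * lap z)) (A_sym Wz)) /TG.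
rewrite -/(grad2 z); set S := (X in 2 * X); move: S (wt z) (lap z) (grad2 z) => S a b c; ring.
Qed.

Let TG_le z (Wz : W z) : TG z <= wt z * \sum_(m < 2) \sum_(n < 2) A m n z.2 *
  (ddGw z n m - \sum_(k < 2) C m n k z.2 * dGw k z).
Proof.
have H := @evolution_algebra R (fun i j => A i j z.2) (fun i j => hess i j z)
  (fun i j k => C i j k z.2) (fun i => q1 i z) (fun i => dG i z) (fun i => dL i z)
  (fun i j => q2 i j z) (fun i j => ddG i j z) (wt z) (lap z) (grad2 z) (A_sym Wz).
have {H} := H _ (ginv00_gt0 g_sym g_pos (WU Wz)) (ginv_det_gt0 g_sym g_pos (WU Wz)) _ (C_sym Wz)
  (fun m => erefl) (bochner Wz) erefl erefl.
have dGwE k : dGw k z = wt z * (dG k z - 2 * q1 k z * grad2 z).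
  by rewrite /dGw mulrA.
have -> : \sum_(m < 2) \sum_(n < 2) A m n z.2 * (ddGw z n m - \sum_(k < 2) C m n k z.2 * dGw k z) =
    \sum_(m < 2) \sum_(n < 2) A m n z.2 * (ddGw z n m - \sum_(k < 2) C m n k z.2 *
      (wt z * (dG k z - 2 * q1 k z * grad2 z))).
  do 2 (apply: eq_bigr => ? _); congr (_ * (_ - _)).
  by apply: eq_bigr => k _; rewrite dGwE.
apply.
- by rewrite /hess (q2_sym Wz); congr (_ - _); apply: eq_bigr => k _; rewrite (C_sym Wz).
- by move=> n m; rewrite /hess subrK.
Qed.

(* [a = 0] yields the maximum principle for [p], [a = 1] Bernstein's gradient
   estimate. *)
Definition bernstein (a s m : R) (z : V) : R^o :=
  a * (((z.1 : R) + - s) * G z) + 2^-1 * ((q z + - m) * (q z + - m)).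

Lemma smooth_bernstein a s m : smooth W (bernstein a s m).
Proof.
have St : smooth W (fun z : V => (z.1 : R) + - s : R^o).
  by apply: smD => //; [exact: smooth_fst|exact: smC].
have Su : smooth W (fun z : V => q z + - m : R^o) by apply: smD => //; exact: smC.
have SG : smooth W G by apply: smM => //; exact: smooth_grad2.
by apply: smD => //; apply: smM => //; try exact: smC; exact: smM.
Qed.

Lemma bernstein_subsolution (a s m : R) z : 0 <= a <= 1 -> W z -> s <= z.1 ->
  'D_T_ (bernstein a s m) z <= wt z * \sum_(i < 2) \sum_(j < 2) A i j z.2 *
    ('D_(X_ j) ('D_(X_ i) (bernstein a s m)) z
     - \sum_(k < 2) C i j k z.2 * 'D_(X_ k) (bernstein a s m) z).
Proof.
move=> a01 Wz sz.
pose tau (y : V) : R^o := (y.1 : R) + - s; pose u y : R^o := q y + - m.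
have dtau (y v : V) : is_derive y v tau v.1.
  by apply: (is_derive_eq (dvD (is_derive_fst y v) (dvC (- s) y v))); rewrite addr0.
have du y v (d : R) : is_derive y v q d -> is_derive y v u d.
  by move=> dq; apply: (is_derive_eq (dvD dq (dvC (- m) y v))); rewrite addr0.
have dF y v (d e : R) : is_derive y v q d -> is_derive y v G e ->
    is_derive y v (bernstein a s m) (a * (G y * v.1 + tau y * e) + u y * d).
  move=> dq dG0; apply: (is_derive_eq (dvD (dvM (dvC a y v) (dvM (dtau y v) dG0))
    (dvM (dvC (2^-1) y v) (dvM (du _ _ _ dq) (du _ _ _ dq))))).
  by move: (tau y) (G y) (u y) => b c f; field.
pose dF1 i y : R^o := a * (tau y * dGw i y) + u y * q1 i y.
have dFX i y : W y -> 'D_(X_ i) (bernstein a s m) y = dF1 i y.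
  move=> Wy; rewrite (dval (dF _ _ _ _ (dvq Wy i) (dvG Wy i))).
  by rewrite mulr0 add0r.
have ddFX i j : 'D_(X_ j) ('D_(X_ i) (bernstein a s m)) z =
    a * (tau z * ddGw z j i) + (q1 i z * q1 j z + u z * q2 j i z).
  rewrite (derive_ext _ oW Wz (dFX i)).
  apply: (etrans (dval (dvD (dvM (dvC a z (X_ j)) (dvM (dtau z (X_ j)) (dvdGw Wz j i)))
    (dvM (du _ _ _ (dvq Wz j)) (dvq1 Wz j i))))).
  by rewrite !mulr0 !addr0 [u z * _ + _]addrC.
rewrite (dval (dF _ _ _ _ (dvTq Wz) (dvTG Wz))) mulr1.
have -> : \sum_(i < 2) \sum_(j < 2) A i j z.2 *
    ('D_(X_ j) ('D_(X_ i) (bernstein a s m)) z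
     - \sum_(k < 2) C i j k z.2 * 'D_(X_ k) (bernstein a s m) z) =
  \sum_(i < 2) \sum_(j < 2) A i j z.2 *
    (a * (tau z * ddGw z j i) + (q1 i z * q1 j z + u z * q2 j i z)
     - \sum_(k < 2) C i j k z.2 * (a * (tau z * dGw k z) + u z * q1 k z)).
  do 2 (apply: eq_bigr => ? _); rewrite ddFX; congr (_ * (_ - _)).
  by apply: eq_bigr => k _; rewrite dFX.
have tau0 : 0 <= tau z by rewrite subr_ge0.
have Q0 := @grad2_ge0 (fun i j => A i j z.2) (fun i => q1 i z) (A_sym Wz)
  (ginv00_gt0 g_sym g_pos (WU Wz)) (ginv_det_gt0 g_sym g_pos (WU Wz)).
exact: (@bernstein_algebra (fun i j => A i j z.2) (fun i j => q2 i j z) (ddGw z)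
  (fun i j k => C i j k z.2) (fun i => q1 i z) (fun i => dGw i z) (wt z) (tau z) (u z)
  _ _ a01 (expR_ge0 _) Q0 tau0 (q2_sym Wz) (TG_le Wz)).
Qed.

End SpaceTime.

(** * Charts *)

Section Charts.
Context {R : realType} {M : smooth_surface R}.
Local Notation P := 'rV[R]_2.
Implicit Types (phi psi : chart R M) (x : M) (y : P).

Lemma cran_cmap phi x : cdom phi x -> cran phi (cmap phi x).
Proof. by move=> dx; exists x. Qed.

Lemma cdom_cinv phi y : cran phi y -> cdom phi (cinv phi y).
Proof. by case=> x dx <-; rewrite cmapK. Qed.

Lemma cinvK phi y : cran phi y -> cmap phi (cinv phi y) = y.
Proof. by case=> x dx <-; rewrite cmapK. Qed.

Lemma overlapP phi psi y : overlap phi psi y <-> cran phi y /\ cdom psi (cinv phi y).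
Proof.
split=> [[x [dx dx'] <-]|[ry dy]]; first by rewrite cmapK//; split=> //; exact: cran_cmap.
by exists (cinv phi y); [split=> //; exact: cdom_cinv|exact: cinvK].
Qed.

Lemma overlap_cmap phi psi x : cdom phi x -> cdom psi x -> overlap phi psi (cmap phi x).
Proof. by move=> dx dx'; exists x. Qed.

Lemma open_overlap phi psi : open (overlap phi psi).
Proof.
rewrite openE => y /overlapP[ry dy].
have : nbhs y (cran phi) by apply: open_nbhs_nbhs; split=> //; exact: cran_open.
have : nbhs y (cinv phi @^-1` cdom psi).
  by apply: cinv_continuous => //; apply: open_nbhs_nbhs; split=> //; exact: cdom_open.
by rewrite /interior; apply: filterS2 => z dz rz; apply/overlapP.
Qed.

Lemma cinv_transition phi psi y : overlap phi psi y ->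
  cinv psi (transition phi psi y) = cinv phi y.
Proof. by move=> /overlapP[ry dy]; rewrite /transition /= cmapK. Qed.

Lemma cran_transition phi psi y : overlap phi psi y -> cran psi (transition phi psi y).
Proof. by move=> /overlapP[ry dy]; exact: cran_cmap. Qed.

Lemma transition_cmap phi psi x : cdom phi x -> transition phi psi (cmap phi x) = cmap psi x.
Proof. by move=> dx; rewrite /transition /= cmapK. Qed.

Definition drow (f : P -> R) y : P := \row_(i < 2) partial i f y.

Definition C1 (u : M -> R) : Prop :=
  forall phi, atlas phi -> Ck 1 (cran phi) (u \o cinv phi : P -> R^o).

Definition jac phi psi y : 'M[R]_2 :=
  \matrix_(i, j) ('D_(e_ i) (transition phi psi) y) 0 j.

Lemma drow_transition phi psi (u : M -> R) y (U : set P) : atlas phi -> atlas psi ->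
  open U -> U (transition phi psi y) -> Ck 1 U (u \o cinv psi : P -> R^o) ->
  overlap phi psi y ->
  drow (u \o cinv phi) y = drow (u \o cinv psi) (transition phi psi y) *m (jac phi psi y)^T.
Proof.
move=> aphi apsi oU Ut Cu oy; apply/rowP => i; rewrite !mxE sum2 !mxE.
have [_ /(_ (e_ i))[dT _]] := atlas_smooth aphi apsi 1.
have H := derive_chain (dT _ oy) (C1_differentiable oU Ut Cu).
rewrite mulrC [partial 1 _ _ * _]mulrC -(dval H).
apply: (derive_ext _ (@open_overlap phi psi) oy) => z oz.
by rewrite /= cinv_transition.
Qed.

Variable h : riemannian_metric M.

Lemma gmat_transition_mx phi psi y : atlas phi -> atlas psi -> overlap phi psi y ->
  gmat h phi y = jac phi psi y *m gmat h psi (transition phi psi y) *m (jac phi psi y)^T.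
Proof.
move=> aphi apsi oy; apply/matrixP => i j.
have dT a : 'D_(e_ a) (transition phi psi) y = row a (jac phi psi y).
  by apply/rowP => b; rewrite !mxE.
have := gmat_transition h aphi apsi oy (e_ i) (e_ j); rewrite !dT.
move: (jac _ _ _) (gmat h psi _) (gmat h phi y) => J g2 g1 /matrixP/(_ 0 0).
have rE a b : row a J 0 b = J a b by rewrite mxE.
rewrite !quadE !rE => E.
transitivity (((e_ i : P) 0 0) * g1 0 0 * ((e_ j : P) 0 0) +
  (e_ i : P) 0 0 * g1 0 1 * (e_ j : P) 0 1 + (e_ i : P) 0 1 * g1 1 0 * (e_ j : P) 0 0
  + (e_ i : P) 0 1 * g1 1 1 * (e_ j : P) 0 1).
  by move: i j {E}; apply: forall2; apply: forall2;
    rewrite !e_E /= ?mulr0n ?mulr1n ?(mulr1, mul1r, mulr0, mul0r, addr0, add0r).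
rewrite E !mxE !sum2 !mxE !sum2 ?mxE.
move: (J i 0) (J i 1) (J j 0) (J j 1) (g2 0 0) (g2 0 1) (g2 1 0) (g2 1 1) => a b c d p q r s.
ring.
Qed.

Definition grad_dot phi (f k : P -> R) y : R :=
  (drow f y *m invmx (gmat h phi y) *m (drow k y)^T) 0 0.

Lemma gmat_unit phi y : atlas phi -> cran phi y -> gmat h phi y \in unitmx.
Proof.
move=> aphi ry; rewrite unitmxE unitfE gt_eqF//.
exact: (detg_gt0 (gmat_sym h aphi) (gmat_pos h aphi)).
Qed.

(** The Jacobians coming from the two differentials cancel those in the inverse of the transformed
    metric. *)
Lemma grad_dot_transition phi psi (u v : M -> R) y (U : set P) : atlas phi -> atlas psi ->
  open U -> U (transition phi psi y) -> Ck 1 U (u \o cinv psi : P -> R^o) ->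
  Ck 1 U (v \o cinv psi : P -> R^o) -> overlap phi psi y ->
  grad_dot phi (u \o cinv phi) (v \o cinv phi) y =
  grad_dot psi (u \o cinv psi) (v \o cinv psi) (transition phi psi y).
Proof.
move=> aphi apsi oU Ut Cu Cv oy; rewrite /grad_dot.
rewrite (drow_transition aphi apsi oU Ut Cu oy) (drow_transition aphi apsi oU Ut Cv oy).
have [ry dy] := (overlapP _ _ _).1 oy.
have u1 := gmat_unit aphi ry; have u2 := gmat_unit apsi (cran_transition oy).
move: u1; rewrite (gmat_transition_mx aphi apsi oy).
set J := jac _ _ _; set g2 := gmat _ _ _ => u1.
(* Invertibility of the Jacobian is read off from the transformation law: it is a factor of an
   invertible metric matrix. *)
have uJ : J \in unitmx by move: u1; rewrite unitmx_mul unitmx_mul => /andP[/andP[]].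
have uJT : J^T \in unitmx by rewrite unitmx_tr.
have -> : invmx (J *m g2 *m J^T) = invmx J^T *m (invmx g2 *m invmx J).
  apply: (can_inj (mulKmx u1)); rewrite mulmxV//.
  by rewrite !mulmxA mulmxK// mulmxK// mulmxV.
by rewrite trmx_mul trmxK !mulmxA mulmxK// -!mulmxA mulKmx.
Qed.

End Charts.

(** * Maximum principle *)

Opaque christoffel ginv derive e_.

Lemma line_near {R : realType} {V : normedModType R} (U : set V) (x v : V) :
  open U -> U x -> exists2 r : R, 0 < r & forall s : R, `|s| <= r -> U (s *: v + x).
Proof.
move=> oU Ux; have [r /= r0 rU] := (nbhs_ballP (0 : R) _).1 (ball_line v 0 oU Ux).
exists (r / 2); first by rewrite divr_gt0.
move=> s sr; have := rU (r / 2); rewrite /ball /= sub0r normrN gtr0_norm ?divr_gt0//.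
have r2 : r / 2 < r by rewrite ltr_pdivrMr// ltr_pMr// ltr1n.
move=> /(_ r2 s 0 sr); rewrite normr0 scale0r add0r; apply.
by rewrite divr_ge0// ltW.
Qed.

Section LocalMaximum.
Context {R : realType} {V : normedModType R}.
Variables (U : set V) (oU : open U) (f : V -> R^o) (x : V) (Ux : U x).
Hypothesis f_smooth : smooth U f.
Hypothesis x_max : forall y, U y -> f y <= f x.

Lemma max_derive0 v : 'D_v f x = 0.
Proof.
have [r r0 rU] := line_near v oU Ux.
pose g (s : R) : R := f (s *: v + x).
have gd (s : R) : s \in `]-r, r[%R -> is_derive s 1 g ('D_v f (s *: v + x)).
  rewrite in_itv /= -ltr_norml => sr; apply: is_derive_line.
  by have [] := sm_der v f_smooth (rU s (ltW sr)).
have g0 : g 0 = f x by rewrite /g scale0r add0r.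
have h0 : (0 : R) \in `]-r, r[%R by rewrite in_itv /= oppr_lt0 r0.
have := @derive1_at_max R g (- r) r 0 _ _ h0 _.
have [_ e] := gd 0 h0; rewrite scale0r add0r in e.
move=> H; rewrite -e; apply: dval; apply: H.
- by lra.
- by move=> s /gd[].
- move=> s; rewrite in_itv /= -ltr_norml => sr; rewrite g0; apply: x_max.
  exact: rU (ltW sr).
Qed.

(** If the second derivative were positive near [x], the first one, zero at [x], would be positive
    just after it, and [f] would exceed its maximum. *)
Lemma max_derive2 v : 'D_v ('D_v f) x <= 0.
Proof.
rewrite leNgt; apply/negP => D0.
have SD := sm_derive v (sm_derive v f_smooth).
pose D2 : V -> R := 'D_v ('D_v f).
have Dc : D2 y @[y --> x] --> D2 x := sm_cont SD Ux.
pose K := [set y | U y /\ 0 < D2 y].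
have nK : nbhs x K.
  apply: filterI; first exact: open_nbhs_nbhs.
  exact: (cvgr_gt (D2 x) Dc 0 D0).
have ix : interior K x := nK.
have [d d0 dU] := line_near v (@open_interior _ K) ix.
have {}dU (s : R) : `|s| <= d -> U (s *: v + x) /\ 0 < D2 (s *: v + x).
  by move=> /dU /interior_subset.
have gd (k : V -> R^o) (s : R) : smooth U k -> `|s| <= d ->
    is_derive s 1 (fun s : R => k (s *: v + x) : R) ('D_v k (s *: v + x)).
  by move=> Sk /dU[Us _]; apply: is_derive_line; have [] := sm_der v Sk Us.
have mvt (k : V -> R^o) (b : R) : smooth U k -> 0 < b -> b <= d ->
    exists2 c : R, 0 < c < b & k (b *: v + x) - k x = 'D_v k (c *: v + x) * b.
  move=> Sk b0 bd; pose g (s : R) : R := k (s *: v + x).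
  have bs (s : R) : 0 <= s -> s <= b -> `|s| <= d.
    by move=> s0 sb; rewrite ger0_norm// (le_trans sb).
  have [||c] := @MVT R g (fun s => 'D_v k (s *: v + x)) 0 b b0.
  - move=> s; rewrite in_itv /= => /andP[s0 sb]; apply: gd => //.
    by apply: bs; exact: ltW.
  - apply: derivable_within_continuous => s; rewrite in_itv /= => /andP[s0 sb].
    by have [] := gd k s Sk (bs _ s0 sb).
  - rewrite in_itv /= => cb; rewrite /g scale0r add0r subr0 => E; by exists c.
have [c /andP[c0 cd] fc] := mvt f d f_smooth d0 (lexx _).
have [e /andP[e0 ec] De] := mvt ('D_v f) c (sm_derive v f_smooth) c0 (ltW cd).
have ed : `|e| <= d by rewrite gtr0_norm// (le_trans (ltW ec))// ltW.
have [_ Dpos] := dU _ ed.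
have Dc1 : 0 < 'D_v f (c *: v + x).
  by move: De; rewrite max_derive0 subr0 => ->; rewrite mulr_gt0.
have [Ud _] : U (d *: v + x) /\ 0 < D2 (d *: v + x).
  by apply: dU; rewrite gtr0_norm.
have := x_max Ud; rewrite -subr_le0 fc leNgt mulr_gt0//.
Qed.

End LocalMaximum.

Lemma dvL {R : realType} {V : normedModType R} (f k : V -> R^o) (z v : V)
    (a b c d : R) : is_derive z v f a -> is_derive z v k b ->
  is_derive z v (fun y => c * f y + d * k y : R^o) (c * a + d * b).
Proof.
move=> fa kb; apply: (is_derive_eq (dvD (dvM (dvC c z v) fa) (dvM (dvC d z v) kb))).
by rewrite !mulr0 !addr0.
Qed.

Section PlaneMaximum.
Context {R : realType}.
Local Notation P := 'rV[R]_2.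

Lemma elliptic_algebra (A D : 'I_2 -> 'I_2 -> R) (a b c : R) :
  A 1 0 = A 0 1 -> A 0 0 = a ^+ 2 -> A 0 1 = a * b -> A 1 1 = b ^+ 2 + c ^+ 2 ->
  \sum_(i < 2) \sum_(j < 2) A i j * D i j =
  a * (a * D 0 0 + b * D 1 0) + b * (a * D 0 1 + b * D 1 1)
  + (0 * (0 * D 0 0 + c * D 1 0) + c * (0 * D 0 1 + c * D 1 1)).
Proof. by move=> As aa ab cc; rewrite !sum2 As aa ab cc; ring. Qed.

(** By the factorization of [A], the operator is the sum of the second derivatives in the two
    directions [(a, b)] and [(0, c)]. *)
Lemma elliptic_at_max (U : set P) (f : P -> R^o) (x : P) (A : 'I_2 -> 'I_2 -> R) :
  open U -> U x -> smooth U f -> (forall y, U y -> f y <= f x) ->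
  A 1 0 = A 0 1 -> 0 < A 0 0 -> 0 < A 0 0 * A 1 1 - A 0 1 ^+ 2 ->
  \sum_(i < 2) \sum_(j < 2) A i j * 'D_(e_ j) ('D_(e_ i) f) x <= 0.
Proof.
move=> oU Ux Sf xmax As A0 Adet.
have [a [b [c [aa ab cc]]]] := cholesky2 A0 Adet.
have D2 v : 'D_v ('D_v f) x = v 0 0 * (v 0 0 * 'D_(e_ 0) ('D_(e_ 0) f) x
     + v 0 1 * 'D_(e_ 0) ('D_(e_ 1) f) x)
   + v 0 1 * (v 0 0 * 'D_(e_ 1) ('D_(e_ 0) f) x + v 0 1 * 'D_(e_ 1) ('D_(e_ 1) f) x).
  rewrite (derive_partial v oU Ux (sm_derive v Sf 1)) !partialE.
  have Dv i : 'D_(e_ i) ('D_v f : P -> R^o) x =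
      v 0 0 * 'D_(e_ i) ('D_(e_ 0) f) x + v 0 1 * 'D_(e_ i) ('D_(e_ 1) f) x.
    rewrite (@derive_ext _ _ _ U _ (fun y => v 0 0 * 'D_(e_ 0) f y + v 0 1 * 'D_(e_ 1) f y : R^o))//.
      have d j := sm_der (e_ i) (sm_derive (e_ j) Sf) Ux.
      exact: (dval (dvL _ _ (d 0) (d 1))).
    by move=> y Uy; rewrite (derive_partial v oU Uy (Sf 1)).
  by congr (_ * _ + _ * _); exact: Dv.
have H1 := max_derive2 oU Ux Sf xmax (row2 (a, b)).
have H2 := max_derive2 oU Ux Sf xmax (row2 (0, c)).
rewrite D2 !mxE /= in H1; rewrite D2 !mxE /= in H2.
have {H1 H2} := lerD H1 H2; rewrite addr0; apply: le_trans.
rewrite le_eqVlt; apply/orP; left; apply/eqP.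
exact: (elliptic_algebra (fun i j => 'D_(e_ j) ('D_(e_ i) f) x) As aa ab cc).
Qed.

End PlaneMaximum.

Section ParabolicMaximum.
Context {R : realType}.

Transparent derive.
(** Only times before [t] are compared, since in [parabolic_max] the maximum may be attained at the
    final time. *)
Lemma derive_left_ge (g : R -> R) (s t d e : R) : s < t -> is_derive t 1 g d ->
  (forall r, s <= r -> r < t -> g r - e * r <= g t - e * t) -> e <= d.
Proof.
move=> st [dg dE] gt; rewrite leNgt; apply/negP => de.
have dc : h^-1 *: (g (h *: (1 : R) + t) - g t) @[h --> 0^'] --> d by rewrite -dE; exact: dg.
have H : nbhs (0 : R) (fun h => h != 0 -> h^-1 *: (g (h *: (1 : R) + t) - g t) < e).
  exact: (cvgr_lt d dc e de).
have [r /= r0 rH] := (nbhs_ballP (0 : R) _).1 H.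
pose h := Num.min (r / 2) (t - s).
have h0 : 0 < h by rewrite lt_min divr_gt0//= subr_gt0.
have hr : h < r by rewrite gt_min ltr_pdivrMr// ltr_pMr// ltr1n.
have := rH (- h); rewrite /ball /= sub0r opprK gtr0_norm// => /(_ hr).
rewrite oppr_eq0 gt_eqF// => /(_ isT).
rewrite [(- h) *: _]mulr1 [_ *: _]mulrC invrN mulrN ltrNl ltr_pdivlMr//.
have := gt (- h + t); rewrite gtrDr oppr_lt0 h0.
have -> : s <= - h + t by rewrite addrC lerBrDr -lerBrDl ge_min lexx orbT.
move=> /(_ isT isT); lra.
Qed.
Opaque derive.

(** The sign of the time derivative is asked for only where [F t] is maximal in space. A computation
    in one chart can verify this, so the argument itself is free of charts. *)
Lemma parabolic_max (M : topologicalType) (F : R -> M -> R) (s T K : R) :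
  compact [set: M] ->
  {within `[s, T] `*` [set: M], continuous (fun z : R * M => F z.1 z.2)} ->
  (forall t x, s < t -> t <= T -> (forall y, F t y <= F t x) ->
     exists2 d, is_derive t 1 (F^~ x) d & d <= 0) ->
  (forall x, F s x <= K) -> forall t x, s <= t -> t <= T -> F t x <= K.
Proof.
move=> cM cF dF F0 t1 x1 st1 t1T; rewrite leNgt; apply/negP => FK.
have [E|ns] := eqVneq t1 s; first by move: FK; rewrite E ltNge F0.
have {ns}st1' : s < t1 by rewrite lt_neqAle eq_sym ns.
(* This slope uses up half of the excess over [K] at time [t1], so [Phi] cannot have its maximum at
   time [s]. *)
pose e := (F t1 x1 - K) / (2 * (t1 - s)).
have e0 : 0 < e by rewrite divr_gt0 ?subr_gt0 ?mulr_gt0 ?subr_gt0.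
have ee : e * (t1 - s) = (F t1 x1 - K) / 2.
  by rewrite /e; field; rewrite gt_eqF// subr_gt0.
pose Phi (z : R * M) : R := F z.1 z.2 - e * (z.1 - s).
pose A := `[s, T] `*` [set: M].
have cA : compact A by apply: compact_setX => //; exact: segment_compact.
have A0 : A !=set0 by exists (t1, x1); split=> //=; rewrite in_itv /= st1.
have cPhi : {within A, continuous Phi}.
  apply: within_continuousB => //; apply: continuous_subspaceT => z.
  apply: cvgM; first exact: cvg_cst.
  by apply: cvgB; [exact: cvg_fst|exact: cvg_cst].
have [[t0 x0]] := compact_EVT_max A0 cA cPhi.
rewrite inE => -[/=]; rewrite in_itv /= => /andP[st0 t0T] _ zmax.
have P1 : F t1 x1 - e * (t1 - s) <= F t0 x0 - e * (t0 - s).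
  by apply: (zmax (t1, x1)); rewrite inE; split=> //=; rewrite in_itv /= st1.
have st0' : s < t0.
  rewrite lt_neqAle st0 andbT; apply/eqP => E; move: P1.
  rewrite -E subrr mulr0 subr0 ee; have := F0 x0; lra.
have [d d1 d2] : exists2 d, is_derive t0 1 (F^~ x0) d & d <= 0.
  apply: dF => // y; have := zmax (t0, y); rewrite inE /Phi /= lerD2r; apply.
  by split=> //=; rewrite in_itv /= st0.
have := @derive_left_ge (F^~ x0) s t0 d e st0' d1.
suff H : forall r, s <= r -> r < t0 -> F r x0 - e * r <= F t0 x0 - e * t0.
  by move=> /(_ H); rewrite leNgt (le_lt_trans d2 e0).
move=> r sr rt; have := zmax (r, x0); rewrite inE /Phi /= => /(_ _).
have rA : A (r, x0) by split=> //=; rewrite in_itv /= sr (le_trans (ltW rt)).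
by move=> /(_ rA); lra.
Qed.

End ParabolicMaximum.

(** * The flow on the surface *)

Lemma Ck_local (R : realType) (V W : normedModType R) k (U : set V) (f : V -> W) :
  (forall x, U x -> exists U', [/\ open U', U' x & Ck k U' f]) -> Ck k U f.
Proof.
elim: k f => [|k IH] f Cf.
  by split=> // x /Cf[U' [oU' U'x [cf _]]]; exact: cf.
split=> [x /Cf[U' [oU' U'x [cf _]]]|v]; first exact: cf.
split=> [x /Cf[U' [oU' U'x [_ /(_ v)[dv _]]]]|]; first exact: dv.
apply: IH => x /Cf[U' [oU' U'x [_ /(_ v)[_ Dv]]]].
by exists U'.
Qed.

Section Flow.
Context {R : realType} {M : smooth_surface R}.
Local Notation P := 'rV[R]_2.
Local Notation V := (R^o * P)%type.
Implicit Types (phi psi : chart R M).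

(** Positive times only: there a local smooth extension agrees with the solution on an open set of
    space-time, so derivatives in all directions are the ordinary ones. *)
Definition cyl phi : set V := [set z | 0 < (z.1 : R) /\ cran phi z.2].

Definition rep (F : R -> M -> R) phi (z : V) : R^o := F z.1 (cinv phi z.2).

Lemma open_cyl phi : open (cyl phi).
Proof.
have -> : cyl phi = (@fst R^o P @^-1` [set t : R^o | (0 : R) < t]) `&` (@snd R^o P @^-1` cran phi).
  by apply/seteqP; split.
apply: openI.
  by apply: open_comp => [z _|]; [exact: cvg_fst|exact: open_gt].
by apply: open_comp => [z _|]; [exact: cvg_snd|exact: cran_open].
Qed.

Variable h : riemannian_metric M.

Lemma grad_dotE phi (f k : P -> R) y : grad_dot h phi f k y =
  \sum_(i < 2) \sum_(j < 2) ginv (gmat h phi) i j y * partial i f y * partial j k y.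
Proof.
rewrite /grad_dot quadE !sum2 !ginvE !mxE.
move: (invmx _) (partial 0 f y) (partial 1 f y) (partial 0 k y) (partial 1 k y) => A a b c d.
by move: (A 0 0) (A 0 1) (A 1 0) (A 1 1) => e f' g h'; ring.
Qed.

(** Near a positive time the restriction to nonnegative times is void, so the limit in the flow
    equation is the ordinary derivative. *)
Lemma quotient_limit (g : R -> R) (t d L : R) : 0 < t -> is_derive t 1 g d ->
  (fun s : R => (g s - g t) / (s - t)) @ within [set s : R | 0 <= s] t^' --> L -> L = d.
Proof.
move=> t0 [dg dE] gL.
have shift : (fun r : R => r + t) @ (0 : R)^' --> t^'.
  move=> A /= [e /= e0 eA]; exists e => //= r re r0; apply: eA => /=.
    by move: re; rewrite /ball /= sub0r normrN opprD addrCA subrr addr0 normrN.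
  by rewrite -subr_eq0 addrK.
have gL' : (fun s : R => (g s - g t) / (s - t)) @ t^' --> L.
  move=> A /gL nA.
  have {}nA : t^' (fun s => 0 <= s -> A ((g s - g t) / (s - t))) := nA.
  have nt : \forall s \near t^', 0 <= s.
    by apply: nbhs_dnbhs; apply: filterS (lt_nbhsr t0) => s; exact: ltW.
  change (t^' (fun s => A ((g s - g t) / (s - t)))).
  apply: (@filterS _ t^' _ _ _ _ (filterI nA nt)) => s [H s0]; exact: H.
have gd : (fun r : R => r^-1 *: (g (r *: (1 : R) + t) - g t)) @ (0 : R)^' --> d.
  by rewrite -dE; exact: dg.
symmetry; apply: (@cvg_unique R (@Rhausdorff R) _ _ d L gd).
apply: cvg_trans (cvg_comp _ _ shift gL').
apply: near_eq_cvg; near=> r => /=.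
by rewrite addrK [r *: 1]mulr1 mulrC.
Unshelve. all: by end_near. Qed.

Hypothesis h_flat : flat h.
Variables (p : R -> M -> R) (sol : normalized_ricci_flow_solution h p).

Section Chart.
Variables (phi : chart R M) (aphi : atlas phi).

Let gs := gmat_smooth h aphi.
Let gy := gmat_sym h aphi.
Let gp := gmat_pos h aphi.
Local Notation A := (ginv (gmat h phi)).
Local Notation C := (christoffel (gmat h phi)).

Lemma smooth_rep : smooth (cyl phi) (rep p phi).
Proof.
move=> k; apply: Ck_local => z [z0 rz].
have [U [f [oU Uz Sf fE]]] := sol.1 phi aphi z (conj (ltW z0) rz).
exists (U `&` cyl phi); split; first by apply: openI => //; exact: open_cyl.
  by split.
apply: (@Ck_ext _ _ _ _ _ f).
- by apply: openI => //; exact: open_cyl.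
- by move=> y [Uy [y0 ry]]; rewrite /rep fE//; split=> //; exact: ltW.
- by apply: Ck_sub (Sf k) => y [].
Qed.

Lemma smooth_rep_slice (t : R) : 0 < t -> smooth (cran phi) (p t \o cinv phi : P -> R^o).
Proof. by move=> t0; apply: (smooth_slice (q := rep p phi) (t := t) _ smooth_rep). Qed.

Lemma is_derive_rep_time (t : R) y : 0 < t -> cran phi y ->
  is_derive t 1 (fun s => p s (cinv phi y) : R^o) ('D_T_ (rep p phi) (t, y)).
Proof.
move=> t0 ry; have [d1 d2] := sm_der T_ smooth_rep (conj t0 ry : cyl phi (t, y)).
apply: DeriveDef; first by rewrite (derivable_time (rep p phi)).
exact: (derive_time (rep p phi)).
Qed.

Lemma rep_flow z : cyl phi z -> 'D_T_ (rep p phi) z =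
  expR (- 2 * rep p phi z) * \sum_(i < 2) \sum_(j < 2) A i j z.2 *
    ('D_(X_ i) ('D_(X_ j) (rep p phi)) z
     - \sum_(k < 2) C i j k z.2 * 'D_(X_ k) (rep p phi) z).
Proof.
case: z => t y [/= t0 ry].
have := sol.2 t (cinv phi y) phi (ltW t0) aphi (cdom_cinv ry).
move=> /(quotient_limit t0 (is_derive_rep_time t0 ry)) <-.
have E1 k : partial k (p t \o cinv phi) y = 'D_(X_ k) (rep p phi) (t, y).
  exact: (derive_slice (rep p phi)).
have E2 i j : partial i (partial j (p t \o cinv phi)) y =
    'D_(X_ i) ('D_(X_ j) (rep p phi)) (t, y).
  have -> : partial j (p t \o cinv phi) = (fun y => 'D_(X_ j) (rep p phi) (t, y)) :> (P -> R).
    by apply/funext => y'; exact: (derive_slice (rep p phi)).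
  exact: (derive_slice ('D_(X_ j) (rep p phi) : V -> R^o)).
have LE : laplacian h phi (p t) (cinv phi y) = \sum_(i < 2) \sum_(j < 2) A i j y *
    (partial i (partial j (p t \o cinv phi)) y
     - \sum_(k < 2) C i j k y * partial k (p t \o cinv phi) y).
  rewrite /laplacian cinvK//.
  exact: (laplacian_coordE (@cran_open _ _ phi) gs gy gp ry (smooth_rep_slice t0)).
rewrite LE /rep /=; f_equal.
apply: eq_bigr => i _; apply: eq_bigr => j _; rewrite E2.
rewrite (eq_bigr (fun k => C i j k y * 'D_(X_ k) (rep p phi) (t, y)))// => k _.
by rewrite E1.
Qed.

(** At a spatial maximum the first derivatives vanish, which removes the Christoffel terms and
    leaves the second derivatives traced against a positive definite matrix. *)
Lemma chart_max (f : V -> R^o) (t w : R) y : smooth (cyl phi) f -> 0 < t -> cran phi y ->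
  0 <= w -> (forall y', cran phi y' -> f (t, y') <= f (t, y)) ->
  'D_T_ f (t, y) <= w * \sum_(i < 2) \sum_(j < 2) A i j y *
    ('D_(X_ j) ('D_(X_ i) f) (t, y) - \sum_(k < 2) C i j k y * 'D_(X_ k) f (t, y)) ->
  'D_T_ f (t, y) <= 0.
Proof.
move=> Sf t0 ry w0 fmax /le_trans; apply; apply: mulr_ge0_le0 => //.
have oU := @cran_open _ _ phi.
have Sfs : smooth (cran phi) (fun y => f (t, y) : R^o).
  by apply: (smooth_slice (t := t) _ Sf).
have := elliptic_at_max oU ry Sfs fmax (ginv10 gy gp ry) (ginv00_gt0 gy gp ry)
  (ginv_det_gt0 gy gp ry).
apply: le_trans; rewrite le_eqVlt; apply/orP; left; apply/eqP.
apply: eq_bigr => i _; apply: eq_bigr => j _; congr (_ * _).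
rewrite big1 ?subr0 => [|k _].
  have -> : 'D_(e_ i) (fun y => f (t, y) : R^o) = (fun y => 'D_(X_ i) f (t, y)) :> (P -> R).
    by apply/funext => y'; exact: (derive_slice f).
  by symmetry; exact: (derive_slice ('D_(X_ i) f : V -> R^o)).
rewrite -[X in _ * X](derive_slice f) (max_derive0 oU ry Sfs fmax).
by rewrite mulr0.
Qed.

End Chart.

End Flow.

Section GlobalFlow.
Context {R : realType} {M : smooth_surface R}.
Local Notation P := 'rV[R]_2.
Local Notation V := (R^o * P)%type.
Implicit Types (phi psi : chart R M).

Definition chart_at (x : M) : chart R M := s2val (cid2 (atlas_cover x)).

Lemma chart_atP x : atlas (chart_at x).
Proof. exact: (s2valP (cid2 (atlas_cover x))). Qed.

Lemma cdom_chart_at x : cdom (chart_at x) x.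
Proof. exact: (s2valP' (cid2 (atlas_cover x))). Qed.

Lemma continuous_rep (F : R -> M -> R) phi (t : R) (x : M) : atlas phi -> cdom phi x ->
  0 < t -> smooth (cyl phi) (rep F phi) ->
  {for (t, x), continuous (fun z : R * M => F z.1 z.2)}.
Proof.
move=> aphi dx t0 SF.
pose c (z : R * M) : V := (z.1, cmap phi z.2).
have cc : {for (t, x), continuous c}.
  apply: (@cvg_pair _ _ _ (nbhs (t, x)) (nbhs (t : R^o)) (nbhs (cmap phi x)) _ _ _
    (fun z : R * M => z.1 : R^o) (fun z : R * M => cmap phi z.2)); first exact: cvg_fst.
  by apply: (@cvg_comp _ _ _ snd (cmap phi) _ (nbhs x)); [exact: cvg_snd|exact: cmap_continuous].
have cF : {for (t, x), continuous (rep F phi \o c)}.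
  apply: continuous_comp => //; apply: (sm_cont SF).
  by split=> //; exact: cran_cmap.
have oD : open (@snd R M @^-1` cdom phi).
  by apply: open_comp => [z _|]; [exact: cvg_snd|exact: cdom_open].
apply: (continuous_ext oD _ _ cF) => //= z dz.
by rewrite /rep /= cmapK.
Qed.

Variable h : riemannian_metric M.

Definition gdot (u v : M -> R) (x : M) : R :=
  grad_dot h (chart_at x) (u \o cinv (chart_at x)) (v \o cinv (chart_at x))
    (cmap (chart_at x) x).

Lemma gdotE u v x phi : atlas phi -> cdom phi x -> C1 u -> C1 v ->
  gdot u v x = grad_dot h phi (u \o cinv phi) (v \o cinv phi) (cmap phi x).
Proof.
move=> aphi dx Cu Cv; have dx' := cdom_chart_at x.
rewrite -(transition_cmap phi dx').
have oy := overlap_cmap dx' dx.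
apply: (grad_dot_transition h (chart_atP x) aphi (@cran_open _ _ phi) (cran_transition oy)) => //;
[exact: Cu|exact: Cv].
Qed.

Definition gradsq (u : M -> R) (x : M) : R := gdot u u x.

Lemma gradsqE u x phi : atlas phi -> cdom phi x -> C1 u ->
  gradsq u x = grad_dot h phi (u \o cinv phi) (u \o cinv phi) (cmap phi x).
Proof. by move=> aphi dx Cu; exact: gdotE. Qed.

Hypothesis h_flat : flat h.
Variables (p : R -> M -> R) (sol : normalized_ricci_flow_solution h p).

Lemma C1_flow t : 0 < t -> C1 (p t).
Proof. by move=> t0 phi aphi; exact: (smooth_rep_slice sol aphi t0 1). Qed.

(** The chart-free form of [bernstein], to which the maximum principle on the whole surface
    applies. *)
Definition bern (a s m t : R) (x : M) : R :=
  a * ((t - s) * (expR (- 2 * p t x) * gradsq (p t) x))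
  + 2^-1 * ((p t x - m) * (p t x - m)).

Lemma rep_bern a s m phi z : atlas phi -> cyl phi z ->
  bernstein (gmat h phi) (rep p phi) a s m z = rep (bern a s m) phi z.
Proof.
case: z => t y aphi [/= t0 ry].
have E k : partial k (p t \o cinv phi) y = 'D_(X_ k) (rep p phi) (t, y).
  exact: (derive_slice (rep p phi)).
have GE : gradsq (p t) (cinv phi y) = \sum_(i < 2) \sum_(j < 2)
    ginv (gmat h phi) i j y * 'D_(X_ i) (rep p phi) (t, y) * 'D_(X_ j) (rep p phi) (t, y).
  rewrite (gradsqE aphi (cdom_cinv ry) (C1_flow t0)) grad_dotE cinvK//.
  by apply: eq_bigr => i _; apply: eq_bigr => j _; rewrite !E.
by rewrite /rep /= /bern GE.
Qed.

Lemma smooth_rep_bern a s m phi : atlas phi -> smooth (cyl phi) (rep (bern a s m) phi).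
Proof.
move=> aphi; apply: (@sm_ext _ _ _ _ (bernstein (gmat h phi) (rep p phi) a s m)).
- exact: open_cyl.
- by move=> z cz; exact: rep_bern.
- exact: (smooth_bernstein (@cran_open _ _ phi) (gmat_smooth h aphi) (gmat_sym h aphi)
  (gmat_pos h aphi) (@open_cyl _ _ phi) (fun z cz => proj2 cz) (smooth_rep sol aphi) a s m).
Qed.

Lemma bern_max a s m t x : 0 <= a <= 1 -> 0 < t -> s <= t ->
  (forall y, bern a s m t y <= bern a s m t x) ->
  exists2 d, is_derive t 1 ((bern a s m)^~ x) d & d <= 0.
Proof.
move=> a01 t0 st bmax; pose phi := chart_at x.
have aphi : atlas phi := chart_atP x; have dx : cdom phi x := cdom_chart_at x.
have ry := cran_cmap dx; set y := cmap phi x in ry.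
have cy : cyl phi (t, y) by [].
pose f := bernstein (gmat h phi) (rep p phi) a s m.
have Sf : smooth (cyl phi) f.
  exact: (smooth_bernstein (@cran_open _ _ phi) (gmat_smooth h aphi) (gmat_sym h aphi)
  (gmat_pos h aphi) (@open_cyl _ _ phi) (fun z cz => proj2 cz) (smooth_rep sol aphi) a s m).
exists ('D_T_ f (t, y)).
  have [d1 d2] := sm_der T_ (smooth_rep_bern a s m aphi) cy.
  have E : (bern a s m)^~ x = (fun r => rep (bern a s m) phi (r, y)).
    by apply/funext => r; rewrite /rep /= cmapK.
  rewrite E; apply: DeriveDef; first by rewrite derivable_time.
  rewrite derive_time; symmetry.
  exact: (derive_ext _ (@open_cyl _ _ phi) cy (fun z => @rep_bern a s m phi z aphi)).
apply: (chart_max aphi Sf t0 ry (expR_ge0 (- 2 * rep p phi (t, y)))).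
  move=> y' ry'; rewrite /f !rep_bern//; rewrite /rep /= cmapK//.
have fl := fun y (ry : cran phi y) => h_flat aphi ry.
exact: (bernstein_subsolution (@cran_open _ _ phi) (gmat_smooth h aphi) (gmat_sym h aphi)
  (gmat_pos h aphi) fl (@open_cyl _ _ phi) (fun z cz => proj2 cz) (smooth_rep sol aphi)
  (rep_flow sol aphi) m a01 cy st).
Qed.

(** Continuity up to time 0 has to come from the local extension of the solution, because [cyl]
    contains positive times only. *)
Lemma continuous_flow (z : R * M) : 0 <= z.1 ->
  (fun z => p z.1 z.2) @ within [set z : R * M | 0 <= z.1] (nbhs z) --> p z.1 z.2.
Proof.
case: z => t x /= t0; pose phi := chart_at x.
have aphi : atlas phi := chart_atP x; have dx : cdom phi x := cdom_chart_at x.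
have [U [f [oU Uz Sf fE]]] := sol.1 phi aphi (t, cmap phi x) (conj t0 (cran_cmap dx)).
pose c (z : R * M) : V := (z.1, cmap phi z.2).
have cc : {for (t, x), continuous c}.
  apply: (@cvg_pair _ _ _ (nbhs (t, x)) (nbhs (t : R^o)) (nbhs (cmap phi x)) _ _ _
    (fun z : R * M => z.1 : R^o) (fun z : R * M => cmap phi z.2)); first exact: cvg_fst.
  by apply: (@cvg_comp _ _ _ snd (cmap phi) _ (nbhs x)); [exact: cvg_snd|exact: cmap_continuous].
have cf : f (c z) @[z --> (t, x)] --> f (c (t, x)).
  by apply: continuous_comp => //; exact: (sm_cont Sf).
have -> : p t x = f (c (t, x)).
  by rewrite -fE//=; [rewrite cmapK|split=> //=; exact: cran_cmap].
move=> A /cf nA.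
have nU : nbhs (t, x) (c @^-1` U) by apply: cc; exact: open_nbhs_nbhs.
have nD : nbhs (t, x) (@snd R M @^-1` cdom phi).
  by apply: cvg_snd; apply: open_nbhs_nbhs; split=> //; exact: cdom_open.
change (nbhs (t, x) (fun z : R * M => 0 <= z.1 -> A (p z.1 z.2))).
have nA' : nbhs (t, x) (fun z : R * M => A (f (c z))) := nA.
apply: (filterS _ (filterI nA' (filterI nU nD))) => -[s y] /= [Ay [Us dy]] s0.
suff <- : f (c (s, y)) = p s y by [].
by rewrite -fE//=; [rewrite cmapK|split=> //=; exact: cran_cmap].
Qed.

Hypothesis cM : compact [set: M].

Lemma within_flow (s t : R) : 0 <= s ->
  {within `[s, t] `*` [set: M], continuous (fun z : R * M => p z.1 z.2)}.
Proof.
move=> s0; apply/subspace_continuousP => z [/=]; rewrite in_itv /= => /andP[sz zt] _.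
apply: cvg_trans (continuous_flow (le_trans s0 sz)).
move=> A nA.
have nA' : nbhs z (fun z : R * M => 0 <= z.1 -> A (p z.1 z.2)) := nA.
change (nbhs z (fun z : R * M => (`[s, t] `*` [set: M]) z -> A (p z.1 z.2))).
apply: (filterS _ nA') => -[r y] /= Ay [/=].
by rewrite in_itv /= => /andP[sr _] _; apply: Ay; exact: le_trans sr.
Qed.

(** This is the case [a = 0]; the square yields the upper and the lower bound together. Only
    continuity of [p] is used at time [s], so the initial time is allowed. *)
Lemma flow_range m B s t : 0 <= s -> s <= t -> 0 <= B ->
  (forall x, `|p s x - m| <= B) -> forall x, `|p t x - m| <= B.
Proof.
move=> s0 st B0 ps x.
have bE r y : bern 0 s m r y = 2^-1 * (p r y - m) ^+ 2.
  by rewrite /bern mul0r add0r expr2.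
have sqE (u : R) : (2^-1 * u ^+ 2 <= 2^-1 * B ^+ 2) = (`|u| <= B).
  by rewrite ler_pM2l// -(ler_sqr (normr_nneg _) _) ?real_normK ?num_real// nnegrE.
have := @parabolic_max R M (bern 0 s m) s t (2^-1 * B ^+ 2) cM.
rewrite -sqE -bE; apply => //.
- have -> : (fun z : R * M => bern 0 s m z.1 z.2) =
    (fun u : R => 2^-1 * (u - m) ^+ 2) \o (fun z : R * M => p z.1 z.2).
    by apply/funext => z; rewrite bE.
  have cq : continuous (fun u : R => 2^-1 * (u - m) ^+ 2).
    move=> u; apply: cvgM; first exact: cvg_cst.
    by apply: (@cvgM _ _ _ _ (fun u => u - m) (fun u => u - m)); apply: cvgB => //; exact: cvg_cst.
  move=> z; apply: (@continuous_comp (subspace (`[s, t] `*` [set: M])) R R); last exact: cq.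
  exact: within_flow.
- move=> r y sr _ bmax; apply: bern_max bmax => //; first by rewrite lexx ler01.
    exact: le_lt_trans sr.
  exact: ltW.
- by move=> y; rewrite bE sqE.
Qed.

(** This is the case [a = 1]: at time [s] the gradient has factor zero, so the initial bound
    involves [p] alone. Continuity of the gradient on the closed time interval is what calls for
    [0 < s]. *)
Lemma flow_gradient m B s t : 0 < s -> s <= t -> 0 <= B ->
  (forall x, `|p s x - m| <= B) -> forall x,
  (t - s) * (expR (- 2 * p t x) * gradsq (p t) x) <= 2^-1 * B ^+ 2.
Proof.
move=> s0 st B0 ps x.
have sqE (u : R) : (2^-1 * u ^+ 2 <= 2^-1 * B ^+ 2) = (`|u| <= B).
  by rewrite ler_pM2l// -(ler_sqr (normr_nneg _) _) ?real_normK ?num_real// nnegrE.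
have H : bern 1 s m t x <= 2^-1 * B ^+ 2.
  apply: (@parabolic_max R M (bern 1 s m) s t (2^-1 * B ^+ 2) cM) => //.
  - apply: continuous_in_subspaceT => -[r y]; rewrite inE /= => -[/=].
    rewrite in_itv /= => /andP[sr _] _.
    apply: (continuous_rep (chart_atP y) (cdom_chart_at y) (lt_le_trans s0 sr)).
    by apply: smooth_rep_bern; exact: chart_atP.
  - move=> r y sr _ bmax; apply: bern_max bmax => //; first by rewrite ler01 lexx.
      exact: lt_trans sr.
    exact: ltW.
  - by move=> y; rewrite /bern subrr mul0r mulr0 add0r -expr2 sqE.
apply: le_trans H; rewrite /bern mul1r lerDl mulr_ge0// -expr2 sqr_ge0//.
Qed.

End GlobalFlow.

(** * Oscillation and gradient *)

Section Oscillation.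
Context {R : realType} {M : smooth_surface R}.
Local Notation P := 'rV[R]_2.
Variable h : riemannian_metric M.

(** The Cauchy-Schwarz inequality between a metric and its inverse: after multiplication by the
    determinant the defect is a perfect square. *)
Lemma derive_le_grad phi (f : P -> R^o) y (v : P) (S B : R) : atlas phi -> cran phi y ->
  Ck 1 (cran phi) f -> 0 <= S -> 0 <= B -> grad_dot h phi f f y <= S ^+ 2 ->
  (v *m gmat h phi y *m v^T) 0 0 <= B -> `|'D_v f y| <= S * Num.sqrt B.
Proof.
move=> aphi ry Cf S0 B0 gS gB.
have gy := gmat_sym h aphi; have gp := gmat_pos h aphi.
have d0 := detg_gt0 gy gp ry; have dE := detE gy ry.
rewrite (derive_partial v (@cran_open _ _ phi) ry Cf).
rewrite -ler_sqr ?nnegrE ?mulr_ge0 ?sqrtr_ge0// real_normK ?num_real// exprMn sqr_sqrtr//.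
apply: le_trans (ler_pM _ _ gS gB).
- rewrite grad_dotE !sum2 (ginv10 gy gp ry) (ginv00 gy gp ry) (ginv11 gy gp ry) (ginv01 gy gp ry).
  rewrite quadE (g10 gy ry).
  move: d0 dE; move: (\det _) (gmat h phi y 0 0) (gmat h phi y 0 1) (gmat h phi y 1 1).
  move: (partial 0 f y) (partial 1 f y) (v 0 0) (v 0 1) => f0 f1 v0 v1 d g00 g01 g11 d0 dE.
  rewrite -(ler_pM2l d0) -subr_ge0.
  have -> : d * ((d^-1 * g11 * f0 * f0 + d^-1 * - g01 * f0 * f1
     + (d^-1 * - g01 * f1 * f0 + d^-1 * g00 * f1 * f1))
     * (v0 * g00 * v0 + v0 * g01 * v1 + v1 * g01 * v0 + v1 * g11 * v1))
     - d * (v0 * f0 + v1 * f1) ^+ 2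
     = (f0 * (g01 * v0 + g11 * v1) - f1 * (g00 * v0 + g01 * v1)) ^+ 2.
    rewrite (_ : d * (_ * _) = (g11 * f0 * f0 - g01 * f0 * f1 + (- g01 * f1 * f0 + g00 * f1 * f1))
     * (v0 * g00 * v0 + v0 * g01 * v1 + v1 * g01 * v0 + v1 * g11 * v1)).
      by rewrite dE; ring.
    by field; rewrite gt_eqF.
  exact: sqr_ge0.
- rewrite grad_dotE; apply: (@grad2_ge0 R (fun i j => ginv (gmat h phi) i j y) (fun i => partial i f y)).
  + exact: (ginv10 gy gp ry).
  + exact: (ginv00_gt0 gy gp ry).
  + exact: (ginv_det_gt0 gy gp ry).
- have [->|v0] := eqVneq v 0; first by rewrite mul0mx mul0mx mxE.
  exact/ltW/gp.
Qed.

(** Riemannian distance at most [K], expressed by duality with functions of bounded gradient, so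
    that no curves or lengths are involved. *)
Definition grad_dist (K : R) (x y : M) : Prop := forall u S, C1 u -> 0 <= S ->
  (forall z, gradsq h u z <= S ^+ 2) -> `|u y - u x| <= K * S.

(** The coordinate segment from [x] to a nearby [y] stays in a ball where the metric coefficients
    are bounded, and the mean value theorem applies along it. *)
Lemma grad_dist_local x : exists2 K, 0 <= K & \forall y \near x, grad_dist K x y.
Proof.
pose phi := chart_at x.
have aphi : atlas phi := chart_atP x; have dx : cdom phi x := cdom_chart_at x.
have ry := cran_cmap dx; set y0 := cmap phi x in ry.
pose b i j : R := `|gmat h phi y0 i j| + 1.
have nb i j : nbhs y0 [set y | `|gmat h phi y i j| <= b i j].
  have := sm_cont (gmat_smooth h aphi i j) ry => /cvgrPdist_le /(_ 1 ltr01).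
  apply: filterS => y /= yb; rewrite /b addrC -lerBlDr.
  by apply: le_trans yb; rewrite distrC; exact: lerB_dist.
have : nbhs y0 (cran phi) by apply: open_nbhs_nbhs; split=> //; exact: cran_open.
move=> /filterI /(_ (filterI (filterI (nb 0 0) (nb 0 1)) (filterI (nb 1 0) (nb 1 1)))).
move=> H; have {H} [r /= r0 rH] := (nbhs_ballP y0 _).1 H.
(* A bound for the squared metric length of [v], whose coordinates are at most [r]. *)
pose B := r ^+ 2 * (b 0 0 + b 0 1 + b 1 0 + b 1 1).
have b0 i j : 0 <= b i j by rewrite addr_ge0.
have B0 : 0 <= B by rewrite mulr_ge0 ?sqr_ge0// !addr_ge0.
exists (Num.sqrt B); first exact: sqrtr_ge0.
have nx : nbhs x (cmap phi @^-1` ball y0 r) by apply: cmap_continuous => //; exact: nbhsx_ballx.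
have nd : nbhs x (cdom phi) by apply: open_nbhs_nbhs; split=> //; exact: cdom_open.
apply: (filterS _ (filterI nx nd)) => y [/= yr dy] u S Cu S0 gS.
pose f : P -> R^o := u \o cinv phi; pose v := cmap phi y - y0.
have vr : `|v| < r by move: yr; rewrite -ball_normE /ball_ /= distrC.
have inb (s : R) : `|s| <= 1 -> ball y0 r (s *: v + y0).
  move=> s1; rewrite -ball_normE /ball_ /= distrC addrK normrZ.
  by apply: le_lt_trans vr; rewrite ler_piMl.
have [s|s s1] := @mvt_line R P f y0 v 1.
  rewrite normr1 => /inb /rH [rs _]; have [_ /(_ v)[d _]] := Cu phi aphi; exact: d.
rewrite scale1r mul1r subrK /f /= !cmapK// => ->.
rewrite mulrC; rewrite normr1 in s1.
have [rs [[n00 n01] [n10 n11]]] := rH _ (inb s s1).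
apply: (derive_le_grad aphi rs (Cu phi aphi) S0 B0).
  by rewrite -[X in grad_dot _ _ _ _ X](cinvK rs) -(gradsqE h aphi (cdom_cinv rs) Cu).
have v0 i : `|v 0 i| <= r by exact: le_trans (coord_le _ _) (ltW vr).
have term i j : `|gmat h phi (s *: v + y0) i j| <= b i j ->
    v 0 i * gmat h phi (s *: v + y0) i j * v 0 j <= r ^+ 2 * b i j.
  move=> gb; apply: le_trans (ler_norm _) _; rewrite !normrM mulrAC expr2.
  by rewrite !ler_pM// mulr_ge0.
have -> : B = r ^+ 2 * b 0 0 + r ^+ 2 * b 0 1 + r ^+ 2 * b 1 0 + r ^+ 2 * b 1 1.
  by rewrite /B; move: (b 0 0) (b 0 1) (b 1 0) (b 1 1) => b1 b2 b3 b4; ring.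
by rewrite quadE; apply: lerD (term 1 1 n11); apply: lerD (term 1 0 n10);
  apply: lerD (term 0 0 n00) (term 0 1 n01).
Qed.

Lemma grad_dist_sym K x y : grad_dist K x y -> grad_dist K y x.
Proof. by move=> H u S Cu S0 gS; rewrite distrC; exact: H. Qed.

Lemma grad_dist_trans K L x y z : grad_dist K x y -> grad_dist L y z ->
  grad_dist (K + L) x z.
Proof.
move=> H1 H2 u S Cu S0 gS; rewrite -(subrKA (u y)) addrC mulrDl.
by apply: le_trans (ler_normD _ _) _; rewrite lerD//; [exact: H1|exact: H2].
Qed.

(** The points at finite distance from [x0] form an open set with open complement, hence the whole
    surface by connectedness; compactness then makes the constant uniform. *)
Lemma osc_gradient : compact [set: M] -> connected [set: M] ->
  exists2 D, 0 < D & forall x y, grad_dist D x y.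
Proof.
move=> cM kM; pose x0 : M := point.
pose A : set M := [set x | exists K, grad_dist K x0 x].
have AT : A = [set: M].
  apply: kM.
  - by exists x0; exists 0 => u S _ _ _; rewrite subrr normr0 mul0r.
  - exists A; last by rewrite setTI.
    rewrite openE => x [K xK]; have [L _ nL] := grad_dist_local x.
    by apply: (filterS _ nL) => y yL; exists (K + L); exact: grad_dist_trans yL.
  - exists A; last by rewrite setTI.
    rewrite -openC openE => x nAx; have [L _ nL] := grad_dist_local x.
    apply: (filterS _ nL) => y yL [K yK]; apply: nAx; exists (K + L).
    by apply: grad_dist_trans yK _; exact: grad_dist_sym.
have [D Dx] : exists D, forall x, grad_dist D x0 x.
  (* Near each point one large enough constant serves all neighbours, which is the local form of
     uniformity that compactness makes global. *)
  have := (compact_near_coveringP [set: M]).1 cM R +oo%R (fun K x => grad_dist K x0 x) _.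
  case=> [x _|D [Dr DP]].
    have [K xK] : A x by rewrite AT.
    have [L _ nL] := grad_dist_local x.
    exists ([set y | grad_dist L x y], [set D | K + L <= D]) => /=.
      split; first exact: nL.
      by exists (K + L); split=> [|z /ltW]; [exact: num_real|].
    move=> [y D] [/= yL KD] u S Cu S0 gS; apply: le_trans (grad_dist_trans xK yL Cu S0 gS) _.
    exact: ler_wpM2r.
  by exists (D + 1) => x; apply: DP => //; rewrite ltrDl.
exists (`|D| + `|D| + 1); first by rewrite ltr_wpDl// addr_ge0.
move=> x y u S Cu S0 gS.
apply: le_trans (grad_dist_trans (grad_dist_sym (Dx x)) (Dx y) Cu S0 gS) _.
by rewrite ler_wpM2r//; have := ler_norm D; move: `|D| => d; lra.
Qed.

End Oscillation.

(** * The area measure *)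

Section Transfer.
Context d1 d2 (X : measurableType d1) (Y : measurableType d2) (R : realType).
Local Open Scope ereal_scope.
Variables (mu : {measure set Y -> \bar R}) (lam : {measure set X -> \bar R}).
Variables (D : set Y) (E : set X) (mD : measurable D) (mE : measurable E).
Variables (psi : X -> Y) (mpsi : measurable_fun E psi) (psiD : forall x, E x -> D (psi x)).
Variables (w : X -> R) (mw : measurable_fun E w) (w0 : forall x, E x -> (0 <= w x)%R).
Hypothesis mu_w : forall A, measurable A -> A `<=` D ->
  mu A = \int[lam]_(x in E `&` psi @^-1` A) (w x)%:E.

Import HBNNSimple.

Let transfer_nnsfun (f : {nnsfun Y >-> R}) :
  \int[mu]_(y in D) (f y)%:E = \int[lam]_(x in E) ((f (psi x))%:E * (w x)%:E).
Proof.
have mpre r : measurable (E `&` psi @^-1` (f @^-1` [set r])).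
  by apply: mpsi => //; exact: measurable_sfunP.
have m1 r : measurable_fun setT (\1_(f @^-1` [set r]) : Y -> R).
  by apply: measurable_indic; exact: measurable_sfunP.
transitivity (\sum_(r \in range f) (r%:E * mu (D `&` f @^-1` [set r]))).
  under eq_integral do rewrite fimfunE -fsumEFin//.
  rewrite ge0_integral_fsum//; last 2 first.
  - by move=> r; apply/measurable_EFinP; apply: measurable_funTS; exact: measurable_funM.
  - by move=> r y _; rewrite EFinM nnfun_muleindic_ge0.
  apply: eq_fsbigr => r _; rewrite integralZl_indic_nnsfun// integral_indic//.
  by rewrite setIC.
transitivity (\sum_(r \in range f)
  \int[lam]_(x in E) (r%:E * ((\1_(f @^-1` [set r]) (psi x))%:E * (w x)%:E))).
  apply: eq_fsbigr => r /[!inE] rf.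
  have r0 : (0 <= r)%R by case: rf => y _ <-.
  rewrite ge0_integralZl//; last 2 first.
  - apply: emeasurable_funM; last exact/measurable_EFinP.
    apply/measurable_EFinP.
    exact: (measurableT_comp (m1 r) mpsi).
  - by move=> x Ex; rewrite mule_ge0 ?lee_fin ?w0.
  congr (_ * _); rewrite mu_w; last 2 first.
  - by apply: measurableI => //; exact: measurable_sfunP.
  - by move=> y [].
  have -> : E `&` psi @^-1` (D `&` f @^-1` [set r]) = E `&` psi @^-1` (f @^-1` [set r]).
    apply/seteqP; split=> x [Ex]; first by move=> [_ ?]; split.
    by move=> ?; split=> //; split => //; exact: psiD.
  rewrite integral_mkcondr; apply: eq_integral => x _.
  rewrite patchE indicE; have [xr|xr] := boolP (x \in psi @^-1` (f @^-1` [set r])).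
    by rewrite (mem_set (set_mem xr : (f @^-1` [set r]) (psi x))) mul1e.
  by rewrite memNset ?mul0e// => xr'; move/negP: xr; apply; exact: mem_set.
rewrite -ge0_integral_fsum//.
- apply: eq_integral => x Ex; rewrite [in RHS]fimfunE -fsumEFin// ge0_mule_fsuml; last first.
    by move=> r; rewrite EFinM nnfun_muleindic_ge0.
  by apply: eq_fsbigr => r _; rewrite EFinM muleA.
- move=> r; apply: emeasurable_funM => //; apply: emeasurable_funM; last exact/measurable_EFinP.
  apply/measurable_EFinP.
  exact: (measurableT_comp (m1 r) mpsi).
- by move=> r x Ex; rewrite muleA; apply: mule_ge0;
  [rewrite -EFinM nnfun_muleindic_ge0|rewrite lee_fin w0].
Qed.

(** [is_area_measure] prescribes only the measure of sets; simple functions and monotone convergence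
    carry the formula over to integrals. *)
Lemma ge0_integral_transfer (f : Y -> \bar R) : measurable_fun D f ->
  (forall y, D y -> 0 <= f y) ->
  \int[mu]_(y in D) f y = \int[lam]_(x in E) (f (psi x) * (w x)%:E).
Proof.
move=> mf f0; pose f_ := nnsfun_approx mD mf.
transitivity (limn (fun n => \int[mu]_(y in D) (f_ n y)%:E)).
  rewrite -monotone_convergence//=.
  - apply: eq_integral => y /[!inE] yD; apply/esym/cvg_lim => //=.
    exact: cvg_nnsfun_approx.
  - by move=> n; apply/measurable_EFinP/measurable_funTS.
  - by move=> n y _; rewrite lee_fin.
  - by move=> y _ a b ab; rewrite lee_fin//; exact/lefP/nd_nnsfun_approx.
rewrite [X in limn X](_ : _ = fun n => \int[lam]_(x in E) ((f_ n (psi x))%:E * (w x)%:E)); last first.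
  by apply/funext => n; exact: transfer_nnsfun.
rewrite -monotone_convergence//=.
- apply: eq_integral => x /[!inE] xE; apply/cvg_lim => //=.
  by apply: cvgeZr => //; apply: cvg_nnsfun_approx => //; exact: psiD.
- move=> n; apply: emeasurable_funM; last exact/measurable_EFinP.
    apply/measurable_EFinP.
  exact: (measurableT_comp (measurable_funP (f_ n)) mpsi).
- by move=> n x Ex; rewrite mule_ge0 ?lee_fin ?w0.
- by move=> x Ex a b ab; rewrite lee_wpmul2r// ?lee_fin ?w0//; exact/lefP/nd_nnsfun_approx.
Qed.

End Transfer.

Section SignedTransfer.
Context d1 d2 (X : measurableType d1) (Y : measurableType d2) (R : realType).
Variables (mu : {measure set Y -> \bar R}) (lam : {measure set X -> \bar R}).
Variables (D : set Y) (E : set X) (mD : measurable D) (mE : measurable E).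
Variables (psi : X -> Y) (mpsi : measurable_fun E psi) (psiD : forall x, E x -> D (psi x)).
Variables (w : X -> R) (mw : measurable_fun E w) (w0 : forall x, E x -> 0 <= w x).
Hypothesis mu_w : forall A, measurable A -> A `<=` D ->
  mu A = (\int[lam]_(x in E `&` psi @^-1` A) (w x)%:E)%E.

(** Positive and negative parts are transferred separately, as multiplication by a nonnegative
    weight commutes with taking them. *)
Lemma integral_transfer (f : Y -> R) : measurable_fun D f ->
  (\int[mu]_(y in D) (f y)%:E = \int[lam]_(x in E) (f (psi x) * w x)%:E)%E.
Proof.
move=> mf; have mEf : measurable_fun D (EFin \o f) by exact/measurable_EFinP.
have tr := ge0_integral_transfer mD mE mpsi psiD mw w0 mu_w.
rewrite [LHS]integralE [RHS]integralE; congr (_ - _)%E.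
- rewrite tr; last 2 first.
  + exact: measurable_funepos.
  + by move=> y _; exact: funepos_ge0.
  apply: eq_integral => x /[!inE] Ex; rewrite !funeposE -!EFin_max -EFinM; congr EFin.
  by rewrite maxr_pMl ?w0// mul0r.
- rewrite tr; last 2 first.
  + exact: measurable_funeneg.
  + by move=> y _; exact: funeneg_ge0.
  apply: eq_integral => x /[!inE] Ex; rewrite !funenegE -!EFinN -!EFin_max -EFinM; congr EFin.
  by rewrite maxr_pMl ?w0// mul0r mulNr.
Qed.

End SignedTransfer.

(** * Measurability of open sets and continuous maps on the plane and the surface *)

Section BorelMeasurability.
Context {R : realType}.
Local Notation P := 'rV[R]_2.

(** An open set of the plane is the union of the countably many squares with rational centre and
    radius that it contains, and squares are measurable rectangles. *)
Lemma open_measurable_prod (O : set (R * R)) : open O -> measurable O.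
Proof.
move=> oO.
pose B (q : rat * rat * rat) : set (R * R) :=
  ball (ratr q.1.1 : R) (ratr q.2 : R) `*` ball (ratr q.1.2 : R) (ratr q.2 : R).
pose C q := if pselect (B q `<=` O) then B q else set0.
have -> : O = \bigcup_q C q.
  apply/seteqP; split=> [[x y] Oxy|z [q _]]; last first.
    by rewrite /C; case: pselect => // BO /BO.
  have [e /= e0 eO] : nbhs_ball (x, y) O.
    by apply/(nbhs_ballP (x, y)); exact: open_nbhs_nbhs.
  have e2 : 0 < e / 2 by rewrite divr_gt0.
  have [r rI] := rat_in_itvoo e2.
  have [r0 re] : 0 < ratr r :> R /\ ratr r < e / 2.
    by move: rI; rewrite in_itv => /andP[].
  have near_rat (a : R) : exists q : rat, `|a - ratr q| < ratr r.
    have ab : a < a + ratr r by rewrite ltrDl.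
    have [q qI] := rat_in_itvoo ab; exists q.
    have [aq qa] : a < ratr q /\ ratr q < a + ratr r by move: qI; rewrite in_itv => /andP[].
    by rewrite distrC gtr0_norm ?subr_gt0// ltrBlDl.
  have [a xa] := near_rat x; have [b yb] := near_rat y.
  exists (a, b, r) => //; rewrite /C; case: pselect => [BO|BO].
    by split; rewrite /= -ball_normE /ball_ /= distrC.
  exfalso; apply: BO => -[u v] [/=]; rewrite -!ball_normE /ball_ /= => ua vb.
  apply: eO; split; rewrite -ball_normE /ball_ /=.
    by have := ler_distD (ratr a) x u; lra.
  by have := ler_distD (ratr b) y v; lra.
apply: countable_bigcupT_measurable => [|q]; first exact: countableP.
rewrite /C; case: pselect => [BO|nBO]; last exact: measurable0.
by apply: measurableX; apply: open_measurable; exact: ball_open.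
Qed.

Lemma measurable_fun_open d (X : measurableType d) (D : set X) (f : X -> R) :
  (forall O : set R, open O -> measurable (D `&` f @^-1` O)) -> measurable_fun D f.
Proof.
move=> H; apply: (measurability _ (RGenOpens.measurableE R)) => _ [_ [a [b ->] <-]].
by apply: H; exact: interval_open.
Qed.

Lemma row2E (z : R * R) : row2 z = z.1 *: e_ 0 + z.2 *: e_ 1.
Proof. by rewrite [LHS]rowE2 !mxE. Qed.

Lemma row2_continuous : continuous (@row2 R).
Proof.
have -> : @row2 R = (fun z => z.1 *: e_ 0 + z.2 *: e_ 1) by apply/funext => z; exact: row2E.
move=> z; apply: cvgD; apply: (@cvgZr_tmp R P); [exact: cvg_fst|exact: cvg_snd].
Qed.

Lemma open_row2 (O : set P) : open O -> open (@row2 R @^-1` O).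
Proof. by move=> oO; apply: open_comp => // z _; exact: row2_continuous. Qed.

Variable M : smooth_surface R.
Local Notation T := (g_sigma_algebraType (@open M)).

Lemma measurable_open_surface (O : set M) : open O -> measurable (O : set T).
Proof. by move=> oO; exact: sub_sigma_algebra. Qed.

Lemma measurable_continuous (u : M -> R) (D : set T) : measurable D ->
  continuous u -> measurable_fun D (u : T -> R).
Proof.
move=> mD cu; apply: measurable_fun_open => O oO; apply: measurableI => //.
by apply: measurable_open_surface; apply: open_comp => // x _; exact: cu.
Qed.

Lemma measurable_cinv (phi : chart R M) :
  measurable_fun (@row2 R @^-1` cran phi) ((cinv phi \o @row2 R) : R * R -> T).
Proof.
apply: (@measurability _ _ _ T _ _ (@open M)); first by [].
move=> _ [B oB <-]; apply: open_measurable_prod; rewrite openE => z [/= rz Bz].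
have n1 : nbhs z (@row2 R @^-1` cran phi).
  by apply: open_nbhs_nbhs; split=> //; apply: open_row2; exact: cran_open.
have n2 : nbhs z ((cinv phi \o @row2 R) @^-1` B).
  have c : {for z, continuous (cinv phi \o @row2 R)}.
    by apply: continuous_comp; [exact: row2_continuous|exact: cinv_continuous].
  by apply: c; exact: open_nbhs_nbhs.
exact: filterI.
Qed.

End BorelMeasurability.

Lemma finite_cover (T : ptopologicalType) (N : T -> set T) : compact [set: T] ->
  (forall x, nbhs x (N x)) -> exists s : seq T, forall y, exists2 x, x \in s & N x y.
Proof.
move=> cT0 nN; have cT : cover_compact [set: T] by rewrite -compact_cover.
have [|y _|s _ sT] := cT T [set: T] (fun x => interior (N x)).
- by move=> x _; exact: open_interior.
- by exists y => //; exact: nN.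
exists (finmap.enum_fset s) => y; have [x /= xs xy] := sT y I.
by exists x => //; exact: interior_subset.
Qed.

Section AreaMeasure.
Context {R : realType} {M : smooth_surface R}.
Local Notation P := 'rV[R]_2.
Local Notation T := (g_sigma_algebraType (@open M)).
Local Notation lam := ((@lebesgue_measure R) \x (@lebesgue_measure R))%E.
Local Notation ran phi := (@row2 R @^-1` cran phi).
Implicit Types phi : chart R M.

Lemma measurable_on_open (E : set (R * R)) (w : R * R -> R) : open E ->
  (forall z, E z -> {for z, continuous w}) -> measurable_fun E w.
Proof.
move=> oE cw; apply: measurable_fun_open => B oB.
apply: open_measurable_prod; rewrite openE => z [Ez Bz].
by apply: filterI; [exact: open_nbhs_nbhs|apply: cw => //; exact: open_nbhs_nbhs].
Qed.

Lemma integral_cst_square (a b r k : R) : 0 <= r ->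
  (\int[lam]_(z in ball a r `*` ball b r) (cst k%:E) z = (k * (r *+ 2 * (r *+ 2)))%:E)%E.
Proof.
move=> r0; have mb c : measurable (ball (c : R) r) by apply: open_measurable; exact: ball_open.
rewrite integral_cst; last by apply: measurableX; exact: mb.
rewrite EFinM EFinM -{1}(lebesgue_measure_ball a r0) -(lebesgue_measure_ball b r0).
by congr (_ * _)%E; apply: product_measure1E; exact: mb.
Qed.

Lemma open_ran phi : open (ran phi).
Proof. by apply: open_row2; exact: cran_open. Qed.

Lemma measurable_cdom phi : measurable (cdom phi : set T).
Proof. by apply: measurable_open_surface; exact: cdom_open. Qed.

Variable h : riemannian_metric M.

Definition area_density phi (z : R * R) : R := Num.sqrt (\det (gmat h phi (row2 z))).

Lemma area_density_continuous phi z : atlas phi -> ran phi z ->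
  {for z, continuous (area_density phi)}.
Proof.
move=> aphi rz; have oU := @cran_open _ _ phi.
have S : smooth (cran phi) (fun y => Num.sqrt (\det (gmat h phi y)) : R^o).
  apply: (sm_sqrt oU) => [y ry|]; first exact: (detg_gt0 (gmat_sym h aphi) (gmat_pos h aphi)).
  exact: (smooth_detg oU (gmat_smooth h aphi) (gmat_sym h aphi)).
have c := sm_cont S rz.
apply: (@continuous_comp _ _ _ (@row2 R) (fun y => Num.sqrt (\det (gmat h phi y)))).
  exact: row2_continuous.
exact: c.
Qed.

Variables (mu : {measure set T -> \bar R}) (mu_area : is_area_measure h mu).

Lemma area_chart phi A : atlas phi -> measurable (A : set T) -> A `<=` cdom phi ->
  (mu A = \int[lam]_(z in ran phi `&` (cinv phi \o @row2 R) @^-1` A) (area_density phi z)%:E)%E.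
Proof.
move=> aphi mA AD; rewrite (mu_area aphi mA AD); congr (integral _ _ _).
apply/seteqP; split=> z /=.
  by case=> x Ax <-; rewrite cmapK; [split=> //; apply: cran_cmap|]; exact: AD.
by case=> rz Az; exists (cinv phi (row2 z)) => //; exact: cinvK.
Qed.

Lemma integral_chart phi (f : M -> R) : atlas phi ->
  measurable_fun (cdom phi : set T) (f : T -> R) ->
  (\int[mu]_(x in (cdom phi : set T)) (f x)%:E =
   \int[lam]_(z in ran phi) (f (cinv phi (row2 z)) * area_density phi z)%:E)%E.
Proof.
move=> aphi mf.
apply: (@integral_transfer _ _ _ T R mu lam (cdom phi) (ran phi) _ _ (cinv phi \o @row2 R) _ _
  (area_density phi)) => //.
- exact: measurable_cdom.
- by apply: open_measurable_prod; exact: open_ran.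
- exact: measurable_cinv.
- by move=> z rz; exact: cdom_cinv.
- apply: measurable_on_open; first exact: open_ran.
  by move=> z rz; exact: area_density_continuous.
- by move=> z _; exact: sqrtr_ge0.
- by move=> A mA AD; exact: area_chart.
Qed.

(** Near a point the density is at most its value there plus one, and a small coordinate square has
    finite Lebesgue measure. *)
Lemma area_local_finite x : exists N : set M, [/\ open N, N x & (mu (N : set T) < +oo)%E].
Proof.
pose phi := chart_at x.
have aphi : atlas phi := chart_atP x; have dx : cdom phi x := cdom_chart_at x.
have ry := cran_cmap dx; set y0 := cmap phi x in ry.
pose z0 : R * R := (y0 0 0, y0 0 1).
have z0E : row2 z0 = y0 by rewrite row2E [RHS]rowE2.
have rz : ran phi z0 by rewrite /= z0E.
have /cvgrPdist_le /(_ 1 ltr01) n1 := area_density_continuous aphi rz.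
have n2 : nbhs z0 (ran phi) by apply: open_nbhs_nbhs; split=> //; exact: open_ran.
have [r /= r0 rH] := (nbhs_ballP z0 _).1 (filterI n1 n2).
pose N := cdom phi `&` cmap phi @^-1` ball y0 r.
have oN : open N.
  rewrite openE => y [dy ny]; apply: filterI.
    by apply: open_nbhs_nbhs; split=> //; exact: cdom_open.
  by apply: cmap_continuous => //; apply: open_nbhs_nbhs; split=> //; exact: ball_open.
exists N; split=> //; first by split=> //; exact: ballxx.
rewrite (area_chart aphi) //; last 2 first.
- exact: measurable_open_surface.
- by move=> y [].
pose a0 := y0 0 0; pose a1 := y0 0 1; pose S := ball a0 r `*` ball a1 r.
have mS : measurable S by apply: measurableX; apply: open_measurable; exact: ball_open.
pose K := area_density phi z0 + 1.
have K0 : 0 <= K by rewrite addr_ge0// sqrtr_ge0.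
have sub : ran phi `&` (cinv phi \o @row2 R) @^-1` N `<=` S.
  move=> z [rz' [/= _]]; rewrite cinvK// -ball_normE /ball_ /= => b.
  split; rewrite -ball_normE /ball_ /=.
    by have := coord_le (y0 - row2 z) 0; rewrite !mxE /= => H; exact: le_lt_trans b.
  by have := coord_le (y0 - row2 z) 1; rewrite !mxE /= => H; exact: le_lt_trans b.
have mE : measurable (ran phi `&` (cinv phi \o @row2 R) @^-1` N).
  have mran := open_measurable_prod (@open_ran phi).
  exact: (@measurable_cinv R M phi mran _ (measurable_open_surface oN)).
apply: (@le_lt_trans _ _ (\int[lam]_(z in S) K%:E)%E).
  apply: (@le_trans _ _ (\int[lam]_(z in ran phi `&` (cinv phi \o @row2 R) @^-1` N) K%:E)%E).
    apply: ge0_le_integral => //.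
    - by move=> z _; rewrite lee_fin sqrtr_ge0.
    - apply/measurable_EFinP; apply: (measurable_funS (open_measurable_prod (@open_ran phi))).
        by move=> z [].
      apply: measurable_on_open; first exact: open_ran.
      by move=> z rz'; exact: area_density_continuous.
    - move=> z /sub [b1 b2]; rewrite lee_fin.
      have [/= H _] := rH z (conj b1 b2); rewrite /K.
      by move: H; rewrite ler_norml => /andP[H _]; lra.
  by apply: ge0_subset_integral => // z _; rewrite lee_fin.
by rewrite integral_cst_square ?ltW// ltry.
Qed.

(** Areas are extended reals, so finiteness has to be deduced; it follows from a finite subcover by
    sets of finite area. *)
Lemma area_finite : compact [set: M] -> (mu [set: T] < +oo)%E.
Proof.
move=> cM.
pose N x := sval (cid (area_local_finite x)).
have NP x : [/\ open (N x), N x x & (mu (N x : set T) < +oo)%E] := svalP (cid (area_local_finite x)).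
have [|s sT] := finite_cover (N := N) cM.
  by move=> x; have [oN Nx _] := NP x; exact: open_nbhs_nbhs.
have mN (l : seq M) : measurable (\big[setU/set0]_(x <- l) N x : set T).
  apply: measurable_open_surface; apply: big_ind; [exact: open0|exact: openU|].
  by move=> y _; have [] := NP y.
have H : forall s : seq M, (mu (\big[setU/set0]_(x <- s) N x : set T) < +oo)%E.
  elim=> [|x l IH]; first by rewrite big_nil measure0.
  have mNx : measurable (N x : set T) by apply: measurable_open_surface; have [] := NP x.
  rewrite big_cons; apply: (le_lt_trans (@measureU2 _ T _ mu (N x) _ mNx (mN l))).
  by apply: lte_add_pinfty => //; have [] := NP x.
apply: le_lt_trans (H s); apply: le_measure; [exact: mem_set|exact: mem_set|].
by move=> y _; have [x xs xy] := sT y; rewrite -bigcup_seq; exists x.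
Qed.

End AreaMeasure.

(** * The area of a conformal metric as an integral for the area of the background metric *)

Section ConformalArea.
Context {R : realType} {M : smooth_surface R}.
Local Notation T := (g_sigma_algebraType (@open M)).
Local Notation lam := ((@lebesgue_measure R) \x (@lebesgue_measure R))%E.
Local Notation ran phi := (@row2 R @^-1` cran phi).
Variables (h g : riemannian_metric M) (u : M -> R).
Hypotheses (hg : conformal u h g) (cu : continuous u).
Variables (mu nu : {measure set T -> \bar R}).
Hypotheses (mu_area : is_area_measure h mu) (nu_area : is_area_measure g nu).

Lemma area_density_conformal phi z : atlas phi -> ran phi z ->
  area_density g phi z = expR (2 * u (cinv phi (row2 z))) * area_density h phi z.
Proof.
(* In dimension two the determinant scales by e^(4u), hence its square root by e^(2u). *)
move=> aphi rz; rewrite /area_density (hg aphi rz) detZ expr2.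
by rewrite sqrtrM ?mulr_ge0 ?expR_ge0// -expr2 sqrtr_sqr ger0_norm ?expR_ge0.
Qed.

Let f (x : M) : R := expR (2 * u x).

Let cf : continuous f.
Proof.
move=> x; apply: (@continuous_comp M R R (fun x => 2 * u x) expR); last exact: continuous_expR.
by apply: cvgM; [exact: cvg_cst|exact: cu].
Qed.

Lemma area_conformal_local phi (A : set T) : atlas phi -> measurable A -> A `<=` cdom phi ->
  (nu A = \int[mu]_(x in A) (f x)%:E)%E.
Proof.
move=> aphi mA AD; rewrite (area_chart nu_area aphi mA AD).
have mran := open_measurable_prod (@open_ran _ _ phi).
have mE := @measurable_cinv R M phi mran _ mA.
symmetry; rewrite (@ge0_integral_transfer _ _ _ T R mu lam A _ mA mE (cinv phi \o @row2 R) _ _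
   (area_density h phi)).
- apply: eq_integral => z /set_mem[rz _].
  by rewrite (area_density_conformal aphi rz) -EFinM.
- by apply: (measurable_funS mran _ (@measurable_cinv R M phi)); exact: subIsetl.
- by move=> z [].
- apply: (measurable_funS mran (@subIsetl _ _ _)).
  apply: measurable_on_open; first exact: open_ran.
  by move=> z rz; exact: area_density_continuous.
- by move=> z _; exact: sqrtr_ge0.
- move=> B mB BA; rewrite (area_chart mu_area aphi mB); last by move=> z /BA/AD.
  congr (integral _ _ _); apply/seteqP; split=> z /=; last by case=> -[].
  by case=> rz Bz; split=> //; split=> //; exact: BA.
- by apply/measurable_EFinP; exact: (measurable_continuous mA cf).
- by move=> x _; rewrite lee_fin expR_ge0.
Qed.

(** Chart domains overlap, so a finite cover by them is first made disjoint; each piece then lies in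
    one chart. *)
Lemma area_conformal : compact [set: M] -> (nu [set: T] = \int[mu]_x (f x)%:E)%E.
Proof.
move=> cM; have [|s sT] := @finite_cover M (fun x => cdom (chart_at x)) cM.
  by move=> x; apply: open_nbhs_nbhs; split; [exact: cdom_open|exact: cdom_chart_at].
(* Beyond the length of [s] the default [point] contributes one more chart domain, harmless for a
   cover. *)
pose F (n : nat) : set T := cdom (chart_at (nth point s n)).
have mF n : measurable (F n) by exact: measurable_cdom.
have FT : \bigcup_n F n = [set: T].
  apply/seteqP; split=> // y _; have [x xs xy] := sT y.
  by exists (index x s) => //; rewrite /F nth_index.
pose D := seqDU F.
have mD n : measurable (D n) by exact: seqDU_measurable.
have DT : \bigcup_n D n = [set: T] by rewrite -FT /D -seqDU_bigcup_eq.
have tD : trivIset [set: nat] D by exact: trivIset_seqDU.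
rewrite -DT measure_semi_bigcup//; last by rewrite DT.
rewrite ge0_integral_bigcup//.
- apply: eq_eseriesr => n _; apply: (@area_conformal_local (chart_at (nth point s n))) => //.
    exact: chart_atP.
  by move=> x [].
- rewrite DT; apply/measurable_EFinP; exact: (measurable_continuous measurableT cf).
- by move=> x _; rewrite lee_fin expR_ge0.
Qed.

End ConformalArea.

(** * The divergence theorem *)

Section BoxDivergence.
Context {R : realType}.
Local Notation P := 'rV[R]_2.
Local Notation leb := (@lebesgue_measure R).
Local Notation lam := (leb \x leb)%E.

Section Box.
Variables (a b c d : R) (F : R * R -> R).
Let I : set R := `[a, b].
Let J : set R := `[c, d].
Let B := I `*` J.

Let mI : measurable I. Proof. exact: measurable_itv. Qed.
Let mJ : measurable J. Proof. exact: measurable_itv. Qed.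
Let mB : measurable B. Proof. exact: measurableX. Qed.

Lemma box_finite : (lam B < +oo)%E.
Proof.
have -> : (lam B = leb I * leb J)%E by exact: product_measure1E.
by rewrite !lebesgue_measure_itv /=; do 2 case: ifP => _; rewrite ?mul0e ?mule0 -?EFinB -?EFinM ?ltry.
Qed.

Variables (O : set (R * R)) (oO : open O) (BO : B `<=` O).
Hypothesis cF : forall z, O z -> {for z, continuous F}.

Lemma box_integrable : lam.-integrable B (EFin \o F).
Proof.
apply: measurable_bounded_integrable => //; first exact: box_finite.
  apply: (measurable_funS (open_measurable_prod oO) BO).
  exact: measurable_on_open.
have cB : compact B by apply: compact_setX; exact: segment_compact.
have wF : {within B, continuous F}.
  by apply: continuous_in_subspaceT => z /set_mem /BO; exact: cF.
have /(@compact_bounded R R^o)[K [_ KF]] := continuous_compact wF cB.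
by exists K; split; rewrite ?num_real // => ? ? ? ?; exact: KF.
Qed.

Let iF0 := (@integrable_mkcond _ _ R lam B (EFin \o F) mB).1 box_integrable.

Lemma box_integral12_eq0 :
  (forall x, I x -> (\int[leb]_(y in J) (F (x, y))%:E = 0)%E) ->
  (\int[lam]_(z in B) (F z)%:E = 0)%E.
Proof.
move=> H; rewrite integral_mkcond -(integral12_prod_meas1 iF0).
apply: integral0_eq => x _; rewrite /fubini_F.
have [Ix|nIx] := pselect (I x).
  rewrite -[RHS](H x Ix) [RHS]integral_mkcond; apply: eq_integral => y _.
  rewrite !patchE; have -> // : ((x, y) \in B) = (y \in J).
  by apply/idP/idP => /set_mem H'; apply: mem_set => //; case: H'.
apply: integral0_eq => y _; rewrite patchE memNset// => -[/= Ix _]; exact: nIx.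
Qed.

Lemma box_integral21_eq0 :
  (forall y, J y -> (\int[leb]_(x in I) (F (x, y))%:E = 0)%E) ->
  (\int[lam]_(z in B) (F z)%:E = 0)%E.
Proof.
move=> H; rewrite integral_mkcond -(integral21_prod_meas1 iF0).
apply: integral0_eq => y _; rewrite /fubini_G.
have [Jy|nJy] := pselect (J y).
  rewrite -[RHS](H y Jy) [RHS]integral_mkcond; apply: eq_integral => x _.
  rewrite !patchE; have -> // : ((x, y) \in B) = (x \in I).
  by apply/idP/idP => /set_mem H'; apply: mem_set => //; case: H'.
apply: integral0_eq => x _; rewrite patchE memNset// => -[/= _ Jy]; exact: nJy.
Qed.

End Box.

Lemma FTC_line (U : set P) (f : P -> R^o) (v x : P) (a b : R) : open U -> Ck 1 U f ->
  (forall s : R, s \in `[a, b] -> U (s *: v + x)) -> a < b ->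
  (\int[leb]_(s in `[a, b]) ('D_v f (s *: v + x))%:E =
    (f (b *: v + x))%:E - (f (a *: v + x))%:E)%E.
Proof.
move=> oU [cf Cf] Us ab; have [df [cdf _]] := Cf v.
pose g (s : R) : R := f (s *: v + x).
have cl : continuous (fun s : R => s *: v + x).
  by move=> s; apply: cvgD; [apply: cvgZr_tmp; exact: cvg_id|exact: cvg_cst].
have gd (s : R) : s \in `[a, b] -> is_derive s 1 g ('D_v f (s *: v + x)).
  by move=> sab; apply: is_derive_line; apply: df; exact: Us.
have cg : {within `[a, b], continuous g}.
  apply: continuous_in_subspaceT => s /[!inE] sab.
  by apply: continuous_comp; [exact: cl|exact: cf (Us _ sab)].
rewrite -/(g b) -/(g a); apply: continuous_FTC2 => //.
- apply: continuous_in_subspaceT => s /[!inE] sab.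
  apply: (@continuous_comp _ _ _ (fun s : R => s *: v + x) ('D_v f)); first exact: cl.
  exact: cdf (Us _ sab).
- split.
  + by move=> s sab; have [] := gd s (subset_itv_oo_cc sab).
  + by have /(continuous_within_itvP _ ab)[] := cg.
  + by have /(continuous_within_itvP _ ab)[] := cg.
- move=> s sab; rewrite derive1E; exact: dval (gd s (subset_itv_oo_cc sab)).
Qed.

Variables (r : R) (y0 : P) (U : set P).
Hypotheses (r0 : 0 < r) (oU : open U) (BU : forall y, `|y0 - y| <= r -> U y).

Local Notation I := (`[y0 0 0 - r, y0 0 0 + r]).
Local Notation J := (`[y0 0 1 - r, y0 0 1 + r]).
Local Notation Box := ([set` I] `*` [set` J]).

Lemma Box_ball z : Box z -> `|y0 - row2 z| <= r.
Proof.
case: z => x y [/=]; rewrite !in_itv /= => xI yJ.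
rewrite [leLHS]mx_normrE; apply: bigmax_le; first exact: ltW.
move=> [i j] _ /=; rewrite (ord1 i); move: j.
by apply: forall2; rewrite !mxE /= ler_norml; apply/andP; split; lra.
Qed.

(** Each term is integrated first along its own direction, where the fundamental theorem leaves two
    values on the edge of the box. The norm being the maximum norm, that edge is the sphere of
    radius [r]. *)
Lemma box_divergence (V0 V1 : P -> R^o) : Ck 1 U V0 -> Ck 1 U V1 ->
  (forall y, `|y0 - y| = r -> V0 y = 0) -> (forall y, `|y0 - y| = r -> V1 y = 0) ->
  (\int[lam]_(z in Box) (partial 0 V0 (row2 z) + partial 1 V1 (row2 z))%:E = 0)%E.
Proof.
move=> C0 C1 z0 z1; pose O := @row2 R @^-1` U.
have oO : open O by exact: open_row2.
have BO : Box `<=` O by move=> z /Box_ball /BU.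
have cp i (V : P -> R^o) : Ck 1 U V -> forall z, O z -> {for z, continuous (partial i V \o @row2 R)}.
  move=> CV z Oz; have [_ /(_ (e_ i))[_ [c _]]] := CV.
  by apply: continuous_comp; [exact: row2_continuous|exact: c].
have ab (t : R) : t - r < t + r by rewrite ltrD2l gtrN.
have edge (x : P) (i : 'I_2) : `|y0 - x| <= r -> `|y0 0 i - x 0 i| = r -> `|y0 - x| = r.
  move=> xr xi; apply/eqP; rewrite eq_le xr -{1}xi /=.
  by have := coord_le (y0 - x) i; rewrite !mxE.
have row1 x y : row2 (x, y) = y *: e_ 1 + x *: e_ 0 :> P by rewrite row2E addrC.
have edges (t : R) : (t - r \in `[t - r, t + r]) /\ (t + r \in `[t - r, t + r]).
  by rewrite !in_itv /= !lexx ?andbT /= ltW ?ab.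
have [a0 b0] := edges (y0 0 0); have [a1 b1] := edges (y0 0 1).
have nr (t : R) : `|t - (t - r)| = r /\ `|t - (t + r)| = r.
  by split; [rewrite opprB addrC subrK gtr0_norm|rewrite opprD addrA subrr add0r normrN gtr0_norm].
have E0 : (\int[lam]_(z in Box) (partial 0 V0 (row2 z))%:E = 0)%E.
  apply: (box_integral21_eq0 oO BO (cp 0 V0 C0)) => y yJ.
  under eq_integral => x _ do rewrite [_ (x, y)]/= row2E [(x, y).1]/= [(x, y).2]/=.
  rewrite (@FTC_line U V0 (e_ 0) (y *: e_ 1) _ _ oU C0) => [|x xI|].
  - rewrite -!(row2E (_, y)) !z0 ?subee//.
      apply: (edge _ 0); first exact: (@Box_ball (_, y)).
      by rewrite !mxE /=; have [] := nr (y0 0 0).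
    apply: (edge _ 0); first exact: (@Box_ball (_, y)).
    by rewrite !mxE /=; have [] := nr (y0 0 0).
  - by rewrite -(row2E (x, y)); apply: BO.
  - exact: ab.
have E1 : (\int[lam]_(z in Box) (partial 1 V1 (row2 z))%:E = 0)%E.
  apply: (box_integral12_eq0 oO BO (cp 1 V1 C1)) => x xI.
  under eq_integral => y _ do rewrite [_ (x, y)]/= row1.
  rewrite (@FTC_line U V1 (e_ 1) (x *: e_ 0) _ _ oU C1) => [|y yJ|].
  - rewrite -!row1 !z1 ?subee//.
      apply: (edge _ 1); first exact: (@Box_ball (x, _)).
      by rewrite !mxE /=; have [] := nr (y0 0 1).
    apply: (edge _ 1); first exact: (@Box_ball (x, _)).
    by rewrite !mxE /=; have [] := nr (y0 0 1).
  - by rewrite -row1; apply: BO.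
  - exact: ab.
have mB : measurable Box by apply: measurableX; exact: measurable_itv.
have i0 := box_integrable oO BO (cp 0 V0 C0); have i1 := box_integrable oO BO (cp 1 V1 C1).
have /(_ mB) := fun m => integralD m i0 i1.
rewrite [X in _ = (X + _)%E]E0 [X in _ = (_ + X)%E]E1 addr0 => <-.
by apply: eq_integral => z _.
Qed.

End BoxDivergence.

(** * Cutoff functions of class C^1 *)

Section Bump.
Context {R : realType}.
Local Notation P := 'rV[R]_2.

Lemma Ck_coord (V : normedModType R) k (U : set V) (T : V -> P) (i : 'I_2) : open U ->
  Ck k U T -> Ck k U (fun y => T y 0 i : R^o).
Proof.
move=> oU; have cc : continuous (fun y : P => y 0 i : R^o) by move=> y; exact: coord_continuous.
have cTi (S : V -> P) x : {for x, continuous S} -> {for x, continuous (fun y => S y 0 i : R^o)}.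
  by move=> cS; apply: (@continuous_comp _ _ _ S (fun y : P => y 0 i : R^o)); [exact: cS|exact: cc].
have dT (S : V -> P) x v : derivable S x v ->
    is_derive x v (fun y => S y 0 i : R^o) ('D_v S x 0 i).
  move=> dS.
  have H : h^-1 *: ((S (h *: v + x) 0 i : R^o) - S x 0 i) @[h --> 0^'] --> ('D_v S x 0 i : R^o).
    apply: cvg_trans (cvg_comp _ _ dS (cc ('D_v S x))); apply: near_eq_cvg.
    by apply: filterE => h /=; rewrite !mxE.
  by apply: DeriveDef; [apply/cvg_ex; eexists; exact: H|exact: cvg_lim H].
elim: k T => [|k IH] T [cT DT].
  by split=> // x Ux; apply: (cTi T) => //; exact: cT.
split=> [x Ux|v]; first by apply: (cTi T) => //; exact: cT.
have [dv Dv] := DT v; split=> [x Ux|]; first by have [] := dT _ _ _ (dv x Ux).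
apply: (Ck_ext oU _ (IH _ Dv)) => x Ux.
by rewrite (dval (dT _ _ _ (dv x Ux))).
Qed.

(** The square of the positive part is C^1, though not C^2. This regularity is enough for cutoffs
    that are differentiated only once. *)
Definition plus2 (u : R) : R := Num.max 0 u ^+ 2.

Lemma plus2_ge0 u : 0 <= plus2 u. Proof. exact: sqr_ge0. Qed.

Lemma plus2_gt0 u : 0 < u -> 0 < plus2 u.
Proof. by move=> u0; rewrite exprn_gt0// lt_max u0 orbT. Qed.

Lemma plus2_eq0 u : u <= 0 -> plus2 u = 0.
Proof. by move=> u0; rewrite /plus2 max_l// expr0n. Qed.

Lemma max0_continuous : continuous (fun u : R => Num.max 0 u).
Proof. by move=> u; apply: (@continuous_max R R (cst 0) id); [exact: cst_continuous|exact: cvg_id]. Qed.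

Lemma is_derive_plus2 (u : R) : is_derive u 1 (plus2 : R -> R^o) (2 * Num.max 0 u).
Proof.
pose a := Num.max 0 u.
(* A quadratic bound on the error of the linear approximation, uniform over the signs of [u] and
   [z + u], gives the derivative even at the corner [u = 0]. *)
have sq_le (z : R) : `|plus2 (z + u) - plus2 u - z * (2 * a)| <= z ^+ 2.
  rewrite ler_norml /plus2 /a; apply/andP.
  have [u0|u0] := leP u 0; have [zu0|zu0] := leP (z + u) 0;
    rewrite ?(max_l u0) ?(max_r (ltW u0)) ?(max_l zu0) ?(max_r (ltW zu0)); split; nra.
suff H : h^-1 *: ((plus2 (h *: 1 + u) : R^o) - plus2 u) @[h --> 0^'] --> (2 * a : R^o).
  by apply: DeriveDef; [apply/cvg_ex; eexists; exact: H|exact: cvg_lim H].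
apply/cvgrPdist_le => e e0; near=> z.
have z0 : z != 0 by near: z; exact: nbhs_dnbhs_neq.
have -> : 2 * a - z^-1 *: (plus2 (z *: 1 + u) - plus2 u : R^o) =
    - z^-1 * (plus2 (z + u) - plus2 u - z * (2 * a)) :> R.
  have fe (p q : R) : 2 * a - z^-1 * (p - q) = - z^-1 * (p - q - z * (2 * a)) by field.
  by rewrite [z *: (1 : R)]mulr1; exact: fe.
rewrite normrM normrN normfV ler_pdivrMl ?normr_gt0//.
apply: le_trans (sq_le z) _; rewrite -real_normK ?num_real// expr2 ler_wpM2l//.
by near: z; apply: nbhs_dnbhs; exact: (@nbhs0_le R R).
Unshelve. all: by end_near. Qed.

Lemma Ck_plus2 (V : normedModType R) (U : set V) (f : V -> R^o) : open U -> Ck 1 U f ->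
  Ck 1 U (fun y => plus2 (f y) : R^o).
Proof.
move=> oU Cf; apply: (Ck_comp (phi := plus2) (phi' := fun u => 2 * Num.max 0 u) oU Cf).
  by move=> x _; exact: is_derive_plus2.
move=> [|//] _ _; split=> // x Ux.
apply: (@continuous_comp _ _ _ f (fun u : R => 2 * Num.max 0 u)); first exact: (Ck_continuous Cf).
by apply: cvgM; [exact: cvg_cst|exact: max0_continuous].
Qed.

Definition bump_coord (y0 : P) (r : R) (y : P) : R :=
  plus2 (r ^+ 2 - (y 0 0 - y0 0 0) ^+ 2) * plus2 (r ^+ 2 - (y 0 1 - y0 0 1) ^+ 2).

Lemma norm_lt (y : P) r : (`|y| < r) = (`|y 0 0| < r) && (`|y 0 1| < r).
Proof.
apply/idP/andP => [yr|[yr0 yr1]]; first by split; apply: le_lt_trans yr; exact: coord_le.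
rewrite [ltLHS]mx_normrE; apply: bigmax_lt; first exact: le_lt_trans yr0.
by move=> [i j] _ /=; rewrite (ord1 i); move: j; apply: forall2.
Qed.

Lemma bump_coord_ge0 y0 r y : 0 <= bump_coord y0 r y.
Proof. by rewrite mulr_ge0// plus2_ge0. Qed.

Lemma bump_coord_gt0 y0 r y : `|y0 - y| < r -> 0 < bump_coord y0 r y.
Proof.
rewrite norm_lt !mxE distrC [X in _ && (X < _)]distrC => /andP[a b].
by rewrite mulr_gt0// plus2_gt0// subr_gt0 -[ltLHS]real_normK ?num_real// ltrXn2r.
Qed.

Lemma bump_coord_eq0 y0 r y : 0 <= r -> r <= `|y0 - y| -> bump_coord y0 r y = 0.
Proof.
move=> r0; have H (i : 'I_2) : r <= `|y 0 i - y0 0 i| -> plus2 (r ^+ 2 - (y 0 i - y0 0 i) ^+ 2) = 0.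
  move=> ri; apply: plus2_eq0; rewrite subr_le0 -[leRHS]real_normK ?num_real//.
  by rewrite lerXn2r// nnegrE.
rewrite leNgt norm_lt !mxE distrC [X in _ && (X < _)]distrC negb_and -!leNgt /bump_coord.
by case/orP => /H ->; rewrite ?mul0r ?mulr0.
Qed.

Lemma Ck_bump_coord (V : normedModType R) (U : set V) (T : V -> P) y0 r : open U -> Ck 1 U T ->
  Ck 1 U (fun y => bump_coord y0 r (T y) : R^o).
Proof.
move=> oU CT.
have H (i : 'I_2) : Ck 1 U (fun y => plus2 (r ^+ 2 - (T y 0 i - y0 0 i) ^+ 2) : R^o).
  have CC : Ck 1 U (fun z => T z 0 i - y0 0 i : R^o).
    by apply: CkD => //; [exact: Ck_coord|exact: Ck_cst].
  have CS : Ck 1 U (fun z => (T z 0 i - y0 0 i) ^+ 2 : R^o).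
    by apply: (Ck_ext oU _ (CkM oU CC CC)) => z _; rewrite -expr2.
  exact: (Ck_plus2 oU (CkD oU (Ck_cst 1 U (r ^+ 2)) (CkN oU CS))).
exact: (CkM oU (H 0) (H 1)).
Qed.

End Bump.

Section SurfaceBump.
Context {R : realType} {M : smooth_surface R}.
Local Notation P := 'rV[R]_2.
Variables (phi : chart R M) (aphi : atlas phi) (y0 : P) (r : R).
Hypotheses (r0 : 0 < r) (ballU : forall y, `|y0 - y| <= r -> cran phi y).

Definition chart_ball : set M := cinv phi @` [set y | `|y0 - y| <= r].

Lemma chart_ballP x : chart_ball x <-> cdom phi x /\ `|y0 - cmap phi x| <= r.
Proof.
split=> [[y /= yr <-]|[dx xr]]; last by exists (cmap phi x) => //; exact: cmapK.
have ry := ballU yr; rewrite cinvK//; split=> //; exact: cdom_cinv.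
Qed.

(** The chart ball is compact as a continuous image, hence closed in the Hausdorff surface. This is
    why extending the bump by zero outside the chart keeps it C^1. *)
Lemma closed_chart_ball : closed chart_ball.
Proof.
apply: compact_closed; first exact: surface_hausdorff.
apply: continuous_compact.
  apply: continuous_in_subspaceT => y /set_mem yr.
  by apply: cinv_continuous; exact: ballU.
apply: bounded_closed_compact.
  exists (`|y0| + r); split=> [|K Kr y /= yr]; first exact: num_real.
  apply: le_trans (ltW Kr); have := ler_distD y0 y 0; rewrite !subr0 [X in _ <= X]addrC => H.
  by apply: le_trans H _; rewrite lerD2l distrC.
have -> : [set y | `|y0 - y| <= r] = closed_ball y0 r by rewrite closed_ballE.
exact: closed_ball_closed.
Qed.

Definition bump (x : M) : R :=
  if pselect (cdom phi x) then bump_coord y0 r (cmap phi x) else 0.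

Lemma bump_ge0 x : 0 <= bump x.
Proof. by rewrite /bump; case: pselect => dx' //; exact: bump_coord_ge0. Qed.

Lemma bump_gt0 x : cdom phi x -> `|y0 - cmap phi x| < r -> 0 < bump x.
Proof. by move=> dx xr; rewrite /bump; case: pselect => dx' //; exact: bump_coord_gt0. Qed.

Lemma bump_eq0 x : ~ (cdom phi x /\ `|y0 - cmap phi x| < r) -> bump x = 0.
Proof.
move=> H; rewrite /bump; case: pselect => // dx; apply: bump_coord_eq0; first exact: ltW.
by rewrite leNgt; apply/negP => xr; apply: H.
Qed.

Lemma bump_C1 : C1 bump.
Proof.
move=> psi apsi; apply: Ck_local => y ry.
have [dy|ndy] := pselect (cdom phi (cinv psi y)).
  exists (overlap psi phi); split; [exact: open_overlap|by apply/overlapP|].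
  have oO := @open_overlap R M psi phi.
  apply: (Ck_ext oO _ (@Ck_bump_coord R P _ (transition psi phi) y0 r oO (atlas_smooth apsi aphi 1))).
  by move=> z /overlapP[rz dz]; rewrite /bump /=; case: pselect.
(* Outside the domain of [phi], a point has a neighbourhood that misses the closed chart ball, and
   there the bump is zero. *)
exists (cran psi `&` cinv psi @^-1` (~` chart_ball)).
have oO : open (cran psi `&` cinv psi @^-1` (~` chart_ball)).
  rewrite openE => z [rz nz]; apply: filterI.
    by apply: open_nbhs_nbhs; split=> //; exact: cran_open.
  apply: cinv_continuous => //; apply: open_nbhs_nbhs; split=> //.
  by apply: closed_openC; exact: closed_chart_ball.
split=> //; first by split=> // /chart_ballP[].
apply: (Ck_ext oO _ (Ck_cst _ _ 0)) => z [rz nz].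
by rewrite /= bump_eq0// => -[dz zr]; apply: nz; apply/chart_ballP; split=> //; exact: ltW.
Qed.

End SurfaceBump.

(** * The divergence of a gradient field cut off inside one chart *)

Section Divergence.
Context {R : realType} {M : smooth_surface R}.
Local Notation P := 'rV[R]_2.
Local Notation T := (g_sigma_algebraType (@open M)).
Local Notation lam := ((@lebesgue_measure R) \x (@lebesgue_measure R))%E.
Local Notation ran phi := (@row2 R @^-1` cran phi).
Variables (h : riemannian_metric M) (f L : M -> R).
Hypothesis Sf : forall phi, atlas phi -> smooth (cran phi) (f \o cinv phi : P -> R^o).
Hypothesis LE : forall phi x, atlas phi -> cdom phi x -> L x = laplacian h phi f x.

Lemma divergence_algebra (a : 'I_2 -> 'I_2 -> R) (dr df dW : 'I_2 -> R) (s rho : R) : s != 0 ->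
  rho * (s^-1 * \sum_(i < 2) dW i) + \sum_(i < 2) \sum_(j < 2) a i j * dr i * df j =
  s^-1 * ((rho * dW 0 + (s * \sum_(j < 2) a 0 j * df j) * dr 0)
        + (rho * dW 1 + (s * \sum_(j < 2) a 1 j * df j) * dr 1)).
Proof.
move=> s0; rewrite !sum2.
move: (a 0 0) (a 0 1) (a 1 0) (a 1 1) (dr 0) (dr 1) (df 0) (df 1) (dW 0) (dW 1).
by move=> a00 a01 a10 a11 r0 r1 f0 f1 w0 w1; field.
Qed.

(** The gradient of [f] times the area density: its coordinate divergence, divided by the density,
    is the Laplacian. *)
Definition flux phi (i : 'I_2) (y : P) : R^o :=
  Num.sqrt (\det (gmat h phi y)) *
    \sum_(j < 2) ginv (gmat h phi) i j y * partial j (f \o cinv phi) y.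

Lemma smooth_flux phi i : atlas phi -> smooth (cran phi) (flux phi i).
Proof.
move=> aphi; have oU := @cran_open _ _ phi; apply: smM => //.
  apply: sm_sqrt => // [y ry|]; first exact: (detg_gt0 (gmat_sym h aphi) (gmat_pos h aphi)).
  exact: (smooth_detg oU (gmat_smooth h aphi) (gmat_sym h aphi)).
have H j : smooth (cran phi) (fun y => ginv (gmat h phi) i j y * partial j (f \o cinv phi) y : R^o).
  apply: smM => //; last exact: (sm_derive (e_ j) (Sf aphi)).
  exact: (smooth_ginv oU (gmat_smooth h aphi) (gmat_sym h aphi) (gmat_pos h aphi)).
apply: (sm_ext oU _ (smD oU (H 0) (H 1))) => y _.
by rewrite sum2.
Qed.

Variable rho : M -> R.
Hypothesis Crho : C1 rho.

(** The divergence of [rho] times the gradient of [f], expanded so that it makes sense globally and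
    [rho] is differentiated only once. *)
Definition div_at (x : M) : R := rho x * L x + gdot h rho f x.

Lemma Ck_rho_flux phi i : atlas phi ->
  Ck 1 (cran phi) (fun y => rho (cinv phi y) * flux phi i y : R^o).
Proof.
by move=> aphi; apply: CkM; [exact: cran_open|exact: (Crho aphi)|exact: (smooth_flux i aphi 1)].
Qed.

Lemma C1_f : C1 f.
Proof. by move=> phi aphi; exact: (Sf aphi 1). Qed.

Lemma div_atE phi y : atlas phi -> cran phi y ->
  div_at (cinv phi y) = (Num.sqrt (\det (gmat h phi y)))^-1 *
    (partial 0 (fun y => rho (cinv phi y) * flux phi 0 y : R^o) y
     + partial 1 (fun y => rho (cinv phi y) * flux phi 1 y : R^o) y).
Proof.
move=> aphi ry; have s0 : Num.sqrt (\det (gmat h phi y)) != 0.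
  by rewrite gt_eqF// sqrtr_gt0; exact: (detg_gt0 (gmat_sym h aphi) (gmat_pos h aphi)).
have dE i : partial i (fun y => rho (cinv phi y) * flux phi i y : R^o) y =
    rho (cinv phi y) * partial i (flux phi i) y + flux phi i y * partial i (rho \o cinv phi) y.
  have [_ /(_ (e_ i))[d1 _]] := Crho aphi.
  have d2 := sm_der (e_ i) (smooth_flux i aphi) ry.
  have d1' := DeriveDef (d1 y ry) erefl.
  by rewrite -[LHS]/('D_(e_ i) _ y) (dval (dvM d1' d2)).
rewrite /div_at (gdotE h aphi (cdom_cinv ry) Crho C1_f) grad_dotE (LE aphi (cdom_cinv ry)).
rewrite /laplacian cinvK// (dE 0) (dE 1).
exact: (divergence_algebra (fun i j => ginv (gmat h phi) i j y)
  (fun i => partial i (rho \o cinv phi) y) (fun j => partial j (f \o cinv phi) y)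
  (fun i => partial i (flux phi i) y) _ s0).
Qed.

Lemma div_at_continuous : continuous div_at.
Proof.
move=> x; pose phi := chart_at x.
have aphi : atlas phi := chart_atP x; have dx : cdom phi x := cdom_chart_at x.
have oU := @cran_open _ _ phi.
pose q y : R^o := partial 0 (fun y => rho (cinv phi y) * flux phi 0 y : R^o) y
     + partial 1 (fun y => rho (cinv phi y) * flux phi 1 y : R^o) y.
have cp i : Ck 0 (cran phi) (partial i (fun y => rho (cinv phi y) * flux phi i y : R^o) : P -> R^o).
  by have [_ /(_ (e_ i))[]] := Ck_rho_flux i aphi.
have Sd : smooth (cran phi) (fun y => (Num.sqrt (\det (gmat h phi y)))^-1 : R^o).
  apply: smV => // [y ry|].
    by rewrite gt_eqF// sqrtr_gt0; exact: (detg_gt0 (gmat_sym h aphi) (gmat_pos h aphi)).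
  apply: sm_sqrt => // [y ry|]; first exact: (detg_gt0 (gmat_sym h aphi) (gmat_pos h aphi)).
  exact: (smooth_detg oU (gmat_smooth h aphi) (gmat_sym h aphi)).
have Cd := CkM oU (Sd 0%N) (CkD oU (cp 0) (cp 1)).
have c := Ck_continuous Cd (cran_cmap dx).
have cc := @continuous_comp _ _ _ (cmap phi) _ x (cmap_continuous dx) c.
apply: (continuous_ext (@cdom_open _ _ phi) dx _ cc) => z dz.
by rewrite -[in RHS](cmapK dz) (div_atE aphi (cran_cmap dz)).
Qed.

Variables (mu : {measure set T -> \bar R}) (mu_area : is_area_measure h mu).
Variables (phi : chart R M) (aphi : atlas phi) (y0 : P) (r : R).
Hypotheses (r0 : 0 < r) (ballU : forall y, `|y0 - y| <= r -> cran phi y).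
Hypothesis rho0 : forall x, ~ (cdom phi x /\ `|y0 - cmap phi x| < r) -> rho x = 0.
Local Notation Box := ([set` `[y0 0 0 - r, y0 0 0 + r]] `*` [set` `[y0 0 1 - r, y0 0 1 + r]]).

(** Off the closed chart ball [rho] is zero on a whole neighbourhood, so its gradient vanishes as
    well. *)
Lemma div_at_eq0 x : ~ chart_ball phi y0 r x -> div_at x = 0.
Proof.
move=> nx; have rho_out z : ~ chart_ball phi y0 r z -> rho z = 0.
  by move=> nz; apply: rho0 => -[dz zr]; apply: nz; apply/(chart_ballP ballU); split=> //; exact: ltW.
rewrite /div_at rho_out// mul0r add0r.
rewrite /gdot grad_dotE; set psi := chart_at x.
have dx : cdom psi x := cdom_chart_at x.
pose O := cran psi `&` cinv psi @^-1` (~` chart_ball phi y0 r).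
have oO : open O.
  rewrite openE => z [rz nz]; apply: filterI.
    by apply: open_nbhs_nbhs; split=> //; exact: cran_open.
  apply: cinv_continuous => //; apply: open_nbhs_nbhs; split=> //.
  by apply: closed_openC; exact: closed_chart_ball.
have Ox : O (cmap psi x) by split; [exact: cran_cmap|rewrite /= cmapK].
have z i : partial i (rho \o cinv psi) (cmap psi x) = 0.
  have := derive_ext (f := rho \o cinv psi : P -> R^o) (g := cst 0) (e_ i) oO Ox.
  by rewrite derive_cst => H; apply: H => z [_ nz]; exact: rho_out.
by apply: big1 => i _; apply: big1 => j _; rewrite z mulr0 mul0r.
Qed.

(** The integrand is supported in one chart, where the area density cancels the prefactor of
    [div_atE]; what remains is a divergence on a box with zero flux on its edge. *)
Lemma integral_div_at : (\int[mu]_x (div_at x)%:E = 0)%E.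
Proof.
transitivity (\int[mu]_(x in (cdom phi : set T)) (div_at x)%:E)%E.
  rewrite [RHS]integral_mkcond; apply: eq_integral => x _; rewrite patchE.
  case: ifPn => // /negP nx; rewrite div_at_eq0// => /(chart_ballP ballU)[dx _].
  by apply: nx; exact: mem_set.
rewrite (integral_chart mu_area aphi); last first.
  by apply: measurable_continuous; [exact: measurable_cdom|exact: div_at_continuous].
have Br z : Box z -> ran phi z by move=> /(Box_ball r0); exact: ballU.
transitivity (\int[lam]_(z in Box) (div_at (cinv phi (row2 z)) * area_density h phi z)%:E)%E.
  rewrite [LHS]integral_mkcond [RHS]integral_mkcond; apply: eq_integral => z _; rewrite !patchE.
  case: ifPn => [/set_mem rz|/negP nrz]; last first.
    by case: ifPn => // /set_mem /Br /mem_set /nrz.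
  case: ifPn => // /negP nB.
  rewrite div_at_eq0 ?mul0r// => /(chart_ballP ballU)[_]; rewrite cinvK// => zr; apply: nB.
  apply: mem_set; split; rewrite /= in_itv /= -ler_distlC.
    by have := coord_le (y0 - row2 z) 0; rewrite !mxE /= => /le_trans; exact.
  by have := coord_le (y0 - row2 z) 1; rewrite !mxE /= => /le_trans; exact.
have edge i y : `|y0 - y| = r -> rho (cinv phi y) * flux phi i y = 0.
  move=> yr; rewrite rho0 ?mul0r// => -[_]; rewrite cinvK ?yr ?ltxx//.
  by apply: ballU; rewrite yr.
rewrite -[RHS](box_divergence r0 (@cran_open _ _ phi) ballU (Ck_rho_flux 0 aphi)
  (Ck_rho_flux 1 aphi) (edge 0) (edge 1)).
apply: eq_integral => z /set_mem /Br rz; rewrite (div_atE aphi rz) /area_density.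
rewrite mulrC mulrA divff ?mul1r//.
by rewrite gt_eqF// sqrtr_gt0; exact: (detg_gt0 (gmat_sym h aphi) (gmat_pos h aphi)).
Qed.

End Divergence.

(** * Partition of unity and the integral of the Laplacian *)

Section DivergenceTheorem.
Context {R : realType} {M : smooth_surface R}.
Local Notation P := 'rV[R]_2.
Local Notation T := (g_sigma_algebraType (@open M)).
Hypothesis cM : compact [set: M].
Variables (h : riemannian_metric M) (mu : {measure set T -> \bar R}).
Hypothesis mu_area : is_area_measure h mu.

Lemma continuous_M_bounded (u : M -> R) : continuous u -> exists2 K, 0 <= K & forall x, `|u x| <= K.
Proof.
move=> cu; have wu : {within [set: M], continuous u} by exact: continuous_subspaceT.
have /(@compact_bounded R R^o)[K [_ KF]] := continuous_compact wu cM.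
exists (`|K| + 1); first by rewrite addr_ge0.
move=> x; have Kx : K < `|K| + 1 by rewrite (le_lt_trans (ler_norm _))// ltrDl.
by apply: (KF _ Kx); exists x.
Qed.

Lemma continuous_M_integrable (u : M -> R) : continuous u ->
  mu.-integrable [set: T] (EFin \o (u : T -> R)).
Proof.
move=> cu; apply: measurable_bounded_integrable => //.
- exact: (area_finite mu_area cM).
- exact: measurable_continuous.
have [K _ Ku] := continuous_M_bounded cu.
by exists K; split=> [|K' KK x _]; [exact: num_real|exact: le_trans (Ku x) (ltW KK)].
Qed.

Lemma is_derive_seq_sum (I : Type) (s : seq I) (F : I -> P -> R^o) (y v : P) :
  (forall i, derivable (F i) y v) ->
  is_derive y v (fun z => \sum_(i <- s) F i z : R^o) (\sum_(i <- s) 'D_v (F i) y).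
Proof.
move=> dF; elim: s => [|i s IH].
  rewrite big_nil; have -> : (fun z : P => \sum_(i <- [::]) F i z : R^o) = cst 0.
    by apply/funext => z; rewrite big_nil.
  exact: is_derive_cst.
rewrite big_cons; have -> : (fun z : P => \sum_(j <- i :: s) F j z : R^o) =
   (fun z => F i z + \sum_(j <- s) F j z).
  by apply/funext => z; rewrite big_cons.
by apply: dvD IH; exact: DeriveDef (dF i) erefl.
Qed.

Lemma C1_sum (I : Type) (s : seq I) (F : I -> M -> R) : (forall i, C1 (F i)) ->
  C1 (fun z => \sum_(i <- s) F i z).
Proof.
move=> CF phi aphi; have oU := @cran_open _ _ phi; elim: s => [|i s IH].
  by apply: (Ck_ext oU _ (Ck_cst 1 _ 0)) => y _; rewrite /= big_nil.
by apply: (Ck_ext oU _ (CkD oU (CF i phi aphi) IH)) => y _; rewrite /= big_cons.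
Qed.

Lemma gdot_sum_cst (I : Type) (s : seq I) (F : I -> M -> R) (c : R) (f : M -> R) x :
  (forall i, C1 (F i)) -> (forall z, \sum_(i <- s) F i z = c) ->
  \sum_(i <- s) gdot h (F i) f x = 0.
Proof.
move=> CF Fc; rewrite /gdot; set phi := chart_at x; set y := cmap phi x.
have aphi : atlas phi := chart_atP x.
have ry : cran phi y by apply: cran_cmap; exact: cdom_chart_at.
have z k : \sum_(i <- s) partial k (F i \o cinv phi) y = 0.
  have dF i : derivable (F i \o cinv phi : P -> R^o) y (e_ k).
    by have [_ /(_ (e_ k))[d _]] := CF i phi aphi; exact: d.
  rewrite -(dval (is_derive_seq_sum s dF)) /=.
  have -> : (fun z : P => \sum_(i <- s) F i (cinv phi z) : R^o) = cst c.
    by apply/funext => z; rewrite /= Fc.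
  by rewrite derive_cst.
under eq_bigr => i _ do rewrite grad_dotE.
rewrite exchange_big /= big1// => k _; rewrite exchange_big /= big1// => l _.
by rewrite -mulr_suml -mulr_sumr z mulr0 mul0r.
Qed.

Lemma chart_radius (x : M) : exists2 r : R, 0 < r &
  forall y, `|cmap (chart_at x) x - y| <= r -> cran (chart_at x) y.
Proof.
set phi := chart_at x; set y0 := cmap phi x.
have : nbhs y0 (cran phi).
  apply: open_nbhs_nbhs; split; first exact: cran_open.
  by apply: cran_cmap; exact: cdom_chart_at.
move=> /nbhs_ballP[e /= e0 eU]; exists (e / 2); first by rewrite divr_gt0.
by move=> y ye; apply: eU; rewrite -ball_normE /ball_ /=; apply: le_lt_trans ye _; lra.
Qed.

Lemma partition_of_unity : exists s : seq M, exists rho : M -> M -> R,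
  [/\ forall x, C1 (rho x), forall z, \sum_(x <- s) rho x z = 1 &
   forall x : M, exists2 r, 0 < r & (forall y, `|cmap (chart_at x) x - y| <= r -> cran (chart_at x) y) /\
     forall z, ~ (cdom (chart_at x) z /\ `|cmap (chart_at x) x - cmap (chart_at x) z| < r) ->
       rho x z = 0].
Proof.
pose r (x : M) := s2val (cid2 (chart_radius x)).
have r0 (x : M) : 0 < r x := s2valP (cid2 (chart_radius x)).
have rU (x : M) : forall y, `|cmap (chart_at x) x - y| <= r x -> cran (chart_at x) y :=
  s2valP' (cid2 (chart_radius x)).
pose b (x : M) := bump (chart_at x) (cmap (chart_at x) x) (r x).
pose N (x : M) := cdom (chart_at x) `&` cmap (chart_at x) @^-1` ball (cmap (chart_at x) x) (r x).
have [|s sM] := finite_cover (N := N) cM.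
  move=> x; have dx := cdom_chart_at x; apply: filterI.
    by apply: open_nbhs_nbhs; split=> //; exact: cdom_open.
  by apply: cmap_continuous => //; exact: nbhsx_ballx.
pose S z := \sum_(x <- s) b x z.
have S0 z : 0 < S z.
  have [x xs [dz xz]] := sM z.
  have bz : 0 < b x z by apply: bump_gt0 => //; move: xz; rewrite -ball_normE.
  apply: lt_le_trans bz _; rewrite /S (big_rem x xs) /= lerDl.
  by apply: sumr_ge0 => y _; exact: bump_ge0.
have Cb x : C1 (b x) by exact: (bump_C1 (chart_atP x) (r0 x) (rU x)).
have CS : C1 S by exact: C1_sum.
exists s, (fun x z => b x z * (S z)^-1); split.
- move=> x phi aphi; have oU := @cran_open _ _ phi.
  have S1 : forall y, cran phi y -> (S \o cinv phi) y != 0 by move=> y _; rewrite gt_eqF/=.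
  exact: (CkM oU (Cb x phi aphi) (CkV oU S1 (CS phi aphi))).
- by move=> z; rewrite -mulr_suml -/(S z) divff// gt_eqF ?S0.
- move=> x; exists (r x) => //; split; first exact: rU.
  by move=> z nz; rewrite /b bump_eq0 ?mul0r.
Qed.

Variables (f L : M -> R).
Hypothesis Sf : forall phi, atlas phi -> smooth (cran phi) (f \o cinv phi : P -> R^o).
Hypothesis LE : forall phi x, atlas phi -> cdom phi x -> L x = laplacian h phi f x.

(** The gradient terms add up to the product of the gradient of a constant with that of [f], so the
    Laplacian is a sum of divergences, each supported in one chart. Both its continuity and its
    vanishing integral follow from this. *)
Lemma laplacian_partition (s : seq M) (rho : M -> M -> R) : (forall x, C1 (rho x)) ->
  (forall z, \sum_(x <- s) rho x z = 1) -> forall z, L z = \sum_(x <- s) div_at h f L (rho x) z.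
Proof.
move=> Crho rho1 z; rewrite /div_at big_split /= (gdot_sum_cst _ _ Crho rho1) addr0.
by rewrite -mulr_suml rho1 mul1r.
Qed.

Lemma laplacian_continuous : continuous L.
Proof.
have [s [rho [Crho rho1 _]]] := partition_of_unity.
have -> : L = (fun z => \sum_(x <- s) div_at h f L (rho x) z).
  by apply/funext => z; exact: laplacian_partition.
elim: s {rho1} => [|x s IH] z.
  under eq_fun do rewrite big_nil; exact: cst_continuous.
under eq_fun do rewrite big_cons; apply: cvgD; last exact: IH.
by apply: div_at_continuous.
Qed.

Theorem integral_laplacian : (\int[mu]_x (L x)%:E = 0)%E.
Proof.
have [s [rho [Crho rho1 rhoB]]] := partition_of_unity.
transitivity (\int[mu]_x (\sum_(x0 <- s) (div_at h f L (rho x0) x)%:E))%E.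
  by apply: eq_integral => z _; rewrite sumEFin -laplacian_partition.
rewrite (@integral_sum _ T R mu [set: T]) => [|//|x]; last first.
  by apply: continuous_M_integrable; exact: div_at_continuous.
apply: big1 => x _; have [r r0 [rU rho0]] := rhoB x.
exact: (integral_div_at Sf LE (Crho x) mu_area (chart_atP x) r0 rU rho0).
Qed.

End DivergenceTheorem.

(** * Conservation of area and decay *)

Section Conservation.
Context {R : realType} {M : smooth_surface R}.
Local Notation P := 'rV[R]_2.
Local Notation V := (R^o * P)%type.
Local Notation T := (g_sigma_algebraType (@open M)).
Hypothesis cM : compact [set: M].
Variables (h : riemannian_metric M) (mu : {measure set T -> \bar R}).
Hypotheses (mu_area : is_area_measure h mu) (h_flat : flat h).
Variables (p : R -> M -> R) (sol : normalized_ricci_flow_solution h p).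

Lemma is_derive_flow (t : R) (x : M) phi : 0 < t -> atlas phi -> cdom phi x ->
  is_derive t 1 (fun s => p s x : R^o) (expR (- 2 * p t x) * laplacian h phi (p t) x).
Proof.
move=> t0 aphi dx; have d := is_derive_rep_time sol aphi t0 (cran_cmap dx).
rewrite cmapK// in d.
by rewrite (quotient_limit t0 d (sol.2 t x phi (ltW t0) aphi dx)).
Qed.

Definition flow_laplacian (t : R) (x : M) : R := laplacian h (chart_at x) (p t) x.

(** The flow itself proves independence of the chart: in any two charts the Laplacian equals e^(2p)
    times the same time derivative. Invariance of [laplacian_coord] under coordinate changes is
    never computed. *)
Lemma flow_laplacianE (t : R) (x : M) phi : 0 < t -> atlas phi -> cdom phi x ->
  flow_laplacian t x = laplacian h phi (p t) x.
Proof.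
move=> t0 aphi dx; have e0 : expR (- 2 * p t x) != 0 by rewrite gt_eqF// expR_gt0.
have E1 := dval (is_derive_flow t0 aphi dx).
have E2 := dval (is_derive_flow t0 (chart_atP x) (cdom_chart_at x)).
by apply: (mulfI e0); exact: etrans (esym E2) E1.
Qed.

(** Solving the flow equation for the Laplacian shows that it is smooth jointly in time and
    space. *)
Lemma rep_flow_laplacian (phi : chart R M) z : atlas phi -> cyl phi z ->
  expR (2 * rep p phi z) * 'D_(T_ : V) (rep p phi) z = rep flow_laplacian phi z.
Proof.
case: z => t y aphi [/= t0 ry]; have dx := cdom_cinv ry.
rewrite -(dval (is_derive_rep_time sol aphi t0 ry)) (dval (is_derive_flow t0 aphi dx)).
rewrite -(flow_laplacianE t0 aphi dx) /rep /= mulrA -expRD.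
by rewrite (_ : 2 * _ + - 2 * _ = 0) ?expR0 ?mul1r//; lra.
Qed.

(** A bound uniform in time and space, which serves to dominate the time derivative of the area
    integrand. *)
Lemma flow_laplacian_bounded (u v : R) : 0 < u ->
  exists2 K, 0 <= K & forall (t : R) (x : M), t \in `[u, v] -> `|flow_laplacian t x| <= K.
Proof.
move=> u0; pose D : set (R * M) := [set` `[u, v]] `*` [set: M].
have cD : compact D by apply: compact_setX => //; exact: segment_compact.
have wF : {within D, continuous (fun z : R * M => flow_laplacian z.1 z.2)}.
  apply: continuous_in_subspaceT => -[t x] /set_mem [/=]; rewrite in_itv /= => /andP[ut _] _.
  have t0 := lt_le_trans u0 ut; have aphi := chart_atP x.
  apply: (continuous_rep aphi (cdom_chart_at x) t0).
  have oC := @open_cyl _ _ (chart_at x).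
  apply: (sm_ext oC (fun z cz => rep_flow_laplacian aphi cz)).
  have Sp := smooth_rep sol aphi.
  apply: smM => //; last exact: sm_derive.
  by apply: sm_expR => //; apply: smM => //; exact: smC.
have /(@compact_bounded R R^o)[K [_ KF]] := continuous_compact wF cD.
exists (`|K| + 1); first by rewrite addr_ge0.
move=> t x tuv; have Kx : K < `|K| + 1 by rewrite (le_lt_trans (ler_norm _))// ltrDl.
by apply: (KF _ Kx); exists (t, x).
Qed.

Lemma is_derive_exp_flow (t : R) (x : M) : 0 < t ->
  is_derive t 1 (fun s => expR (2 * p s x) : R^o) (2 * flow_laplacian t x).
Proof.
move=> t0; have d := is_derive_flow t0 (chart_atP x) (cdom_chart_at x).
apply: (is_derive_eq (@dvE R R^o _ t 1 _ (dvM (dvC (2 : R) t 1) d))).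
have alg (a b c q : R) : b * a = 1 -> (2 * (a * c) + q * 0) * b = 2 * c.
  by move=> ba; transitivity (2 * (b * a) * c); [ring|rewrite ba mulr1].
by apply: alg; rewrite -expRD (_ : 2 * _ + - 2 * _ = 0) ?expR0//; lra.
Qed.

Lemma flow_continuous (t : R) : 0 <= t -> continuous (p t).
Proof.
move=> t0 x; have c := @continuous_flow R M h p sol (t, x) t0.
move=> A /c nA.
have nA' : nbhs (t, x) (fun z : R * M => 0 <= z.1 -> A (p z.1 z.2)) := nA.
have ct : (fun y : M => (t, y)) @ x --> (t, x).
  by apply: (@cvg_pair _ _ _ (nbhs x) (nbhs t) (nbhs x) _ _ _ (cst t) id);
    [exact: cvg_cst|exact: cvg_id].
change (nbhs x (fun y => A (p t y))).
have n2 : nbhs x (fun y => 0 <= t -> A (p t y)) := ct _ nA'.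
by apply: (filterS _ n2) => y; exact.
Qed.

Definition flow_area (t : R) : R := \int[mu]_x expR (2 * p t x).

Lemma exp_flow_continuous (t : R) : 0 <= t -> continuous (fun x => expR (2 * p t x)).
Proof.
move=> t0 x; apply: (@continuous_comp M R R (fun x => 2 * p t x) expR); last exact: continuous_expR.
by apply: cvgM; [exact: cvg_cst|exact: flow_continuous].
Qed.

Lemma is_derive_flow_area (a : R) : 0 < a -> is_derive a 1 (flow_area : R -> R^o) 0.
Proof.
(* A time interval around [a] whose closure avoids 0, so that [flow_laplacian_bounded] supplies a
   dominating constant. *)
move=> a0; pose u := a / 2; pose v := a * 2.
have u0 : 0 < u by rewrite divr_gt0.
have Ia : `]u, v[%classic a by rewrite /= in_itv /= /u /v; apply/andP; split; lra.
have pos (t : R) : `]u, v[%classic t -> 0 < t by rewrite /= in_itv /= => /andP[ut _]; exact: lt_trans ut.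
have [K K0 KF] := flow_laplacian_bounded v u0.
pose e (t : R) (x : M) : R^o := expR (2 * p t x).
have intf (t : R) : `]u, v[%classic t -> mu.-integrable [set: T] (EFin \o e t).
  by move=> /pos t0; apply: (continuous_M_integrable cM mu_area); apply: exp_flow_continuous; exact: ltW.
have der (t : R) (x : T) : `]u, v[%classic t -> [set: T] x -> derivable (e^~ x) t 1.
  by move=> /pos t0 _; have [] := is_derive_exp_flow x t0.
have p1 (t : R) (x : M) : 0 < t -> partial1of2 e t x = 2 * flow_laplacian t x.
  by move=> t0; rewrite partial1of2E; exact: dval (is_derive_exp_flow x t0).
have intG : mu.-integrable [set: T] (EFin \o cst (2 * K)).
  by apply: (continuous_M_integrable cM mu_area (u := cst (2 * K))); exact: cst_continuous.
have Gub (t : R) (x : T) : `]u, v[%classic t -> [set: T] x ->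
    `|partial1of2 e t x| <= cst (2 * K) x.
  move=> It _; rewrite p1; last exact: pos.
  by rewrite normrM ger0_norm// ler_wpM2l// KF// subset_itv_oo_cc.
have G0 (x : T) : 0 <= cst (2 * K) x by rewrite /= mulr_ge0.
apply: DeriveDef; first exact: (derivable_under_integral measurableT Ia intf der G0 intG Gub).
have := differentiation_under_integral measurableT Ia intf der G0 intG Gub.
rewrite derive1E => ->; rewrite /Rintegral.
have -> : (\int[mu]_y (partial1of2 e a y)%:E =
    \int[mu]_y (2%:E * (flow_laplacian a y)%:E))%E.
  by apply: eq_integral => y _; rewrite p1// EFinM.
have Sf phi : atlas phi -> smooth (cran phi) (p a \o cinv phi : P -> R^o).
  by move=> aphi; exact: (smooth_rep_slice sol aphi a0).
have LE phi x : atlas phi -> cdom phi x -> flow_laplacian a x = laplacian h phi (p a) x.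
  exact: flow_laplacianE.
have cL := laplacian_continuous cM Sf LE.
have lap0 := integral_laplacian cM mu_area Sf LE.
rewrite integralZl//; last exact: (continuous_M_integrable cM mu_area cL).
by rewrite [X in (_ * X)%E]lap0 mule0.
Qed.

Lemma flow_area_pos (s t : R) : 0 < s -> s <= t -> flow_area t = flow_area s.
Proof.
move=> s0 st.
have d (r : R) : s <= r -> is_derive r 1 (flow_area : R -> R^o) 0.
  by move=> sr; apply: is_derive_flow_area; exact: lt_le_trans sr.
have [r _] : exists2 r, r \in `[s, t] & flow_area t - flow_area s = 0 * (t - s).
  apply: (@MVT_segment R flow_area (cst 0) s t st) => [r|].
    by rewrite in_itv /= => /andP[sr _]; apply: d; exact: ltW.
  apply: derivable_within_continuous => r; rewrite in_itv /= => /andP[sr _].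
  by have [] := d r sr.
by rewrite mul0r => /eqP; rewrite subr_eq0 => /eqP.
Qed.

(** The derivative of the area is known at positive times only, so time 0 is joined by continuity of
    the integral, dominated by means of the bound from [flow_range]. *)
Lemma flow_area_cst (t : R) : 0 <= t -> flow_area t = flow_area 0.
Proof.
have [B B0 pB] := continuous_M_bounded cM (flow_continuous (lexx 0)).
have pt (s : R) (x : M) : 0 <= s -> `|p s x| <= B.
  move=> s0; rewrite -[p s x]subr0; apply: (flow_range h_flat sol cM (lexx 0) s0 B0) => y.
  by rewrite subr0.
(* the flow is reflected at [t = 0] so that [0] becomes an interior time *)
pose F (s : R) (x : T) := expR (2 * p `|s| x).
have cg : {in `](-1), 1[%classic, continuous (fun s : R => \int[mu]_x F s x)}.
  apply: (@continuity_under_integral R _ T mu F [set: T] measurableT (-1) 1 _ _ (cst (expR (2 * B)))).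
  - by move=> s _; apply: (continuous_M_integrable cM mu_area); apply: exp_flow_continuous.
  - apply: aeW => x _ s _.
    apply: (@continuous_comp R R R (fun s => 2 * p `|s| x) expR); last exact: continuous_expR.
    apply: cvgM; first exact: cvg_cst.
    move=> A /(@continuous_flow R M h p sol (`|s|, x) (normr_ge0 s)) nA.
    have nA' : nbhs (`|s|, x) (fun z : R * M => 0 <= z.1 -> A (p z.1 z.2)) := nA.
    have ct : (fun r : R => (`|r|, x : M)) @ s --> (`|s|, x : M).
      by apply: (@cvg_pair _ _ _ (nbhs s) (nbhs `|s|) (nbhs (x : M)) _ _ _
        (fun r : R => `|r|) (cst (x : M))); [exact: norm_continuous|exact: cvg_cst].
    change (nbhs s (fun r => A (p `|r| x))).
    have n2 : nbhs s (fun r => 0 <= `|r| -> A (p `|r| x)) := ct _ nA'.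
    by apply: (filterS _ n2) => r; exact.
  - by apply: (continuous_M_integrable cM mu_area (u := cst (expR (2 * B)))); exact: cst_continuous.
  - move=> s _; apply: aeW => x _; rewrite /F /= ger0_norm ?expR_ge0// ler_expR ler_pM2l//.
    by apply: le_trans (ler_norm _) _; exact: pt.
have c0 : (fun s : R => \int[mu]_x F s x) @ 0^'+ --> flow_area 0.
  have -> : flow_area 0 = \int[mu]_x F 0 x by rewrite /F normr0.
  apply: cvg_at_right_filter; apply: cg; rewrite inE /= in_itv /=; apply/andP; split; lra.
have F1 : flow_area 0 = flow_area 1.
  apply: (@cvg_unique R (@Rhausdorff R) _ _ _ _ c0).
  apply: cvg_near_cst; near=> s.
  have s0 : 0 < s by near: s; exact: nbhs_right_gt.
  have s1 : s <= 1 by near: s; exact: nbhs_right_le.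
  by rewrite /F gtr0_norm// (flow_area_pos s0 s1).
rewrite le_eqVlt => /predU1P[<-//|t0]; rewrite F1.
by have [t1|/ltW t1] := leP t 1; [symmetry; exact: flow_area_pos|exact: flow_area_pos].
Unshelve. all: by end_near. Qed.

End Conservation.

(** * Signs taken by the exponent of an area-preserving conformal factor *)

Section AreaSign.
Context {R : realType} {M : smooth_surface R}.
Local Notation P := 'rV[R]_2.
Local Notation T := (g_sigma_algebraType (@open M)).
Local Notation lam := ((@lebesgue_measure R) \x (@lebesgue_measure R))%E.
Hypothesis cM : compact [set: M].
Variables (h : riemannian_metric M) (mu : {measure set T -> \bar R}).
Hypothesis mu_area : is_area_measure h mu.

(** On a small coordinate square the density stays above half of its positive value at the
    centre. *)
Lemma area_gt0 : (0 < mu [set: T])%E.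
Proof.
pose x : M := point; pose phi := chart_at x.
have aphi : atlas phi := chart_atP x; have dx : cdom phi x := cdom_chart_at x.
set y0 := cmap phi x; have ry : cran phi y0 := cran_cmap dx.
pose z0 : R * R := (y0 0 0, y0 0 1).
have z0E : row2 z0 = y0 by rewrite row2E [RHS]rowE2.
have rz : (@row2 R @^-1` cran phi) z0 by rewrite /= z0E.
pose e := area_density h phi z0 / 2.
have d0 : 0 < area_density h phi z0.
  by rewrite sqrtr_gt0; exact: (detg_gt0 (gmat_sym h aphi) (gmat_pos h aphi)).
have e0 : 0 < e by rewrite divr_gt0.
have /cvgrPdist_le /(_ e e0) n1 := area_density_continuous (h := h) aphi rz.
have n2 : nbhs z0 (@row2 R @^-1` cran phi) by apply: open_nbhs_nbhs; split=> //; exact: open_ran.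
have [r /= r0 rH] := (nbhs_ballP z0 _).1 (filterI n1 n2).
pose a0 := y0 0 0; pose a1 := y0 0 1; pose S := ball a0 r `*` ball a1 r.
have mS : measurable S by apply: measurableX; apply: open_measurable; exact: ball_open.
have mran := open_measurable_prod (@open_ran R M phi).
have mcd := @measurable_cdom R M phi.
apply: (@lt_le_trans _ _ (mu (cdom phi : set T))); last by apply: le_measure => //; exact: mem_set.
rewrite (area_chart mu_area aphi mcd (@subset_refl _ _)).
have -> : @row2 R @^-1` cran phi `&` (cinv phi \o @row2 R) @^-1` cdom phi = @row2 R @^-1` cran phi.
  by apply/seteqP; split=> [z []//|z zr]; split=> //; exact: cdom_cinv.
have md : measurable_fun (@row2 R @^-1` cran phi) (area_density h phi).
  by apply: measurable_on_open; [exact: open_ran|move=> z zr; exact: area_density_continuous].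
have Sr : S `<=` @row2 R @^-1` cran phi by move=> z Sz; have [] := rH z Sz.
apply: (@lt_le_trans _ _ (\int[lam]_(z in S) (cst e%:E) z)%E).
  by rewrite integral_cst_square ?ltW// lte_fin !mulr_gt0// mulr2n addr_gt0.
apply: (@le_trans _ _ (\int[lam]_(z in S) (area_density h phi z)%:E)%E).
  apply: ge0_le_integral => //.
  - by move=> z _; rewrite lee_fin ltW.
  - by apply/measurable_EFinP; exact: measurable_funS Sr md.
  - move=> z Sz; have [/= H _] := rH z Sz; rewrite lee_fin.
    by move: H; rewrite ler_norml => /andP[_]; rewrite /e; lra.
apply: ge0_subset_integral => //; first exact/measurable_EFinP.
by move=> z _; rewrite lee_fin sqrtr_ge0.
Qed.

(** If [u] had a strict sign, its extremum on the compact surface would keep e^(2u) away from 1, and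
    the integral would differ from the area, which is positive and finite. *)
Lemma exp_area_sign (u : M -> R) : continuous u ->
  (\int[mu]_x (expR (2 * u x))%:E = mu [set: T])%E ->
  (exists x, u x <= 0) /\ (exists x, 0 <= u x).
Proof.
move=> cu; have a0 := area_gt0; have afin := area_finite mu_area cM.
have E : mu [set: T] = (fine (mu [set: T]))%:E by rewrite fineK// ge0_fin_numE.
move: a0; rewrite E lte_fin; set A := fine _ => A0 I.
have ce : measurable_fun [set: T] (fun x : T => (expR (2 * u x))%:E).
  apply/measurable_EFinP; apply: measurable_continuous => // x.
  apply: (@continuous_comp M R R (fun x => 2 * u x) expR); last exact: continuous_expR.
  by apply: cvgM; [exact: cvg_cst|exact: cu].
have wu : {within [set: M], continuous u} by exact: continuous_subspaceT.
have M0 : [set: M] !=set0 by exists point.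
split; apply: contrapT => /forallNP nu.
- have [x _ xmin] := compact_EVT_min M0 cM wu.
  have ux : 0 < u x by rewrite ltNge; apply/negP; exact: nu.
  have : (\int[mu]_(y in [set: T]) (cst (expR (2 * u x))%:E) y <= A%:E)%E.
    rewrite -I; apply: ge0_le_integral => //.
    - by move=> y _; rewrite /= lee_fin expR_ge0.
    - by move=> y _; rewrite /= lee_fin ler_expR ler_pM2l// xmin// inE.
  rewrite integral_cst// E -EFinM lee_fin -/A leNgt => /negP; apply.
  by rewrite ltr_pMl// expR_gt1 mulr_gt0.
- have [x _ xmax] := compact_EVT_max M0 cM wu.
  have ux : u x < 0 by rewrite ltNge; apply/negP; exact: nu.
  have : (A%:E <= \int[mu]_(y in [set: T]) (cst (expR (2 * u x))%:E) y)%E.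
    rewrite -I; apply: ge0_le_integral => //.
    by move=> y _; rewrite /= lee_fin ler_expR ler_pM2l// xmax// inE.
  rewrite integral_cst// E -EFinM lee_fin -/A leNgt => /negP; apply.
  by rewrite gtr_pMl// expR_lt1 nmulr_llt0.
Qed.

End AreaSign.

(** * Iterated halving of the oscillation *)

Section Decay.
Context {R : realType} {M : smooth_surface R}.
Variables (h : riemannian_metric M) (p : R -> M -> R).
Hypotheses (cM : compact [set: M]) (h_flat : flat h).
Hypothesis sol : normalized_ricci_flow_solution h p.
Variables (D B : R).
Hypotheses (D0 : 0 < D) (gD : forall x y, grad_dist h D x y).
Hypotheses (B0 : 0 <= B) (pB : forall x, `|p 0 x| <= B).

(** After this lapse [flow_gradient] gives T e^(-2B) |grad p|^2 at most w^2 / 2, that is, a gradient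
    of at most w / (2 D), hence an oscillation of at most w / 2. *)
Let T := 2 * D ^+ 2 * expR (2 * B).

Let T0 : 0 < T. Proof. by rewrite !mulr_gt0// ?exprn_gt0// expR_gt0. Qed.

Lemma flow_le t x : 0 <= t -> `|p t x| <= B.
Proof.
move=> t0; rewrite -[p t x]subr0; apply: (flow_range h_flat sol cM (lexx 0) t0 B0) => y.
by rewrite subr0.
Qed.

Lemma flow_osc_half s w : 0 < s -> 0 <= w -> (forall x y, `|p s x - p s y| <= w) ->
  forall x y, `|p (s + T) x - p (s + T) y| <= w / 2.
Proof.
move=> s0 w0 ps x y; have sT : s <= s + T by rewrite lerDl ltW.
have t0 := lt_le_trans s0 sT.
have S0 : 0 <= w / (2 * D) by rewrite divr_ge0// ltW// mulr_gt0.
have := gD y x (C1_flow sol t0) S0.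
have -> : D * (w / (2 * D)) = w / 2 by field; rewrite gt_eqF.
apply=> z; have := flow_gradient h_flat sol cM s0 sT w0 (fun x => ps x point) z.
rewrite addrC addKr; set G := gradsq _ _ _; set q := p _ z => H.
have [G0|G0] := leP G 0; first by apply: le_trans G0 (sqr_ge0 _).
have H1 : 2 * D ^+ 2 * G <= 2^-1 * w ^+ 2.
  (* The factor e^(2B) built into [T] compensates the weight e^(-2p), since [B] bounds [p] at all
     times. *)
  have k1 : 1 <= expR (2 * B) * expR (- 2 * q).
    rewrite -expRD -[leLHS]expR0 ler_expR.
    by have := flow_le z (ltW t0); rewrite -/q ler_norml => /andP[qB Bq]; lra.
  apply: le_trans H; rewrite /T.
  have -> : 2 * D ^+ 2 * expR (2 * B) * (expR (- 2 * q) * G) =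
     2 * D ^+ 2 * ((expR (2 * B) * expR (- 2 * q)) * G) by ring.
  by rewrite ler_pM2l ?mulr_gt0 ?exprn_gt0// ler_peMl// ltW.
have -> : (w / (2 * D)) ^+ 2 = (2^-1 * w ^+ 2) / (2 * D ^+ 2) by field; rewrite gt_eqF.
by rewrite ler_pdivlMr ?mulr_gt0 ?exprn_gt0// mulrC.
Qed.

Lemma flow_osc n s : 0 < s -> forall x y, `|p (s + n%:R * T) x - p (s + n%:R * T) y| <= 2 * B / 2 ^+ n.
Proof.
elim: n s => [|n IH] s s0 x y.
  rewrite mul0r addr0 expr0 divr1; apply: le_trans (ler_normB _ _) _.
  by have := flow_le x (ltW s0); have := flow_le y (ltW s0); lra.
have s1 : 0 < s + n%:R * T by rewrite ltr_pwDl// mulr_ge0// ltW.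
have w0 : 0 <= 2 * B / 2 ^+ n by rewrite divr_ge0 ?mulr_ge0 ?exprn_ge0.
have -> : s + n.+1%:R * T = s + n%:R * T + T by rewrite -natr1 mulrDl mul1r addrA.
have -> : 2 * B / 2 ^+ n.+1 = 2 * B / 2 ^+ n / 2 by rewrite exprSr invfM mulrA.
exact: flow_osc_half s1 w0 (IH s s0) x y.
Qed.

Lemma flow_decay : (forall t, 0 <= t -> (exists x, p t x <= 0) /\ (exists x, 0 <= p t x)) ->
  forall t x, 0 <= t -> `|p t x| <= 4 * B * expR (- (ln 2 / (2 * T)) * t).
Proof.
move=> sgn t x t0.
(* Counting lapses of [2 * T] rather than [T] leaves at least half of [t] before the first halving,
   so the starting time [t - n%:R * T] is positive, as [flow_osc] requires. *)
pose n := Num.truncn (t / (2 * T)).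
have T2 : 0 < 2 * T by rewrite mulr_gt0.
have /andP[n1 n2] : n%:R <= t / (2 * T) < n.+1%:R by apply: truncn_itv; rewrite divr_ge0// ltW.
have step : `|p t x| <= 2 * B / 2 ^+ n.
  (* The case [n = 0] includes [t = 0], where no positive starting time exists; there the bound [B]
     is enough. *)
  have [->|nn] := eqVneq n 0%N; first by rewrite expr0 divr1; have := flow_le x t0; have := B0; lra.
  have s0 : 0 < t - n%:R * T.
    have nT : 0 < n%:R * T by rewrite mulr_gt0// ltr0n lt0n.
    by move: n1; rewrite ler_pdivlMr//; lra.
  have osc a b : `|p t a - p t b| <= 2 * B / 2 ^+ n.
    by have := flow_osc n s0 a b; rewrite subrK.
  have [[a pa] [b pb]] := sgn t t0.
  have := osc x a; have := osc x b; rewrite !ler_norml => /andP[H1 H2] /andP[H3 H4].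
  apply/andP; split; lra.
apply: le_trans step _.
have e2 : (2 : R) ^+ n = expR (n%:R * ln 2) by rewrite mulrC expRM_natr lnK// posrE.
(* The extra factor 2 pays for rounding [t / (2 * T)] down to [n]. *)
have -> : 4 * B = 2 * B * expR (ln 2) by rewrite lnK ?posrE//; lra.
rewrite -[leRHS]mulrA; apply: ler_wpM2l; first by rewrite mulr_ge0.
rewrite e2 -expRN -expRD ler_expR.
have l2 : 0 < ln 2 :> R by rewrite ln_gt0// ltr1n.
have -> : ln 2 + - (ln 2 / (2 * T)) * t = - (t / (2 * T) - 1) * ln 2.
  by field; rewrite gt_eqF.
rewrite -mulNr ler_pM2r// lerN2 lerBlDr natr1; exact: ltW.
Qed.

End Decay.

Theorem theorem10 (R : realType) (M : smooth_surface R)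
    (h g0 : riemannian_metric M) (p0 : M -> R) :
  compact [set: M] -> connected [set: M] -> has_euler_char M 0 ->
  flat h -> conformal p0 h g0 ->
  (exists a : \bar R, has_area g0 a /\ has_area h a) ->
  exists c C : R, 0 < c /\ 0 < C /\
    forall p : R -> M -> R,
      normalized_ricci_flow_solution h p -> (forall x, p 0 x = p0 x) ->
      forall t : R, 0 <= t ->
        (ereal_sup [set (`|p t x|)%:E | x in [set: M]]
          <= (c * expR (- C * t))%:E)%E.
Proof.
move=> cM kM _ h_flat cg [a [[nu nu_area nuT] [mu mu_area muT]]].
(* Continuity of [p0] is obtained from a solution, yet the constants precede the choice of one. So
   existence is decided first; without a solution any positive constants do. *)
have [[q [solq q0]]|nosol] := pselect (exists q : R -> M -> R,
    normalized_ricci_flow_solution h q /\ forall x, q 0 x = p0 x); last first.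
  by exists 1, 1; split=> //; split=> // p sol p0E; exfalso; apply: nosol; exists p.
have cp0 : continuous p0.
  have -> : p0 = q 0 by apply/funext => x; rewrite q0.
  exact: flow_continuous solq _ (lexx 0).
have [D D0 gD] := osc_gradient h cM kM.
have [B B0 pB] := continuous_M_bounded cM cp0.
(* Both constants involve only [D], which comes from [h], and the bound [B] of [p0]. Adding 1 keeps
   the first one positive, as [B] is only known to be nonnegative. *)
exists (4 * B + 1), (ln 2 / (2 * (2 * D ^+ 2 * expR (2 * B)))).
split; first by rewrite ltr_wpDl// mulr_ge0.
split.
  by rewrite divr_gt0 ?ln_gt0 ?ltr1n// !mulr_gt0 ?exprn_gt0 ?expR_gt0.
move=> p sol pp0 t t0.
have {}pB x : `|p 0 x| <= B by rewrite pp0.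
have sgn s : 0 <= s -> (exists x, p s x <= 0) /\ (exists x, 0 <= p s x).
  move=> s0; apply: (exp_area_sign cM mu_area); first exact: (flow_continuous sol).
  have iE r : 0 <= r -> (\int[mu]_x (expR (2 * p r x))%:E = (flow_area mu p r)%:E)%E.
    move=> r0; rewrite /flow_area /Rintegral fineK//; apply: integrable_fin_num => //.
    by apply: (continuous_M_integrable cM mu_area); exact: (exp_flow_continuous sol r0).
  rewrite (iE s s0) (flow_area_cst cM mu_area h_flat sol s0) -(iE 0 (lexx 0)) muT -nuT.
  rewrite (area_conformal cg cp0 mu_area nu_area cM).
  by apply: eq_integral => x _; rewrite pp0.
apply: ub_ereal_sup => _ [x _ <-]; rewrite lee_fin.
apply: le_trans (flow_decay cM h_flat sol D0 gD B0 pB sgn x t0) _.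
by rewrite ler_wpM2r ?expR_ge0// lerDl.
Qed.
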